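(* There is a universal constant $C$ such that the following holds for every $n\ge1$. Let $E$ be a symmetric function space on $\Omega_n=\{-1,1\}^n$ such that either (i) $E$ is 2-concave with constant $1$, or (ii) $E$ is 2-convex with constant $1$ and $q$-concave with constant $1$ for some $q\ge2$. Put $K_E=1$ in case (i) and $K_E=Cq$ in case (ii) (if $E=L^q(\Omega_n)$, $q>2$, one may even take $K_E=C\sqrt q$). Let $T$ belong to the $*$-algebra $M_n'$ spanned by the $n$ fermions $Q_1',\dots,Q_n'$. Then $$\Vert T-\tau_n(T)\mathrm{Id}\Vert_{C_E}\le\frac{\pi}{2}K_E\,\big\Vert\,|\nabla_sT|\,\big\Vert_{C_E}$$ and, for $0<\alpha<\frac12$, with $K_\alpha=\frac1{\Gamma(1-\alpha)}\int_0^{\pi/2}(-\log\cos\theta)^{-\alpha}d\theta$, $$\Vert N'^{\alpha}(T)\Vert_{C_E}\le K_\alpha K_E\,\big\Vert\,|\nabla_sT|\,\big\Vert_{C_E}.$$ Moreover, if $C_E$ is UMD, then $\Vert N'^{1/2}(T)\Vert_{C_E}\le H_EK_E\,\big\Vert\,|\nabla_sT|\,\big\Vert_{C_E}$.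
   Context: $\Omega_n=\{-1,1\}^n$ carries the uniform probability. A symmetric function space $E$ on $\Omega_n$ is the space of complex functions on $\Omega_n$ with a norm making it a Banach lattice ($|f|\le|g|$ implies $\Vert f\Vert_E\le\Vert g\Vert_E$) and with $\Vert f\circ\sigma\Vert_E=\Vert f\Vert_E$ for every permutation $\sigma$ of the set $\Omega_n$. $E$ is $p$-convex with constant $M$ if $\Vert(\sum_i|v_i|^p)^{1/p}\Vert_E\le M(\sum_i\Vert v_i\Vert_E^p)^{1/p}$, and $q$-concave with constant $M$ if $(\sum_i\Vert v_i\Vert_E^q)^{1/q}\le M\Vert(\sum_i|v_i|^q)^{1/q}\Vert_E$, for all finite families in $E$. $\mathcal{M}_{2^n}=\mathcal{M}_2\otimes\cdots\otimes\mathcal{M}_2$ is the algebra of complex $2^n\times2^n$ matrices, with normalized trace $\tau_n$. $C_E$ is $\mathcal{M}_{2^n}$ with norm $\Vert S\Vert_{C_E}=\Vert(s_k(S))_{1\le k\le2^n}\Vert_E$, $s_k(S)$ being the eigenvalues of $|S|=(S^*S)^{1/2}$ in decreasing order and $\Omega_n$ being identified with $\{1,\dots,2^n\}$. Let $U=\begin{pmatrix}1&0\\0&-1\end{pmatrix}$, $Q=\begin{pmatrix}0&1\\1&0\end{pmatrix}$ and $Q_j'=U\otimes\cdots\otimes U\otimes Q\otimes \mathrm{Id}\otimes\cdots\otimes\mathrm{Id}$ ($U$ in the first $j-1$ factors, $Q$ in the $j$-th). The $Q_j'$ are hermitian, unitary and pairwise anticommuting. For $A=\{i_1<\cdots<i_k\}\subset\{1,\dots,n\}$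 let $Q_A'=Q_{i_1}'\cdots Q_{i_k}'$, $Q_\emptyset'=\mathrm{Id}$. $M_n'$ is the $*$-algebra spanned by the $Q_j'$; the $Q_A'$ form a linear basis of it. On $M_n'$ define linearly $D_j'(Q_A')=Q_j'Q_A'$ if $j\in A$ and $0$ otherwise; $N'(Q_A')=|A|Q_A'$, $N'^\alpha(Q_A')=|A|^\alpha Q_A'$ for $A\neq\emptyset$, $N'^\alpha(\mathrm{Id})=0$. Finally $|\nabla_sT|=\big(\sum_{j=1}^n|D_j'(T)^*|^2+|D_j'(T)|^2\big)^{1/2}$, where $|S|^2=S^*S$. $H_E$ is defined by $\sqrt{2\pi}H_E=\Vert L_\varphi\otimes\mathrm{Id}_{C_E}\Vert$ on $L^2(\mathbb{R}/2\pi\mathbb{Z},C_E)$, where $L_\varphi g(x)=\mathrm{p.v.}\int\varphi(\theta)g(x-\theta)d\theta$ with $\varphi(\theta)=1_{[-\frac\pi2,\frac\pi2]}(\theta)\,\mathrm{sgn}(\theta)(-\log\cos\theta)^{-1/2}$. UMD is the usual unconditional martingale differences property. *)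

(* Defs.v *)
From HB Require Import structures.
From mathcomp Require Import all_boot all_order all_algebra.
From mathcomp Require Import perm vector sesquilinear spectral complex.
From mathcomp Require Import all_classical all_reals all_analysis.

Set Implicit Arguments.
Unset Strict Implicit.
Unset Printing Implicit Defensive.

Import Order.TTheory GRing.Theory Num.Theory.
Import numFieldNormedType.Exports.
Import ComplexField.Normc.

Local Open Scope classical_set_scope.
Local Open Scope ring_scope.
Local Open Scope complex_scope.

(* The discrete cube {-1,1}^n; the coordinate k : 'I_2 stands for the sign
   (-1)^k. *)
Definition Omega (n : nat) : finType := {ffun 'I_n -> 'I_2}.

(* Complex 2^n x 2^n matrices: #|Omega n| = 2^n.  The bijection enum_rank
   identifies the points of the cube with row and column indices. *)
Notation cubemx R n := 'M[R[i]]_(#|Omega n|).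

Section SymmetricSpaces.
Variables (R : realType) (n : nat).

(* Completeness is automatic, the space being finite-dimensional. *)
Record symSpace := SymSpace {
  snorm :> {ffun Omega n -> R[i]} -> R;
  snorm_eq0 : forall f, snorm f = 0 -> f = [ffun=> 0];
  snormD : forall f g : {ffun Omega n -> R[i]},
    snorm [ffun w => f w + g w] <= snorm f + snorm g;
  snormZ : forall (c : R[i]) (f : {ffun Omega n -> R[i]}),
    snorm [ffun w => c * f w] = normc c * snorm f;
  snorm_lattice : forall f g : {ffun Omega n -> R[i]},
    (forall w, normc (f w) <= normc (g w)) -> snorm f <= snorm g;
  snorm_perm : forall (s : {perm Omega n}) (f : {ffun Omega n -> R[i]}),
    snorm [ffun w => f (s w)] = snorm f }.

Definition lp_sum (p : R) (m : nat) (v : 'I_m -> {ffun Omega n -> R[i]}) :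
    {ffun Omega n -> R[i]} :=
  [ffun w => ((\sum_(k < m) normc (v k w) `^ p) `^ p^-1)%:C].

Definition pconvex (E : symSpace) (p M : R) : Prop :=
  forall (m : nat) (v : 'I_m -> {ffun Omega n -> R[i]}),
    E (lp_sum p v) <= M * (\sum_(k < m) E (v k) `^ p) `^ p^-1.

Definition qconcave (E : symSpace) (q M : R) : Prop :=
  forall (m : nat) (v : 'I_m -> {ffun Omega n -> R[i]}),
    (\sum_(k < m) E (v k) `^ q) `^ q^-1 <= M * E (lp_sum q v).

(* E is L^q of the uniform probability on the cube. *)
Definition is_Lq (E : symSpace) (q : R) : Prop :=
  forall f, E f =
    ((#|Omega n|%:R)^-1 * \sum_(w : Omega n) normc (f w) `^ q) `^ q^-1.

(* K is one of the admissible values of the constant K_E. *)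
Inductive admissible_KE (C : R) (E : symSpace) : R -> Prop :=
| KE_2concave : qconcave E 2 1 -> admissible_KE C E 1
| KE_2convex (q : R) : 2 <= q -> pconvex E 2 1 -> qconcave E q 1 ->
    admissible_KE C E (C * q)
| KE_Lq (q : R) : 2 < q -> is_Lq E q -> admissible_KE C E (C * Num.sqrt q).

End SymmetricSpaces.

Section Schatten.
Variable R : realType.
Local Open Scope sesquilinear_scope.

Definition sqmodmx N (S : 'M[R[i]]_N) : 'M[R[i]]_N := (S ^t*) *m S.

(* Continuous functional calculus: the positive square root of a positive
   semidefinite matrix, read off its unitary diagonalization. *)
Definition sqrtmx N (A : 'M[R[i]]_N) : 'M[R[i]]_N :=
  invmx (spectralmx A) *m diag_mx (map_mx sqrtC (spectral_diag A))
    *m spectralmx A.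

Definition absmx N (S : 'M[R[i]]_N) : 'M[R[i]]_N := sqrtmx (sqmodmx S).

(* The eigenvalues of |S|, with multiplicity, in decreasing order. *)
Definition singvals N (S : 'M[R[i]]_N) : seq R :=
  sort (fun x y : R => y <= x)
    [seq complex.Re (spectral_diag (absmx S) 0 k) | k <- enum 'I_N].

Definition CEnorm n (E : symSpace R n) (S : cubemx R n) : R :=
  E [ffun w => ((singvals S)`_(enum_rank w))%:C].

Definition ntrace n (T : cubemx R n) : R[i] := \tr T / (2 ^ n)%N%:R.

End Schatten.

Section Fermions.
Variables (R : realType) (n : nat).
Local Open Scope sesquilinear_scope.

Definition U2 : 'M[R[i]]_2 := \matrix_(a, b)
  if a == b then (if a == 0 then 1 else -1) else 0.
Definition Q2 : 'M[R[i]]_2 := \matrix_(a, b) if a == b then 0 else 1.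

(* F_0 (x) ... (x) F_(n-1): the tensor basis is indexed by the cube and the
   entries are products of entries of the factors. *)
Definition tensmxs (F : 'I_n -> 'M[R[i]]_2) : cubemx R n :=
  \matrix_(a, b) \prod_(k < n) F k ((enum_val a : Omega n) k)
                                   ((enum_val b : Omega n) k).

Definition fermion (j : 'I_n) : cubemx R n :=
  tensmxs (fun k => if (k < j)%N then U2 else if k == j then Q2 else 1%:M).

(* The big operator runs over 'I_n in increasing order. *)
Definition fermion_set (A : {set 'I_n}) : cubemx R n :=
  \big[mulmx/1%:M]_(j < n | j \in A) fermion j.

Inductive fermion_alg : cubemx R n -> Prop :=
| fermion_alg_gen j : fermion_alg (fermion j)
| fermion_alg1 : fermion_alg 1%:M
| fermion_algD S T : fermion_alg S -> fermion_alg T -> fermion_alg (S + T)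
| fermion_algZ (c : R[i]) T : fermion_alg T -> fermion_alg (c *: T)
| fermion_algM S T : fermion_alg S -> fermion_alg T -> fermion_alg (S *m T)
| fermion_alg_adj T : fermion_alg T -> fermion_alg (T ^t*).

Definition fermion_basis : #|{set 'I_n}|.-tuple (cubemx R n) :=
  [tuple fermion_set (enum_val k) | k < #|{set 'I_n}|].

(* The linear map defined on fermion_alg by its values L A on the basis
   (fermion_set A); elsewhere its value is irrelevant. *)
Definition lin_ext (L : {set 'I_n} -> cubemx R n) (T : cubemx R n) :
    cubemx R n :=
  \sum_(A : {set 'I_n}) coord fermion_basis (enum_rank A) T *: L A.

Definition fermD (j : 'I_n) : cubemx R n -> cubemx R n :=
  lin_ext (fun A => if j \in A then fermion j *m fermion_set A else 0).

Definition number_pow (alpha : R) : cubemx R n -> cubemx R n :=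
  lin_ext (fun A => if A == finset.set0 then 0
                    else ((#|A|%:R : R) `^ alpha)%:C *: fermion_set A).

Definition grad_s (T : cubemx R n) : cubemx R n :=
  sqrtmx (\sum_(j < n) (sqmodmx ((fermD j T) ^t*) + sqmodmx (fermD j T))).

End Fermions.

Section Constants.
Variable R : realType.

Definition Gamma (s : R) : R :=
  \int[lebesgue_measure]_(t in `]0, +oo[) (t `^ (s - 1) * expR (- t)).

Definition Kalpha (alpha : R) : R :=
  (Gamma (1 - alpha))^-1 *
  \int[lebesgue_measure]_(t in `]0, pi / 2[) (- ln (cos t)) `^ (- alpha).

End Constants.

Section MatrixValued.
Variable R : realType.

(* F-measurability of a matrix-valued map, F a sigma-algebra on its domain. *)
Definition mx_measurable (T : Type) (F : set (set T)) N
    (g : T -> 'M[R[i]]_N) : Prop :=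
  forall i j (B : set R), measurable B ->
    F [set x | B (complex.Re (g x i j))] /\
    F [set x | B (complex.Im (g x i j))].

Definition mx_integral d (T : measurableType d)
    (mu : {measure set T -> \bar R}) (D : set T) N (g : T -> 'M[R[i]]_N) :
    'M[R[i]]_N :=
  \matrix_(i, j) ((\int[mu]_(x in D) complex.Re (g x i j))
                  +i* (\int[mu]_(x in D) complex.Im (g x i j))).

Definition Lp_norm d (T : measurableType d)
    (mu : {measure set T -> \bar R}) (D : set T) N (nrm : 'M[R[i]]_N -> R)
    (p : R) (g : T -> 'M[R[i]]_N) : \bar R :=
  ((\int[mu]_(x in D) (nrm (g x) `^ p)%:E) `^ p^-1)%E.

(* The matrix space normed by nrm has the UMD property: for each p in
   ]1, +oo[, the signed sums of every finite L^p-martingale difference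
   sequence are uniformly controlled.  The condition E[d_k | F_k] = 0 is
   spelled out on the sets of F_k. *)
Definition UMD N (nrm : 'M[R[i]]_N -> R) : Prop :=
  forall p : R, 1 < p -> exists beta : R,
  forall (d : measure_display) (T : measurableType d) (P : probability T R)
    (m : nat) (F : nat -> set (set T)) (dif : nat -> T -> 'M[R[i]]_N)
    (eps : nat -> bool),
  (forall k, sigma_algebra setT (F k)) ->
  (forall k, F k `<=` measurable) ->
  (forall k, F k `<=` F k.+1) ->
  (forall k, (k < m)%N -> mx_measurable (F k.+1) (dif k)) ->
  (forall k, (k < m)%N -> (Lp_norm P setT nrm p (dif k) < +oo)%E) ->
  (forall k A, (k < m)%N -> F k A -> mx_integral P A (dif k) = 0) ->
  (Lp_norm P setT nrm p
     (fun x => (\sum_(k < m) ((-1) ^+ eps k : R[i]) *: dif k x)%R)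
   <= beta%:E * Lp_norm P setT nrm p (fun x => (\sum_(k < m) dif k x)%R))%E.

Definition phi (t : R) : R :=
  if - (pi / 2) <= t <= pi / 2
  then Num.sg t * (- ln (cos t)) `^ (- 2^-1) else 0.

(* x |-> p.v. int phi(t) g(x - t) dt, the circle being [-pi, pi]; for g in L^2
   the limit exists almost everywhere. *)
Definition Lphi N (g : R -> 'M[R[i]]_N) (x : R) : 'M[R[i]]_N :=
  let tr (e : R) : 'M[R[i]]_N :=
    mx_integral lebesgue_measure [set t : R | e < `|t| <= pi]
      (fun t => (phi t)%:C *: g (x - t)) in
  \matrix_(i, j) (lim (complex.Re (tr e i j) @[e --> 0^'+])
                  +i* lim (complex.Im (tr e i j) @[e --> 0^'+])).

Definition circle_L2norm N (nrm : 'M[R[i]]_N -> R) (g : R -> 'M[R[i]]_N) :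
    \bar R :=
  Lp_norm lebesgue_measure `[0, 2 * pi] nrm 2 g.

Definition circle_L2_ball N (nrm : 'M[R[i]]_N -> R) : set (R -> 'M[R[i]]_N) :=
  [set g | [/\ mx_measurable (@measurable _ (measurableTypeR R)) g,
               (forall x, g (x + 2 * pi) = g x) &
               (circle_L2norm nrm g <= 1)%E]].

Definition Lphi_opnorm N (nrm : 'M[R[i]]_N -> R) : \bar R :=
  ereal_sup [set circle_L2norm nrm (Lphi g) | g in circle_L2_ball nrm].

Definition HE N (nrm : 'M[R[i]]_N -> R) : \bar R :=
  ((Num.sqrt (2 * pi))^-1%:E * Lphi_opnorm nrm)%E.

End MatrixValued.

(* Main.v *)
Require Import Defs.
From HB Require Import structures.
From mathcomp Require Import all_boot all_order all_algebra.
From mathcomp Require Import perm vector sesquilinear spectral complex.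
From mathcomp Require Import all_classical all_reals all_analysis.
From mathcomp Require Import measurable_realfun.
From mathcomp Require Import ring lra.

Set Implicit Arguments.
Unset Strict Implicit.
Unset Printing Implicit Defensive.

Import Order.TTheory GRing.Theory Num.Theory.
Import numFieldNormedType.Exports.

Local Open Scope classical_set_scope.
Local Open Scope ring_scope.
Local Open Scope complex_scope.

Local Notation normc := ComplexField.Normc.normc.
Local Open Scope sesquilinear_scope.

(* On the 2^n-dimensional space the fermions [Q_j] are half of a system of 2n
   anticommuting hermitian unitaries [Q_j, P_j].  Rotating all the planes
   [(Q_j, P_j)] by an angle [s] is conjugation by a unitary, hence an isometry of
   [C_E]; the conditional expectation onto the algebra of the [Q_j] is a
   contraction of [C_E].  For [T = sum_A t_A Q_A], applying both to
   [X = sum_j P_j D_j(T)] gives [- sum_A |A| (sin s) (cos s)^(|A| - 1) t_A Q_A],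
   and the integral of [|A| (sin s) (cos s)^(|A| - 1) (- ln cos s)^(- alpha)] is
   [Gamma(1 - alpha) |A|^alpha]: the norm of [N^alpha T] is controlled by that of
   [X].  For [alpha = 1/2] the weight [(- ln cos s)^(- alpha)] is not integrable;
   [L_phi] is then applied to the orbit of [X] under the rotations, a function on
   the circle.  Finally [X] is compared with the gradient by a Khintchine
   inequality for matrices whose signs can be flipped one at a time by unitary
   conjugations. *)

(** * Majorization and finite-dimensional Hahn-Banach *)

(** Matrix inequalities are reduced to scalar ones by one mechanism: the diagonal of a hermitian
    matrix in an orthonormal basis is a bistochastic average of its eigenvalues, and majorization
    controls such averages. Convexity and concavity of the space enter only as sub- and
    superadditivity of [rpow r] on nonnegative vectors. The obstacle is the Khintchine step. The
    terms P_j D_j(T) are not independent variables, but the norm of their sum is unchanged when a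
    single term changes sign, and the argument rests on this invariance. In case (i) the
    parallelogram identity suffices and yields the constant 1. In case (ii) a derivative of the
    squared norm is needed although the norm need not be differentiable; a Hahn-Banach functional
    replaces it, and q-concavity controls its growth. Nonhermitian terms are split into hermitian
    and antihermitian parts, which brings in the squares of D_j(T) and of its adjoint together. Case
    (ii) yields 4 sqrt q for [L^q] and for general spaces alike; for the latter it is weakened to 4
    q. At the exponent 1/2 the rotations produce the factor 2 Gamma(1/2), which has to absorb the
    sqrt (2 pi) in the definition of [HE]. *)

Lemma sort_ord_perm (T : eqType) (r : rel T) N (f : 'I_N -> T) x0 :
  exists p : {perm 'I_N}, forall k : 'I_N,
    nth x0 (sort r [seq f i | i <- enum 'I_N]) k = f (p k).
Proof.
have ss : size (sort r [seq f i | i <- enum 'I_N]) == N.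
  by rewrite size_sort size_map size_enum_ord.
have /tuple_permP[p /= sp] : perm_eq (Tuple ss) [tuple f i | i < N].
  by rewrite /= perm_sort.
exists p => k; rewrite sp (nth_map k) ?size_enum_ord//.
by rewrite nth_ord_enum tnth_mktuple.
Qed.

Section Majorization.
Variables (R : realFieldType) (N : nat) (F : ('I_N -> R) -> R).
(** Mixing with a single permutation is what symmetry and convexity provide. Stated this way, the
    hypothesis fits a symmetric norm, a subadditive [rpow r], and the opposite of a superadditive
    one. *)
Hypothesis Fperm_mix : forall (x : 'I_N -> R) (p : {perm 'I_N}) (s : R),
  (forall j, 0 <= x j) -> 0 <= s <= 1 ->
  F (fun j => (1 - s) * x j + s * x (p j)) <= F x.

(** Moving mass [t] from a larger coordinate to a smaller one is mixing with the transposition of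
    the two, in proportion [t / (x i - x k)]. *)
Lemma perm_mix_transfer (x : 'I_N -> R) (i k : 'I_N) (t : R) :
  (forall j, 0 <= x j) -> i != k -> 0 <= t <= x i - x k ->
  F (fun j => x j - t * (j == i)%:R + t * (j == k)%:R) <= F x.
Proof.
move=> x0 ik /andP[t0 tx].
have [t00|tn0] := eqVneq t 0.
  by rewrite t00; under eq_fun do rewrite !mul0r subr0 addr0.
have xik : 0 < x i - x k by rewrite (lt_le_trans _ tx)// lt_def tn0.
rewrite (_ : (fun j => _) =
  fun j => (1 - t / (x i - x k)) * x j + t / (x i - x k) * x (tperm i k j)).
  apply: Fperm_mix => //; rewrite divr_ge0 ?(ltW xik)//=.
  by rewrite ler_pdivrMr// mul1r.
apply: funext => j; case: tpermP => [->|->|/eqP ji /eqP jk].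
- by rewrite eqxx (negbTE ik) /=; field; rewrite gt_eqF.
- by rewrite eqxx eq_sym (negbTE ik) /=; field; rewrite gt_eqF.
- by rewrite (negbTE ji) (negbTE jk); ring.
Qed.

(* Hardy-Littlewood-Polya: each transfer makes one more coordinate agree with
   [y], and only [y] has to be sorted. *)
Lemma perm_mix_le_majorized (x y : 'I_N -> R) :
  (forall i, 0 <= x i) -> (forall i, 0 <= y i) ->
  (forall i j : 'I_N, (i <= j)%N -> y j <= y i) ->
  (forall l : 'I_N, \sum_(i < N | (i <= l)%N) y i
     <= \sum_(i < N | (i <= l)%N) x i) ->
  \sum_i y i = \sum_i x i -> F y <= F x.
Proof.
move=> + y0 ysort; have [m] := ubnP #|[pred i | y i != x i]|.
elim: m x => // m IH x; rewrite ltnS => cardm x0 xyl xyT.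
have [/forallP xy|/forallPn[i0 xyi0]] := boolP [forall i, y i == x i].
  by rewrite (_ : y = x)//; apply: funext => i; exact/eqP.
have [k0 xyk0] : exists k, x k < y k.
  apply/existsP; apply: contraNT xyi0 => /existsPn yx.
  have yx' i : 0 <= x i - y i by rewrite subr_ge0 leNgt yx.
  have /psumr_eq0P/(_ i0 isT)/eqP : \sum_i (x i - y i) = 0.
    by rewrite sumrB xyT subrr.
  by rewrite subr_eq0 eq_sym; apply.
(* [k] is the first coordinate where [x] falls short of [y]. Since the partial sums up to [k] do not
   fall short, some earlier coordinate [i] is in excess. *)
have [k xyk kmin] := @fintype.arg_minnP _ k0 (fun k => x k < y k)
  (fun k => nat_of_ord k) xyk0.
have ltk (j : 'I_N) : (j < k)%N -> y j <= x j.
  by move=> jk; rewrite leNgt; apply/negP => /kmin; rewrite leqNgt jk.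
have [i ik yxi] : exists2 i : 'I_N, (i < k)%N & y i < x i.
  apply/exists_inP; apply: contraTT (xyl k) => /exists_inPn yxk.
  rewrite -ltNge (bigD1 k)//= [ltRHS](bigD1 k)//= ltr_leD//.
  apply: ler_sum => j /andP[jk jnk]; rewrite leNgt yxk//.
  by change (j < k)%N; rewrite ltn_neqAle jk andbT.
have ink : i != k by rewrite -val_eqE /= ltn_eqF.
(* The largest transfer that overshoots neither target: one of the coordinates [i], [k] reaches [y],
   so the number of disagreements drops. *)
pose t : R := Num.min (x i - y i) (y k - x k).
have t1 : t <= x i - y i by rewrite ge_min lexx.
have t2 : t <= y k - x k by rewrite ge_min lexx orbT.
have t0 : 0 <= t by rewrite le_min !subr_ge0 !ltW.
have yki := ysort i k (ltnW ik).
pose x' j := x j - t * (j == i)%:R + t * (j == k)%:R.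
have x'i : x' i = x i - t by rewrite /x' eqxx (negbTE ink) /=; ring.
have x'k : x' k = x k + t by rewrite /x' eqxx eq_sym (negbTE ink) /=; ring.
have x'j j : j != i -> j != k -> x' j = x j.
  by move=> /negbTE ji /negbTE jk; rewrite /x' ji jk /=; ring.
have Fx' : F x' <= F x by apply: perm_mix_transfer => //; apply/andP; split; lra.
apply: le_trans Fx'; apply: IH.
- apply: leq_trans cardm; apply: proper_card; apply/properP; split.
    apply/fintype.subsetP => j; rewrite !inE.
    have [->|ji] := eqVneq j i; first by rewrite (lt_eqF yxi).
    have [->|jk] := eqVneq j k; first by rewrite (gt_eqF xyk).
    by rewrite x'j.
  have [xyik|xyik] := leP (x i - y i) (y k - x k).
    exists i; first by rewrite inE lt_eqF.
    rewrite inE negbK x'i; apply/eqP.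
    by move: xyik; rewrite /t => /min_idPl ->; ring.
  exists k; first by rewrite inE gt_eqF.
  rewrite inE negbK x'k; apply/eqP.
  by move/ltW: xyik; rewrite /t => /min_idPr ->; ring.
- move=> j; have [->|ji] := eqVneq j i.
    by rewrite x'i; have := y0 i; lra.
  have [->|jk] := eqVneq j k; first by rewrite x'k; have := x0 k; lra.
  by rewrite x'j.
(* From [k] on, the two sides of the transfer do not lower the partial sums. Before [k] no
   coordinate is in deficit, so the sums are compared term by term. *)
- move=> l; have [kl|lk] := leqP k l.
    apply: le_trans (xyl l) _; rewrite big_split/= sumrB.
    rewrite -!mulr_sumr -addrA lerDl addrC subr_ge0.
    rewrite (bigD1 i) ?(leq_trans (ltnW ik))//= eqxx big1 => [|j /andP[_ /negbTE->]//].
    by rewrite (bigD1 k)//= eqxx big1 => [|j /andP[_ /negbTE->]//].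
  apply: ler_sum => j jl; have jk := leq_ltn_trans jl lk.
  have [->|ji] := eqVneq j i; first by rewrite x'i; lra.
  rewrite x'j ?ltk//; apply/eqP => jk'; move: jk; by rewrite jk' ltnn.
- rewrite xyT big_split/= sumrB -!mulr_sumr.
  have sE m' : \sum_(j < N) (j == m')%:R = 1 :> R.
    by rewrite (bigD1 m')//= eqxx big1 ?addr0// => j /negbTE ->.
  by rewrite !sE; ring.
Qed.

Lemma exists_sorting_perm (x : 'I_N -> R) :
  exists p : {perm 'I_N}, forall i j : 'I_N, (i <= j)%N -> x (p j) <= x (p i).
Proof.
pose s := sort (fun a b : R => b <= a) [seq x i | i <- enum 'I_N].
have [p sE] := sort_ord_perm (fun a b : R => b <= a) x 0.
exists p => i j ij; rewrite -!sE.
have ss : size s = N by rewrite size_sort size_map size_enum_ord.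
have srt : sorted (fun a b : R => b <= a) s.
  by apply: sort_sorted => a b; rewrite orbC le_total.
apply: (@sorted_leq_nth _ (fun a b : R => b <= a)) => //.
- by move=> a b c ab ca; exact: le_trans ca ab.
- by rewrite inE ss.
- by rewrite inE ss.
Qed.

(** The partial sums of the sorted averages have the form [\sum_j c j * x (r j)] with
    [0 <= c j <= 1] and total mass [l + 1]; they are largest when this mass sits on the [l + 1]
    largest entries of [x]. Hence [x] majorizes its averages. *)
Lemma perm_mix_le_bistochastic (D : 'I_N -> 'I_N -> R) (x : 'I_N -> R) :
  (forall i j, 0 <= D i j) -> (forall i, \sum_j D i j = 1) ->
  (forall j, \sum_i D i j = 1) -> (forall i, 0 <= x i) ->
  F (fun i => \sum_j D i j * x j) <= F x.
Proof.
move=> D0 Dr Dc x0; set y := fun i => _.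
have Fperm z (p : {perm 'I_N}) : (forall i, 0 <= z i) ->
    F (fun i => z (p i)) <= F z.
  move=> z0; have := Fperm_mix p z0 (s := 1); rewrite ler01 lexx => /(_ isT).
  by under eq_fun do rewrite subrr mul0r add0r mul1r.
have y0 i : 0 <= y i by apply: sumr_ge0 => j _; exact: mulr_ge0.
have [p yp] := exists_sorting_perm y; have [r xr] := exists_sorting_perm x.
have : F (y \o p) <= F (x \o r).
  apply: perm_mix_le_majorized => /=; [by []|by []|by []| |].
  - move=> l.
    under eq_bigr do rewrite /y (reindex_inj (@perm_inj _ r)) /=.
    rewrite exchange_big/=; under eq_bigr do rewrite -mulr_suml.
    pose c j := \sum_(i < N | (i <= l)%N) D (p i) (r j).
    have c0 j : 0 <= c j by apply: sumr_ge0.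
    have c1 j : c j <= 1.
      rewrite -(Dc (r j)) (reindex_inj (@perm_inj _ p)) /=.
      by rewrite [leRHS](bigID (fun i : 'I_N => (i <= l)%N))/= lerDl sumr_ge0.
    have cT : \sum_j c j = \sum_(j < N) (j <= l)%N%:R.
      rewrite exchange_big/= [RHS]big_mkcond/= big_mkcond/=.
      apply: eq_bigr => i _; case: ifP => // _.
      by rewrite -(Dr (p i)) [RHS](reindex_inj (@perm_inj _ r)).
    (* Subtracting this null sum recentres [x] at its entry of rank [l]; each term of the difference
       is then nonnegative. *)
    have e0 : \sum_(j < N) (x (r l) * ((j <= l)%N%:R - c j)) = 0.
      by rewrite -mulr_sumr sumrB -cT subrr mulr0.
    rewrite [X in _ <= X]big_mkcond/= -subr_ge0 -sumrB.
    rewrite -[X in _ <= X]subr0 -[X in _ - X]e0 -sumrB sumr_ge0// => j _.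
    rewrite -/(c j); case: leqP => jl /=.
      have := xr _ _ jl; have := c1 j.
      by move=> A B; have := mulr_ge0 (_ : 0 <= 1 - c j) (_ : 0 <= x (r j) - x (r l)); nra.
    by have := xr _ _ (ltnW jl); have := c0 j; nra.
  - transitivity (\sum_i y i); first by rewrite [RHS](reindex_inj (@perm_inj _ p)).
    transitivity (\sum_i x i); last by rewrite [LHS](reindex_inj (@perm_inj _ r)).
    by rewrite exchange_big/=; apply: eq_bigr => j _; rewrite -mulr_suml Dc mul1r.
move=> Fyx; apply: (@le_trans _ _ (F (y \o p))); last first.
  by apply: le_trans Fyx _; exact: Fperm.
have := Fperm (y \o p) p^-1%g; rewrite /comp.
by under eq_fun do rewrite permKV; apply.
Qed.

End Majorization.

(** The row deficits [r] and the column deficits [c] have the same total, so the rank-one matrix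
    [r i * c j] divided by that total fills both at once. *)
Lemma substochastic_le_bistochastic (R : realFieldType) N (D : 'I_N -> 'I_N -> R) :
  (forall i j, 0 <= D i j) -> (forall i, \sum_j D i j <= 1) ->
  (forall j, \sum_i D i j <= 1) ->
  exists D' : 'I_N -> 'I_N -> R, [/\ forall i j, D i j <= D' i j,
    forall i, \sum_j D' i j = 1 & forall j, \sum_i D' i j = 1].
Proof.
move=> D0 Dr Dc.
pose r i := 1 - \sum_j D i j; pose c j := 1 - \sum_i D i j.
have r0 i : 0 <= r i by rewrite subr_ge0.
have c0 i : 0 <= c i by rewrite subr_ge0.
have rc : \sum_i r i = \sum_j c j.
  by rewrite !sumrB [X in _ - X]exchange_big.
have [m0|mn0] := eqVneq (\sum_i r i) 0.
  exists D; split => // i; apply/eqP.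
    by rewrite eq_sym -subr_eq0; apply/eqP/(psumr_eq0P _ m0).
  by move: m0; rewrite rc eq_sym -subr_eq0 => m0; apply/eqP/(psumr_eq0P _ m0).
exists (fun i j => D i j + r i * c j / \sum_i r i); split.
- by move=> i j; rewrite lerDl divr_ge0 ?mulr_ge0 ?sumr_ge0.
- by move=> i; rewrite big_split/= -mulr_suml -mulr_sumr -rc mulfK// addrC subrK.
- move=> j; rewrite big_split/= -mulr_suml -mulr_suml mulrAC divff// mul1r.
  by rewrite addrC subrK.
Qed.

Section HahnBanach.
Variable R : realType.

Definition sublinear (V : lmodType R) (p : V -> R) :=
  (forall x y, p (x + y) <= p x + p y) /\
  (forall (t : R) x, 0 <= t -> p (t *: x) <= t * p x).

Lemma sublinear_ge (V : lmodType R) (p : V -> R) : sublinear p ->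
  [/\ p 0 = 0, forall (t : R) x, 0 <= t -> p (t *: x) = t * p x &
      forall x, - p (- x) <= p x].
Proof.
move=> [pD pZ].
have p0 : p 0 = 0.
  apply/le_anti/andP; split; first by have := pZ 0 0 (lexx _); rewrite scale0r mul0r.
  by have := pD 0 0; rewrite addr0 lerDl.
split=> // [t x t0|x]; last first.
  by have := pD x (- x); rewrite subrr p0; lra.
apply/le_anti/andP; split; first exact: pZ.
have [->|tn0] := eqVneq t 0; first by rewrite scale0r mul0r p0.
have tp : 0 < t by rewrite lt_def tn0.
have : p (t^-1 *: (t *: x)) <= t^-1 * p (t *: x) by apply: pZ; rewrite invr_ge0.
by rewrite scalerA mulVf// scale1r mulrC ler_pdivlMr// mulrC.
Qed.

(* [p'] is the greatest sublinear minorant of [p] with [p' (- e) = - p e]. *)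
Lemma sublinear_minorant (V : lmodType R) (p : V -> R) (e : V) : sublinear p ->
  exists p' : V -> R,
    [/\ sublinear p', forall x, p' x <= p x & p' (- e) <= - p e].
Proof.
move=> sp; have [p0 pZE pN] := sublinear_ge sp; have [pD pZ] := sp.
pose S x := [set p (x + t *: e) - t * p e | t in [set t : R | 0 <= t]].
have Sx x t : 0 <= t -> S x (p (x + t *: e) - t * p e) by move=> t0; exists t.
have Sne x : S x !=set0 by exists (p (x + 0 *: e) - 0 * p e); exact: Sx.
have Slb x : lbound (S x) (- p (- x)).
  move=> _ [t /= t0 <-]; rewrite -(pZE t)//.
  by have := pD (x + t *: e) (- x); rewrite addrAC subrr add0r; lra.
have le_S x t : 0 <= t -> inf (S x) <= p (x + t *: e) - t * p e.
  by move=> t0; apply: ge_inf; [exists (- p (- x))|exact: Sx].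
exists (fun x => inf (S x)); split.
- split=> [x y|c x c0].
    rewrite -lerBlDr; apply: lb_le_inf => // _ [t /= t0 <-].
    rewrite lerBlDr -lerBlDl; apply: lb_le_inf => // _ [s /= s0 <-].
    rewrite lerBlDr; apply: (le_trans (le_S _ (s + t) (addr_ge0 s0 t0))).
    have := pD (x + t *: e) (y + s *: e).
    rewrite (_ : x + t *: e + _ = x + y + (s + t) *: e); first by lra.
    by rewrite addrACA -scalerDl (addrC t).
  have [->|cn0] := eqVneq c 0.
    rewrite scale0r mul0r; apply: (le_trans (le_S _ 0 (lexx _))).
    by rewrite scale0r mul0r addr0 p0 subrr.
  have cp : 0 < c by rewrite lt_def cn0.
  rewrite mulrC -ler_pdivrMr//; apply: lb_le_inf => // _ [t /= t0 <-].
  rewrite ler_pdivrMr//; apply: (le_trans (le_S _ (c * t) (mulr_ge0 c0 t0))).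
  by rewrite -scalerA -scalerDr pZE// mulrBl [X in _ <= _ - X]mulrC mulrA [X in _ <= X - _]mulrC.
- by move=> x; apply: (le_trans (le_S _ 0 (lexx _))); rewrite scale0r addr0 mul0r subr0.
- by apply: (le_trans (le_S _ 1 ler01)); rewrite scale1r addNr p0 mul1r sub0r.
Qed.

(** The inequality [p (- e) <= - p e] survives the passage to a smaller sublinear functional, so the
    vectors can be treated one at a time. *)
Lemma sublinear_linear_along (V : lmodType R) (s : seq V) (p : V -> R) :
  sublinear p -> exists p' : V -> R, [/\ sublinear p', forall x, p' x <= p x &
    forall e, e \in s -> p' (- e) <= - p' e].
Proof.
move=> sp; elim: s => [|e s [p1 [sp1 p1p p1s]]]; first by exists p.
have [p2 [sp2 p2p p2e]] := sublinear_minorant e sp1.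
exists p2; split=> [//|x|f]; first exact: le_trans (p2p x) (p1p x).
rewrite inE => /predU1P[->|fs]; first by have := p2p e; lra.
by have := p1s _ fs; have := p2p f; have := p2p (- f); lra.
Qed.

(** Minorizing along [x0] secures the equality at that point. Minorizing next along the standard
    basis leaves a functional bounded above by the linear form with the same values on the basis,
    hence equal to it. *)
Lemma hahn_banach_rV n (p : 'rV[R]_n -> R) (x0 : 'rV[R]_n) : sublinear p ->
  exists a : 'I_n -> R, (forall x : 'rV_n, \sum_i a i * x 0 i <= p x) /\
    \sum_i a i * x0 0 i = p x0.
Proof.
move=> sp; have [p1 [sp1 p1p p1x0]] := sublinear_minorant x0 sp.
have [p2 [sp2 p2p p2s]] := sublinear_linear_along
  [seq delta_mx 0 i | i <- enum 'I_n] sp1.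
have [p20 p2Z p2N] := sublinear_ge sp2; have [p2D _] := sp2.
pose a i := p2 (delta_mx 0 i); exists a.
have ub x : p2 x <= \sum_i a i * x 0 i.
  rewrite {1}[x]row_sum_delta.
  have : p2 (\sum_(i < n) x 0 i *: delta_mx 0 i) <=
      \sum_(i < n) p2 (x 0 i *: delta_mx 0 i).
    elim/big_rec2: _ => [|i u v _ uv]; first by rewrite p20.
    by apply: (le_trans (p2D _ _)); rewrite lerD2l.
  move/le_trans; apply; apply: ler_sum => i _.
  have [x0i|x0i] := leP 0 (x 0 i); first by rewrite p2Z// mulrC.
  rewrite -[x 0 i]opprK scaleNr -scalerN p2Z ?oppr_ge0 ?(ltW x0i)//.
  have xN : 0 <= - x 0 i by rewrite oppr_ge0 ltW.
  have := p2s (delta_mx 0 i); rewrite map_f ?mem_enum// => /(_ isT).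
  by move=> /(ler_wpM2l xN); rewrite /a; lra.
have aN (x : 'rV[R]_n) : \sum_i a i * (- x) 0 i = - \sum_i a i * x 0 i.
  by rewrite -sumrN; apply: eq_bigr => i _; rewrite mxE mulrN.
have lb (x : 'rV[R]_n) : \sum_i a i * x 0 i <= p2 x.
  by have := ub (- x); rewrite aN; have := p2N x; lra.
have le_p (x : 'rV[R]_n) : \sum_i a i * x 0 i <= p x.
  exact: le_trans (lb x) (le_trans (p2p x) (p1p x)).
split=> //; apply/le_anti; rewrite le_p /=.
by have := lb (- x0); rewrite aN; have := p2p (- x0); lra.
Qed.

Lemma hahn_banach_fin (I : finType) (p : (I -> R) -> R) (x0 : I -> R) :
  (forall x y, p (fun i => x i + y i) <= p x + p y) ->
  (forall t x, 0 <= t -> p (fun i => t * x i) <= t * p x) ->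
  exists a : I -> R, (forall x : I -> R, \sum_i a i * x i <= p x) /\
    \sum_i a i * x0 i = p x0.
Proof.
move=> pD pZ.
pose f (x : 'rV[R]_#|I|) i := x 0 (enum_rank i).
pose g (x : I -> R) : 'rV[R]_#|I| := \row_k x (enum_val k).
have fg x : f (g x) = x by apply: funext => i; rewrite /f mxE enum_rankK.
have [|a [ap ax0]] := @hahn_banach_rV _ (p \o f) (g x0).
  split=> [x y|t x t0] /=.
    rewrite (_ : f (x + y) = fun i => f x i + f y i) //.
    by apply: funext => i; rewrite /f mxE.
  rewrite (_ : f (t *: x) = fun i => t * f x i); first exact: pZ.
  by apply: funext => i; rewrite /f mxE.
have sE (x : I -> R) : \sum_i a i * g x 0 i = \sum_i a (enum_rank i) * x i.
  rewrite (reindex enum_rank) /=; last exact/onW_bij/enum_rank_bij.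
  by apply: eq_bigr => i _; rewrite mxE enum_rankK.
exists (a \o enum_rank) => /=; split=> [x|]; rewrite -sE.
  by apply: (le_trans (ap _)); rewrite /= fg.
by rewrite ax0 /= fg.
Qed.

End HahnBanach.

(** * Symmetric norms on real vectors *)

Section Powers.
Variable R : realType.

(** Young's inequality for the product of [a] to the power [r] and 1, with conjugate exponents
    [1 / r] and [1 / (1 - r)]. *)
Lemma powR_le_tangent (r a : R) : 0 < r <= 1 -> 0 <= a ->
  a `^ r <= 1 + r * (a - 1).
Proof.
move=> /andP[r0 r1] a0; have [->|rn1] := eqVneq r 1.
  by rewrite powRr1// mul1r; lra.
have r'0 : 0 < 1 - r by rewrite subr_gt0 lt_def eq_sym rn1.
have := @conjugate_powR _ (a `^ r) 1 r^-1 (1 - r)^-1.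
rewrite powR_ge0 ler01 !invr_gt0 r0 r'0 !invrK addrC subrK.
move=> /(_ isT isT isT isT erefl).
by rewrite -powRrM mulfV ?gt_eqF// powRr1// powR1; lra.
Qed.

Lemma powR_ge_tangent (p a : R) : 1 <= p -> 0 <= a ->
  1 + p * (a - 1) <= a `^ p.
Proof.
move=> p1 a0; have p0 : 0 < p by rewrite (lt_le_trans ltr01).
have := @powR_le_tangent p^-1 (a `^ p); rewrite invr_gt0 p0 invf_le1// p1.
move=> /(_ isT (powR_ge0 _ _)); rewrite -powRrM mulfV ?gt_eqF// powRr1//.
move=> h; have := ler_wpM2l (ltW p0) h.
by rewrite mulrDr mulrA mulfV ?gt_eqF//; lra.
Qed.

Lemma powR_concave (r a b : R) : 0 < r <= 1 -> 0 < a -> 0 <= b ->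
  b `^ r <= a `^ r + r * a `^ (r - 1) * (b - a).
Proof.
move=> r01 a0 b0; have := powR_le_tangent r01 (divr_ge0 b0 (ltW a0)).
have ar0 : 0 <= a `^ r by exact: powR_ge0.
move=> /(ler_wpM2l ar0); rewrite -powRM ?divr_ge0 ?(ltW a0)//.
rewrite [a * (b / a)]mulrC divfK ?gt_eqF// => /le_trans; apply.
rewrite powRB ?(gt_eqF a0) ?implybT// powRr1 ?(ltW a0)//.
by rewrite le_eqVlt; apply/orP; left; apply/eqP; field; rewrite gt_eqF.
Qed.

Lemma powR_le_mono (r a b : R) : 0 <= r -> 0 <= a -> a <= b -> a `^ r <= b `^ r.
Proof. by move=> r0 a0 ab; apply: ge0_ler_powR; rewrite ?nnegrE// (le_trans a0). Qed.

Lemma powR2 (a : R) : 0 <= a -> a `^ 2 = a ^+ 2.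
Proof. by move=> a0; rewrite (powR_mulrn 2). Qed.

Lemma powRKV (r a : R) : 0 < r -> 0 <= a -> (a `^ r^-1) `^ r = a.
Proof. by move=> r0 a0; rewrite -powRrM mulVf ?gt_eqF// powRr1. Qed.

Lemma powRVK (r a : R) : 0 < r -> 0 <= a -> (a `^ r) `^ r^-1 = a.
Proof. by move=> r0 a0; rewrite -powRrM mulfV ?gt_eqF// powRr1. Qed.

End Powers.

Lemma normc_real (R : realType) (a : R) : normc a%:C = `|a|.
Proof. by rewrite /= expr0n addr0 sqrtr_sqr. Qed.

Section SymmetricNorms.
Variables (R : realType) (N : nat) (nrm : ('I_N -> R) -> R).
Implicit Types (x y u v : 'I_N -> R) (r : R).

Definition symmetric_norm : Prop :=
  [/\ forall x y, (forall i, `|x i| <= `|y i|) -> nrm x <= nrm y,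
      forall (p : {perm 'I_N}) x, nrm (fun i => x (p i)) = nrm x,
      forall x y, nrm (fun i => x i + y i) <= nrm x + nrm y &
      forall (c : R) x, nrm (fun i => c * x i) = `|c| * nrm x].

Hypothesis nrm_sym : symmetric_norm.

Lemma nrm_le x y : (forall i, `|x i| <= `|y i|) -> nrm x <= nrm y.
Proof. by case: nrm_sym => + _ _ _; apply. Qed.

Lemma nrm_perm (p : {perm 'I_N}) x : nrm (fun i => x (p i)) = nrm x.
Proof. by case: nrm_sym. Qed.

Lemma nrmD x y : nrm (fun i => x i + y i) <= nrm x + nrm y.
Proof. by case: nrm_sym. Qed.

Lemma nrmZ (c : R) x : nrm (fun i => c * x i) = `|c| * nrm x.
Proof. by case: nrm_sym. Qed.

Lemma nrm0 : nrm (fun=> 0) = 0.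
Proof.
by have := nrmZ 0 (fun=> 0); rewrite normr0 !mul0r.
Qed.

Lemma nrm_ge0 x : 0 <= nrm x.
Proof. by rewrite -nrm0; apply: nrm_le => i; rewrite normr0. Qed.

(** The functional of the r-concavification of the space. With constant 1, r-convexity becomes
    subadditivity of [rpow r] on nonnegative vectors and r-concavity becomes superadditivity. *)
Definition rpow r u : R := nrm (fun i => u i `^ r^-1) `^ r.

Definition rpow_subadditive r := forall u v,
  (forall i, 0 <= u i) -> (forall i, 0 <= v i) ->
  rpow r (fun i => u i + v i) <= rpow r u + rpow r v.

Definition rpow_superadditive r := forall u v,
  (forall i, 0 <= u i) -> (forall i, 0 <= v i) ->
  rpow r u + rpow r v <= rpow r (fun i => u i + v i).

Lemma rpow_ge0 r u : 0 <= rpow r u. Proof. exact: powR_ge0. Qed.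

Lemma rpow_le r u v : 0 < r -> (forall i, 0 <= u i <= v i) ->
  rpow r u <= rpow r v.
Proof.
move=> r0 uv; apply: powR_le_mono; rewrite ?(ltW r0) ?nrm_ge0//.
apply: nrm_le => i; rewrite !ger0_norm ?powR_ge0//.
by have /andP[u0 ?] := uv i; apply: powR_le_mono; rewrite // invr_ge0 ltW.
Qed.

Lemma rpow_perm r (p : {perm 'I_N}) u : rpow r (fun i => u (p i)) = rpow r u.
Proof. by rewrite /rpow (nrm_perm p (fun i => u i `^ r^-1)). Qed.

Lemma rpowZ r (c : R) u : 0 < r -> 0 <= c -> (forall i, 0 <= u i) ->
  rpow r (fun i => c * u i) = c * rpow r u.
Proof.
move=> r0 c0 u0; rewrite /rpow.
rewrite (_ : (fun i => _) = fun i => c `^ r^-1 * u i `^ r^-1); last first.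
  by apply: funext => i; rewrite powRM.
by rewrite nrmZ ger0_norm ?powR_ge0// powRM ?powR_ge0 ?nrm_ge0// powRKV.
Qed.

Lemma rpow_pow r x : 0 < r -> (forall i, 0 <= x i) ->
  rpow r (fun i => x i `^ r) = nrm x `^ r.
Proof.
move=> r0 x0; rewrite /rpow; congr (nrm _ `^ _); apply: funext => i.
by rewrite powRVK.
Qed.

Lemma rpow2 u : (forall i, 0 <= u i) ->
  rpow 2 u = nrm (fun i => Num.sqrt (u i)) ^+ 2.
Proof.
move=> u0; rewrite /rpow powR2 ?nrm_ge0//; congr (nrm _ ^+ 2).
by apply: funext => i; rewrite powR12_sqrt.
Qed.

Lemma nrm_substochastic (D : 'I_N -> 'I_N -> R) x :
  (forall i j, 0 <= D i j) -> (forall i, \sum_j D i j <= 1) ->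
  (forall j, \sum_i D i j <= 1) -> (forall i, 0 <= x i) ->
  nrm (fun i => \sum_j D i j * x j) <= nrm x.
Proof.
move=> D0 Dr Dc x0.
have [D' [DD' D'r D'c]] := substochastic_le_bistochastic D0 Dr Dc.
have D'0 i j : 0 <= D' i j by exact: le_trans (DD' i j).
apply: (@le_trans _ _ (nrm (fun i => \sum_j D' i j * x j))).
  apply: nrm_le => i; rewrite !ger0_norm ?sumr_ge0// => [|j _|j _].
  - by apply: ler_sum => j _; rewrite ler_wpM2r.
  - by rewrite mulr_ge0.
  - by rewrite mulr_ge0.
apply: (perm_mix_le_bistochastic (F := nrm)) => // {}x p s {}x0 /andP[s0 s1].
apply: le_trans (nrmD _ _) _; rewrite !nrmZ nrm_perm -mulrDl.
by rewrite !ger0_norm ?subr_ge0// subrK mul1r.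
Qed.

Lemma rpow_mix_ge r x (p : {perm 'I_N}) (s : R) : 0 < r ->
  rpow_superadditive r -> (forall i, 0 <= x i) -> 0 <= s <= 1 ->
  - rpow r (fun i => (1 - s) * x i + s * x (p i)) <= - rpow r x.
Proof.
move=> r0 cE x0 /andP[s0 s1]; rewrite lerN2.
apply: le_trans (cE _ _ _ _) => [|i|i].
- by rewrite !rpowZ ?subr_ge0// rpow_perm -mulrDl subrK mul1r.
- by rewrite mulr_ge0 ?subr_ge0.
- by rewrite mulr_ge0.
Qed.

(** Majorization applied to [- rpow r]: averaging increases a superadditive symmetric functional.
    The sums must be exactly 1, because completing a substochastic matrix would go against a lower
    bound. *)
Lemma rpow_bistochastic_ge r (D : 'I_N -> 'I_N -> R) x :
  0 < r -> rpow_superadditive r ->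
  (forall i j, 0 <= D i j) -> (forall i, \sum_j D i j = 1) ->
  (forall j, \sum_i D i j = 1) -> (forall i, 0 <= x i) ->
  rpow r x <= rpow r (fun i => \sum_j D i j * x j).
Proof.
move=> r0 cE D0 Dr Dc x0; rewrite -lerN2.
refine (@perm_mix_le_bistochastic R N (fun x => - rpow r x) _ D x D0 Dr Dc x0).
by move=> ? ? ? ? ?; exact: rpow_mix_ge.
Qed.

Lemma rpow_substochastic_le r (D : 'I_N -> 'I_N -> R) x : 0 < r ->
  rpow_subadditive r ->
  (forall i j, 0 <= D i j) -> (forall i, \sum_j D i j <= 1) ->
  (forall j, \sum_i D i j <= 1) -> (forall i, 0 <= x i) ->
  rpow r (fun i => \sum_j D i j * x j) <= rpow r x.
Proof.
move=> r0 cE D0 Dr Dc x0.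
have [D' [DD' D'r D'c]] := substochastic_le_bistochastic D0 Dr Dc.
have D'0 i j : 0 <= D' i j by exact: le_trans (DD' i j).
apply: (@le_trans _ _ (rpow r (fun i => \sum_j D' i j * x j))).
  apply: rpow_le => // i; rewrite sumr_ge0/= => [|j _]; last by rewrite mulr_ge0.
  by apply: ler_sum => j _; rewrite ler_wpM2r.
refine (@perm_mix_le_bistochastic R N (rpow r) _ D' x D'0 D'r D'c x0).
move=> {}x p s {}x0 /andP[s0 s1].
apply: le_trans (cE _ _ _ _) _ => [i|i|].
- by rewrite mulr_ge0 ?subr_ge0.
- by rewrite mulr_ge0.
- by rewrite !rpowZ ?subr_ge0// rpow_perm -mulrDl subrK mul1r.
Qed.

(* [w i * x i] is the derivative of [nrm ^ 2 / 2] at [x]; the last condition says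
   that [w] increases with [x], but not faster than [x ^ (q - 2)]. *)
Definition has_weights (q : R) := forall x, (forall i, 0 <= x i) ->
  exists w : 'I_N -> R,
    [/\ forall i, 0 <= w i,
        \sum_i w i * x i ^+ 2 = nrm x ^+ 2,
        forall g : 'I_N -> R, \sum_i w i * g i ^+ 2 <= nrm g ^+ 2 &
        forall i j, 0 < x j < x i ->
          w j <= w i /\ w i * x j `^ (q - 2) <= w j * x i `^ (q - 2)].

(** The weights of [x], the square root of [u + v], represent its squared norm as a sum that splits
    into a [u] part and a [v] part, and the domination clause bounds each of them. *)
Lemma has_weights_subadditive q : has_weights q -> rpow_subadditive 2.
Proof.
move=> wE u v u0 v0; pose x i := Num.sqrt (u i + v i).
have uv0 i : 0 <= u i + v i by rewrite addr_ge0.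
have [|w [w0 wx wg _]] := wE x; first by move=> i; exact: sqrtr_ge0.
rewrite !rpow2// -/x -wx.
rewrite (eq_bigr (fun i => w i * u i + w i * v i)) => [|i _]; last first.
  by rewrite sqr_sqrtr// mulrDr.
rewrite big_split/=; apply: lerD.
  by apply: le_trans (wg _); apply: ler_sum => i _; rewrite sqr_sqrtr.
by apply: le_trans (wg _); apply: ler_sum => i _; rewrite sqr_sqrtr.
Qed.

(** Undoing the spread is a transfer towards the mean, which can only increase a superadditive
    symmetric functional. *)
Lemma concave_spread q x (s : R) (i j : 'I_N) : 0 < q -> rpow_superadditive q ->
  (forall k, 0 <= x k) -> i != j -> x j <= x i -> 0 <= s <= x j ->
  rpow q (fun k => x k + s * (k == i)%:R - s * (k == j)%:R) <= rpow q x.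
Proof.
move=> q0 cE x0 ij xji /andP[s0 sx].
set y := fun k => _.
have yi : y i = x i + s by rewrite /y eqxx (negbTE ij) /=; ring.
have yj : y j = x j - s by rewrite /y eqxx eq_sym (negbTE ij) /=; ring.
have y0 k : 0 <= y k.
  have [->|ki] := eqVneq k i; first by rewrite yi; have := x0 i; lra.
  have [->|kj] := eqVneq k j; first by rewrite yj; lra.
  by rewrite /y (negbTE ki) (negbTE kj) /= mulr0 addr0 subr0.
have mix u (p : {perm 'I_N}) (t : R) : (forall k, 0 <= u k) -> 0 <= t <= 1 ->
    - rpow q (fun k => (1 - t) * u k + t * u (p k)) <= - rpow q u.
  by move=> ? ?; exact: rpow_mix_ge.
have /= := @perm_mix_transfer _ _ (fun x => - rpow q x) mix y i j s y0 ij.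
rewrite yi yj lerN2 => h.
have xE : x = fun k => y k - s * (k == i)%:R + s * (k == j)%:R.
  by apply: funext => k; rewrite /y; ring.
by rewrite [in leRHS]xE; apply: h; apply/andP; split; lra.
Qed.

(** The weights are a functional supporting [rpow 2] at [x ^ 2]. Symmetry under transpositions makes
    them increase with [x]. The growth bound is a first-order optimality condition: spreading the
    q-th powers of [x] lowers the norm by q-concavity, so it cannot raise the supporting
    functional. *)
Lemma convex_concave_weights q : 2 <= q -> rpow_subadditive 2 ->
  rpow_superadditive q -> has_weights q.
Proof.
move=> q2 cE vE x x0; have q0 : 0 < q by lra.
have R2 : (0 : R) < 2 by [].
(* [rpow 2] is sublinear on nonnegative vectors; composing with the positive part extends it to all
   vectors and forces the supporting functional to be nonnegative. *)
pose pos u (i : 'I_N) := Num.max (u i) 0.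
have pos0 u i : 0 <= pos u i by rewrite le_max lexx orbT.
have posE u : (forall i, 0 <= u i) -> pos u = u.
  by move=> u0; apply: funext => i; apply/max_idPl.
have [u v|t u t0|a [ap ax]] := @hahn_banach_fin R _ (fun u => rpow 2 (pos u))
    (fun i => x i ^+ 2).
- apply: le_trans (cE _ _ (pos0 u) (pos0 v)); apply: rpow_le => // i.
  rewrite pos0 /pos ge_max addr_ge0 ?le_max ?lexx ?orbT// andbT.
  by apply: lerD; rewrite le_max lexx.
- rewrite le_eqVlt -rpowZ//; apply/orP; left; apply/eqP; congr (rpow _ _).
  by apply: funext => i; rewrite /pos maxr_pMr// mulr0.
rewrite /= posE in ax; last by move=> i; exact: sqr_ge0.
have a0 i : 0 <= a i.
  have := ap (fun k => - (k == i)%:R).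
  rewrite (bigD1 i)//= eqxx big1 => [|k /negbTE->]; last by rewrite oppr0 mulr0.
  rewrite addr0 mulrN1 (_ : pos _ = fun=> 0); last first.
    by apply: funext => k; apply/max_idPr; rewrite oppr_le0.
  rewrite rpow2// (_ : (fun=> _) = fun=> 0) ?nrm0; last by apply: funext => k; rewrite sqrtr0.
  by rewrite expr0n/= oppr_le0.
have xq : rpow 2 (fun i => x i ^+ 2) = nrm x ^+ 2.
  rewrite rpow2 => [|i]; last exact: sqr_ge0.
  by congr (nrm _ ^+ 2); apply: funext => i; rewrite sqrtr_sqr ger0_norm.
exists (fun i => if x i == 0 then 0 else a i); split.
- by move=> i; case: ifP.
- rewrite -xq -ax; apply: eq_bigr => i _; case: eqVneq => [->|//].
  by rewrite expr0n/= !mulr0.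
- move=> g; apply: (@le_trans _ _ (\sum_i a i * g i ^+ 2)).
    by apply: ler_sum => i _; case: ifP => // _; rewrite mul0r mulr_ge0 ?sqr_ge0.
  have g20 i : 0 <= g i ^+ 2 by exact: sqr_ge0.
  apply: le_trans (ap _) _; rewrite /= posE// rpow2//.
  rewrite ler_sqr ?nnegrE ?nrm_ge0//; apply: nrm_le => i.
  by rewrite sqrtr_sqr normr_id.
move=> i j /andP[xj0 xji]; have xi0 : 0 < x i by exact: lt_trans xji.
have ij : i != j by apply/eqP => ij; rewrite ij ltxx in xji.
rewrite !gt_eqF//; split.
  (* Exchanging two coordinates leaves [rpow 2] unchanged, so the functional is at least as large at
     [x ^ 2] as at the exchanged vector. The difference is [(a i - a j) * (x i ^+ 2 - x j ^+ 2)]. *)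
  pose t k := tperm i j k.
  have := ap (fun k => x (t k) ^+ 2).
  rewrite /= posE => [|k]; last exact: sqr_ge0.
  rewrite (rpow_perm _ (tperm i j) (fun k => x k ^+ 2)) -ax.
  rewrite (bigD1 i)//= (bigD1 j)/=; last by rewrite eq_sym.
  rewrite [X in _ <= X](bigD1 i)//= [X in _ <= _ + X](bigD1 j)/=; last first.
    by rewrite eq_sym.
  rewrite /t tpermL tpermR.
  rewrite (eq_bigr (fun k => a k * x k ^+ 2)); last first.
    by move=> k /andP[ki kj]; rewrite tpermD// eq_sym.
  have : 0 < x i ^+ 2 - x j ^+ 2 by rewrite subr_gt0 ltr_sqr ?nnegrE ?ltW.
  move: (x i ^+ 2) (x j ^+ 2) (bigop _ _ _) => A B S AB.
  move=> h; rewrite leNgt; apply/negP => aij.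
  by have : 0 < (a j - a i) * (A - B); [rewrite mulr_gt0// subr_gt0|lra].
(* In the variable [v], the q-th power of [x], the square of [x] is the r-th power of [v] with
   [r <= 1]: concave powers are now compared along a spread of [v]. *)
pose r := 2 / q.
have r01 : 0 < r <= 1 by rewrite divr_gt0//= ler_pdivrMr// mul1r.
pose v k := x k `^ q.
have v0 k : 0 <= v k by exact: powR_ge0.
have vr k : v k `^ r = x k ^+ 2.
  by rewrite /v -powRrM /r mulrC divfK ?gt_eqF// powR2.
have vi0 : 0 < v i by exact: powR_gt0.
have vj0 : 0 < v j by exact: powR_gt0.
have vji : v j <= v i by apply: powR_le_mono; rewrite ltW.
have vq k : 0 < x k -> v k `^ (1 - r) = x k `^ (q - 2).
  move=> xk; rewrite /v -powRrM /r; congr (_ `^ _); field.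
  by rewrite gt_eqF.
(* The tangents of the concave power are taken at the moved points, so that the inequality for the
   spread by [s] yields a bound without any error term. *)
have spread s : 0 < s < v j ->
    a i * (v j - s) `^ (1 - r) <= a j * (v i + s) `^ (1 - r).
  move=> /andP[s0 sv].
  pose y k := v k + s * (k == i)%:R - s * (k == j)%:R.
  have yi : y i = v i + s by rewrite /y eqxx (negbTE ij) /=; ring.
  have yj : y j = v j - s by rewrite /y eqxx eq_sym (negbTE ij) /=; ring.
  have yk k : k != i -> k != j -> y k = v k.
    by move=> /negbTE ki /negbTE kj; rewrite /y ki kj /=; ring.
  have y0 k : 0 <= y k.
    have [->|ki] := eqVneq k i; first by rewrite yi addr_ge0// ltW.
    have [->|kj] := eqVneq k j; first by rewrite yj subr_ge0 ltW.
    by rewrite yk.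
  have yv : rpow q y <= rpow q v.
    by apply: concave_spread => //; apply/andP; split; exact: ltW.
  have ya : \sum_k a k * y k `^ r <= \sum_k a k * v k `^ r.
    apply: le_trans (ap _) _; rewrite /= posE => [|k]; last exact: powR_ge0.
    rewrite (eq_bigr (fun k => a k * x k ^+ 2)) => [|k _]; last by rewrite vr.
    rewrite ax xq -(@powR2 _ (nrm x)) ?nrm_ge0//.
    have -> : nrm x `^ 2 = rpow q v `^ r.
      by rewrite /v rpow_pow// -powRrM /r [q * _]mulrC divfK ?gt_eqF.
    have -> : rpow 2 (fun k => y k `^ r) = rpow q y `^ r.
      have qr : q * r = 2 by rewrite /r; field; rewrite gt_eqF.
      have rV : r * 2^-1 = q^-1 by rewrite /r; field; rewrite gt_eqF.
      rewrite /rpow -(powRrM (nrm (fun k => y k `^ q^-1)) q r) qr.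
      congr (nrm _ `^ _); apply: funext => k.
      by rewrite -(powRrM (y k) r) rV.
    by apply: powR_le_mono; rewrite ?rpow_ge0//; case/andP: r01 => /ltW.
  move: ya; rewrite (bigD1 i)//= (bigD1 j)/=; last by rewrite eq_sym.
  rewrite [X in _ <= X](bigD1 i)//= [X in _ <= _ + X](bigD1 j)/=; last first.
    by rewrite eq_sym.
  rewrite yi yj (eq_bigr (fun k => a k * v k `^ r)); last first.
    by move=> k /andP[ki kj]; rewrite yk.
  have A0 : 0 < v i + s by rewrite addr_gt0.
  have B0 : 0 < v j - s by rewrite subr_gt0.
  have cA := powR_concave r01 A0 (v0 i).
  have cB := powR_concave r01 B0 (v0 j).
  have := ler_wpM2l (a0 i) cA; have := ler_wpM2l (a0 j) cB.
  rewrite (_ : v i - (v i + s) = - s); last by ring.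
  rewrite (_ : v j - (v j - s) = s); last by ring.
  set Am := (v i + s) `^ (r - 1); set Bm := (v j - s) `^ (r - 1).
  move: (v i `^ r) (v j `^ r) ((v i + s) `^ r) ((v j - s) `^ r) (bigop _ _ _).
  move=> Vi Vj Ar Br S h1 h2 h3.
  have h : r * s * (a i * Am) <= r * s * (a j * Bm).
    by clear -h1 h2 h3; clearbody Am Bm r; clear -h1 h2 h3; lra.
  rewrite ler_pM2l in h; last by rewrite mulr_gt0//; case/andP: r01.
  have P0 : 0 <= (v i + s) `^ (1 - r) * (v j - s) `^ (1 - r).
    by rewrite mulr_ge0 ?powR_ge0.
  have inv A : 0 < A -> A `^ (r - 1) * A `^ (1 - r) = 1.
    by move=> A0'; rewrite -powRD ?(gt_eqF A0') ?implybT// addrA subrK subrr powRr0.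
  have := ler_wpM2l P0 h.
  have := inv _ A0; have := inv _ B0; rewrite -/Am -/Bm.
  move: ((v i + s) `^ (1 - r)) ((v j - s) `^ (1 - r)) Am Bm {h h1 h2 P0} => A' B' A B.
  move=> B1 A1.
  rewrite (_ : A' * B' * (a i * A) = A * A' * (a i * B')); last by ring.
  rewrite (_ : A' * B' * (a j * B) = B * B' * (a j * A')); last by ring.
  by rewrite A1 B1 !mul1r.
rewrite -(vq i xi0) -(vq j xj0).
have r'01 : 0 <= 1 - r <= 1 by case/andP: r01 => ? ?; apply/andP; split; lra.
have /andP[r'0 r'1] := r'01.
clearbody r v.
(* The limit [s -> 0] is replaced by [s = e * v j] with factors [1 - e] and [1 + e]. *)
have eps (e : R) : 0 < e < 1 ->
    (1 - e) * (a i * v j `^ (1 - r)) <= (1 + e) * (a j * v i `^ (1 - r)).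
  move=> /andP[e0 e1].
  have e1' : 0 <= 1 - e by rewrite subr_ge0 ltW.
  have esv : 0 < e * v j < v j by rewrite mulr_gt0//= gtr_pMl.
  have h := spread _ esv.
  apply: (@le_trans _ _ (a i * (v j - e * v j) `^ (1 - r))).
    rewrite (_ : v j - e * v j = (1 - e) * v j); last by ring.
    rewrite powRM// mulrCA; apply: ler_wpM2l => //.
    apply: ler_wpM2r; first exact: powR_ge0.
    by apply: ger1_powR => //; apply/andP; split; lra.
  apply: le_trans h _.
  rewrite mulrCA; apply: ler_wpM2l => //.
  apply: (@le_trans _ _ (((1 + e) * v i) `^ (1 - r))).
    apply: powR_le_mono => //; first by rewrite addr_ge0// mulr_ge0// ltW.
    by rewrite mulrDl mul1r lerD2l ler_pM2l.
  rewrite powRM ?addr_ge0 ?(ltW e0)//; apply: ler_wpM2r; first exact: powR_ge0.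
  by apply: ler1_powR => //; lra.
rewrite leNgt; apply/negP; set P := a i * _; set Q := a j * _ => QP.
have Q0 : 0 <= Q by rewrite mulr_ge0 ?powR_ge0.
have PQ : 0 < P + Q by lra.
have PQ' : 0 < P - Q by lra.
(* For this [e] the inequality reads [P - Q <= e * (P + Q) = (P - Q) / 2], which is absurd when
   [Q < P]. *)
have := eps ((P - Q) / (2 * (P + Q))).
rewrite divr_gt0 ?mulr_gt0//= ltr_pdivrMr ?mulr_gt0// mul1r => /(_ _).
have e : (P - Q) / (2 * (P + Q)) * (P + Q) = (P - Q) / 2.
  by field; rewrite gt_eqF.
by rewrite -/P -/Q; lra.
Qed.

End SymmetricNorms.

(** * Symmetric spaces on the cube as symmetric norms of real vectors *)

Section RealVectors.
Variables (R : realType) (n : nat) (E : symSpace R n).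
Local Notation N := #|Omega n|.
Implicit Types (x y u v : 'I_N -> R) (r : R).

Definition rnorm x : R := E [ffun w => (x (enum_rank w))%:C].

Lemma rnorm_symmetric : symmetric_norm rnorm.
Proof.
split=> [x y xy|p x|x y|c x].
- by apply: snorm_lattice => w; rewrite !ffunE !normc_real.
- have inj : injective (fun w : Omega n => enum_val (p (enum_rank w))).
    by move=> w1 w2 /enum_val_inj/perm_inj/enum_rank_inj.
  rewrite /rnorm -[RHS](snorm_perm E (perm inj)); congr (snorm E _).
  by apply/ffunP => w; rewrite !ffunE permE enum_valK.
- apply: le_trans (snormD E _ _); rewrite le_eqVlt; apply/orP; left; apply/eqP.
  by congr (snorm E _); apply/ffunP => w; rewrite !ffunE rmorphD.
- rewrite -normc_real -(snormZ E); congr (snorm E _).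
  by apply/ffunP => w; rewrite !ffunE rmorphM.
Qed.

Lemma rnorm_eq0 x : rnorm x = 0 -> forall i, x i = 0.
Proof.
move=> /(snorm_eq0)/ffunP x0 i; have := x0 (enum_val i).
by rewrite !ffunE enum_valK => -[].
Qed.

Let root r u : {ffun Omega n -> R[i]} :=
  [ffun w => (u (enum_rank w) `^ r^-1)%:C].

Let sum2 (F : 'I_2 -> R) : \sum_(k < 2) F k = F 0 + F 1.
Proof. by rewrite big_ord_recl big_ord1; congr (_ + F _); apply: val_inj. Qed.

Let lp_sum_pair r u v : 0 < r -> (forall i, 0 <= u i) -> (forall i, 0 <= v i) ->
  lp_sum r (fun k : 'I_2 => if k == 0 then root r u else root r v) =
  root r (fun i => u i + v i).
Proof.
move=> r0 u0 v0; apply/ffunP => w; rewrite ffunE [RHS]ffunE sum2 eqxx /=.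
by rewrite /root !ffunE !normc_real !ger0_norm ?powR_ge0// !powRKV.
Qed.

Lemma pconvex_subadditive r : 0 < r -> pconvex E r 1 ->
  rpow_subadditive rnorm r.
Proof.
move=> r0 cE u v u0 v0.
have := cE 2%N (fun k : 'I_2 => if k == 0 then root r u else root r v).
rewrite lp_sum_pair// mul1r sum2 eqxx /= => h.
have := powR_le_mono (ltW r0) (nrm_ge0 rnorm_symmetric _)
  (h : rnorm (fun i => (u i + v i) `^ r^-1) <= _).
by rewrite powRKV ?addr_ge0 ?powR_ge0.
Qed.

Lemma qconcave_superadditive r : 0 < r -> qconcave E r 1 ->
  rpow_superadditive rnorm r.
Proof.
move=> r0 cE u v u0 v0.
have := cE 2%N (fun k : 'I_2 => if k == 0 then root r u else root r v).
rewrite lp_sum_pair// mul1r sum2 eqxx /= => h.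
have := powR_le_mono (ltW r0) (powR_ge0 _ _) h.
by rewrite powRKV ?addr_ge0 ?powR_ge0.
Qed.

(** For [L^q] the norm is differentiable and the weights are explicit: [x i] to the power [q - 2],
    normalized by the norm of [x]. The growth clause is then an equality and the domination clause
    is Hölder's inequality. *)
Lemma Lq_weights q : 2 < q -> is_Lq E q -> has_weights rnorm q.
Proof.
move=> q2 EL x x0.
have q0 : 0 < q by lra.
set c := (N%:R)^-1 : R.
have rE y : rnorm y = (c * \sum_i `|y i| `^ q) `^ q^-1.
  rewrite /rnorm EL; congr ((_ * _) `^ _).
  rewrite [RHS](reindex enum_rank) /=; last exact/onW_bij/enum_rank_bij.
  by apply: eq_bigr => i _; rewrite ffunE normc_real.
have c0 : 0 <= c by rewrite invr_ge0.
have rq y : rnorm y `^ q = c * \sum_i `|y i| `^ q.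
  by rewrite rE powRKV// mulr_ge0// sumr_ge0// => i _; exact: powR_ge0.
have rn0 y : 0 <= rnorm y by exact: nrm_ge0 rnorm_symmetric y.
set M := rnorm x.
exists (fun i => c * x i `^ (q - 2) * M `^ (2 - q)).
have [M0|Mn0] := eqVneq M 0.
  have x00 := rnorm_eq0 M0.
  have q20 : q - 2 != 0 by rewrite gt_eqF// subr_gt0.
  have w0 i : c * x i `^ (q - 2) * M `^ (2 - q) = 0.
    by rewrite x00 powR0// mulr0 mul0r.
  split=> [i||g|i j]; first by rewrite w0.
  - by rewrite big1 => [|i _]; [rewrite M0 expr0n|rewrite w0 mul0r].
  - by rewrite big1 ?sqr_ge0// => i _; rewrite w0 mul0r.
  - by rewrite !x00 ltxx.
have M0 : 0 < M by rewrite lt_def Mn0 rn0.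
have Mr : 0 < M `^ (2 - q) by exact: powR_gt0.
split=> [i||g|i j /andP[xj0 xji]].
- by rewrite !mulr_ge0 ?powR_ge0.
- rewrite (eq_bigr (fun i => M `^ (2 - q) * (c * `|x i| `^ q))) => [|i _].
    rewrite -mulr_sumr -mulr_sumr -rq -/M -powRD ?Mn0 ?implybT// subrK powR2 ?(ltW M0)//.
  rewrite ger0_norm// -(powR2 (x0 i)).
  have [->|xi0] := eqVneq (x i) 0.
    by rewrite (@powR0 _ 2)// (@powR0 _ q) ?(gt_eqF q0)// !mulr0.
  by rewrite mulrAC -[c * _ * _]mulrA -powRD ?xi0 ?implybT// subrK mulrC.
- set G := rnorm g; have [G0|Gn0] := eqVneq G 0.
    rewrite big1 ?sqr_ge0// => i _; rewrite (rnorm_eq0 G0) expr0n/= mulr0//.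
  have G0 : 0 < G by rewrite lt_def Gn0 rn0.
  pose p := q / 2; pose p' := q / (q - 2).
  have p0 : 0 < p by rewrite divr_gt0.
  have p'0 : 0 < p' by rewrite divr_gt0// subr_gt0.
  have pp : p'^-1 + p^-1 = 1 by rewrite /p /p'; field; rewrite !gt_eqF ?subr_gt0.
  (* Hölder with exponents [q / (q - 2)] and [q / 2], obtained from Young's inequality after both
     norms are scaled to 1. *)
  have young i : (x i / M) `^ (q - 2) * (`|g i| / G) `^ 2 <=
      (x i / M) `^ q / p' + (`|g i| / G) `^ q / p.
    have := @conjugate_powR _ ((x i / M) `^ (q - 2)) ((`|g i| / G) `^ 2) p' p.
    rewrite !powR_ge0 p0 p'0 pp => /(_ isT isT isT isT erefl) /le_trans; apply.
    rewrite -!powRrM /p /p'.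
    have -> : (q - 2) * (q / (q - 2)) = q by field; rewrite gt_eqF ?subr_gt0.
    by have -> : 2 * (q / 2) = q by field.
  have MV : 0 <= M^-1 by rewrite invr_ge0 ltW.
  have GV : 0 <= G^-1 by rewrite invr_ge0 ltW.
  have key : c * \sum_i ((x i / M) `^ (q - 2) * (`|g i| / G) `^ 2) <= 1.
    apply: (@le_trans _ _ (c * \sum_i
        ((x i / M) `^ q / p' + (`|g i| / G) `^ q / p))).
      by apply: ler_wpM2l => //; apply: ler_sum => i _.
    rewrite big_split/= -!mulr_suml mulrDr !mulrA.
    have nE y K : 0 < K -> rnorm y = K -> c * \sum_i (`|y i| / K) `^ q = 1.
      move=> K0 yK.
      rewrite (eq_bigr (fun i => `|y i| `^ q * K^-1 `^ q)) => [|i _].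
        rewrite -mulr_suml mulrA -rq yK -powRM ?invr_ge0 ?(ltW K0)//.
        by rewrite divff ?gt_eqF// powR1.
      by rewrite powRM ?invr_ge0 ?(ltW K0).
    rewrite nE// (eq_bigr (fun i => (`|x i| / M) `^ q)) => [|i _]; last first.
      by rewrite ger0_norm.
    by rewrite nE// !mul1r pp.
  rewrite (eq_bigr (fun i => G ^+ 2 * (c * ((x i / M) `^ (q - 2) *
      (`|g i| / G) `^ 2)))) => [|i _].
    by rewrite -mulr_sumr -mulr_sumr -[leRHS]mulr1 ler_wpM2l ?sqr_ge0.
  rewrite [(x i / M) `^ _]powRM// powR2 ?mulr_ge0// exprMn -normrX.
  rewrite [`|_ ^+ 2|]ger0_norm ?sqr_ge0//.
  have -> : M^-1 `^ (q - 2) = M `^ (2 - q).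
    by rewrite -powR_inv1 ?ltW// -powRrM; congr (_ `^ _); ring.
  by field; rewrite gt_eqF.
- have xi0 : 0 < x i by exact: lt_trans xji.
  split.
    apply: ler_wpM2r; first exact: powR_ge0.
    apply: ler_wpM2l => //; apply: powR_le_mono; rewrite ?subr_ge0 ltW//.
  by rewrite le_eqVlt; apply/orP; left; apply/eqP; ring.
Qed.

End RealVectors.

(** * Singular values and Schatten norms *)

Section Adjoint.
Variable R : realType.
Local Notation C := R[i].

Lemma adjmxM m n p (A : 'M[C]_(m, n)) (B : 'M[C]_(n, p)) :
  (A *m B) ^t* = B ^t* *m A ^t*.
Proof. by rewrite trmx_mul map_mxM. Qed.

Lemma adjmxD m n (A B : 'M[C]_(m, n)) : (A + B) ^t* = A ^t* + B ^t*.
Proof. by rewrite linearD/= map_mxD. Qed.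

Lemma adjmxB m n (A B : 'M[C]_(m, n)) : (A - B) ^t* = A ^t* - B ^t*.
Proof. by rewrite linearB/= map_mxB. Qed.

Lemma adjmxZ m n (c : C) (A : 'M[C]_(m, n)) : (c *: A) ^t* = Num.conj c *: A ^t*.
Proof. by rewrite linearZ/= map_mxZ. Qed.

Lemma adjmx1 n : (1%:M : 'M[C]_n) ^t* = 1%:M.
Proof. by rewrite trmx1 map_mx1. Qed.

Lemma adjmx_sum m n I (r : seq I) (P : pred I) (F : I -> 'M[C]_(m, n)) :
  (\sum_(i <- r | P i) F i) ^t* = \sum_(i <- r | P i) (F i) ^t*.
Proof.
elim/big_rec2: _ => [|i A B _ <-]; first by rewrite trmx0 map_mx0.
by rewrite adjmxD.
Qed.

Lemma adjmxK m n (A : 'M[C]_(m, n)) : A ^t* ^t* = A.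
Proof. exact: trmxCK. Qed.

Definition unitary n (U : 'M[C]_n) : Prop := U *m U ^t* = 1%:M.

Lemma unitary_adjmul n (U : 'M[C]_n) : unitary U -> U ^t* *m U = 1%:M.
Proof. exact: mulmx1C. Qed.

Lemma unitary_adj n (U : 'M[C]_n) : unitary U -> unitary (U ^t*).
Proof. by move=> uU; rewrite /unitary adjmxK unitary_adjmul. Qed.

Lemma unitaryM n (U V : 'M[C]_n) : unitary U -> unitary V -> unitary (U *m V).
Proof.
by move=> uU uV; rewrite /unitary adjmxM mulmxA -(mulmxA U) uV mulmx1.
Qed.

Lemma unitary1 n : unitary (1%:M : 'M[C]_n).
Proof. by rewrite /unitary adjmx1 mulmx1. Qed.

Lemma spectral_unitary n (A : 'M[C]_n) : unitary (spectralmx A).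
Proof. exact/unitarymxP/spectral_unitarymx. Qed.

(** The block matrix [M] is multiplied by a block triangular matrix on the right, then on the left.
    Both determinants contain [\det M], and the remaining factor, a power of the indeterminate,
    cancels. *)
Lemma char_poly_mulC n (A B : 'M[C]_n) : char_poly (A *m B) = char_poly (B *m A).
Proof.
pose Xn : 'M[{poly C}]_n := 'X%:M.
pose a := map_mx polyC A; pose b := map_mx polyC B.
pose M := block_mx Xn a b 1%:M.
have cE (D E : 'M[C]_n) : char_poly (D *m E) =
    \det (Xn - map_mx polyC D *m map_mx polyC E).
  by rewrite /char_poly /char_poly_mx map_mxM.
have e1 : M *m block_mx 1%:M 0 (- b) 1%:M = block_mx (Xn - a *m b) a 0 1%:M.
  by rewrite mulmx_block !mulmx1 !mulmx0 !mul1mx !mulmxN subrr !add0r.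
have e2 : block_mx 1%:M 0 (- b) Xn *m M = block_mx Xn a 0 (Xn - b *m a).
  rewrite mulmx_block !mul1mx !mul0mx !addr0 mulmx1 !mulNmx.
  by rewrite /Xn scalar_mxC addNr addrC.
move/(congr1 determinant): e1; rewrite det_mulmx det_lblock det_ublock !det1 !mulr1.
move/(congr1 determinant): e2; rewrite det_mulmx det_lblock det_ublock !det1 !mul1r.
move=> e3 e4; rewrite !cE -/a -/b -e4; apply: (@mulfI _ (\det Xn)) => //.
by rewrite det_scalar expf_neq0// polyX_eq0.
Qed.

Lemma char_poly_diag n (d : 'rV[C]_n) :
  char_poly (diag_mx d) = \prod_(x <- [seq d 0 i | i <- enum 'I_n]) ('X - x%:P).
Proof.
rewrite char_poly_trig ?diag_mx_is_trig// big_map big_enum /=.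
by apply: eq_bigr => i _; rewrite mxE eqxx.
Qed.

Lemma char_poly_diag_perm n (d e : 'rV[C]_n) :
  char_poly (diag_mx d) = char_poly (diag_mx e) ->
  exists p : {perm 'I_n}, forall j, d 0 j = e 0 (p j).
Proof.
rewrite !char_poly_diag => /prod_XsubC_eq de.
have /tuple_permP[p /= dep] : perm_eq [tuple d 0 i | i < n] [tuple e 0 i | i < n].
  exact: de.
exists p => j; have := congr1 (fun s => nth 0 s j) dep.
rewrite (nth_map j 0) ?size_enum_ord// [in RHS](nth_map j 0) ?size_enum_ord//.
by rewrite !nth_ord_enum tnth_mktuple.
Qed.

(** [sqrtmx] and [singvals] are read off one chosen diagonalization. Any other one has the same
    characteristic polynomial, so its entries differ by a permutation, which a symmetric norm
    ignores. *)
Lemma diag_unitary_perm n (d e : 'rV[C]_n) (U V : 'M[C]_n) :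
  unitary U -> unitary V ->
  U ^t* *m diag_mx d *m U = V ^t* *m diag_mx e *m V ->
  exists p : {perm 'I_n}, forall j, d 0 j = e 0 (p j).
Proof.
have cU (f : 'rV[C]_n) (W : 'M[C]_n) : unitary W ->
    char_poly (W ^t* *m diag_mx f *m W) = char_poly (diag_mx f).
  by move=> WW; rewrite char_poly_mulC mulmxA WW mul1mx.
move=> uU uV UV; apply: char_poly_diag_perm.
transitivity (char_poly (U ^t* *m diag_mx d *m U)); first by rewrite (cU d U uU).
by rewrite UV (cU e V uV).
Qed.

Lemma normal_spectral n (A : 'M[C]_n) : A *m A ^t* = A ^t* *m A ->
  A = (spectralmx A) ^t* *m diag_mx (spectral_diag A) *m spectralmx A.
Proof.
move=> /normalmxP/orthomx_spectralP {1}->.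
by rewrite (invmx_unitary (spectral_unitarymx A)).
Qed.

Lemma perm_mx_unitary n (p : {perm 'I_n}) : unitary (perm_mx p : 'M[C]_n).
Proof.
rewrite /unitary tr_perm_mx (_ : map_mx _ _ = perm_mx p^-1).
  by rewrite -perm_mxM mulgV perm_mx1.
by apply/matrixP => i j; rewrite !mxE rmorph_nat.
Qed.

End Adjoint.

Section SingularValues.
Variables (R : realType) (N : nat).
Local Notation C := R[i].
Implicit Types (A B U V : 'M[C]_N) (a b : 'I_N -> R).

Definition rdiag a : 'M[C]_N := diag_mx (\row_k (a k)%:C).

Lemma sqr_normcE (z : C) : (normc z ^+ 2)%:C = z * Num.conj z.
Proof. by rewrite -normCK rmorphXn. Qed.

Lemma conjC_real (x : R) : Num.conj (x%:C : C) = x%:C.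
Proof. exact: conjc_real. Qed.

Lemma adjmx_rdiag a : (rdiag a) ^t* = rdiag a.
Proof.
apply/matrixP => i j; rewrite !mxE [j == i]eq_sym.
by rewrite rmorphMn /= conjC_real; case: eqP => [->|_].
Qed.

Lemma rdiagM a b : rdiag a *m rdiag b = rdiag (fun k => a k * b k).
Proof.
by rewrite /rdiag mulmx_diag; congr diag_mx; apply/rowP => k; rewrite !mxE rmorphM.
Qed.

Lemma rdiagE a i j : rdiag a i j = (a i)%:C *+ (i == j).
Proof. by rewrite !mxE. Qed.

Lemma mulmx_rdiagE A a i j : (A *m rdiag a) i j = A i j * (a j)%:C.
Proof. by rewrite mul_mx_diag !mxE. Qed.

Lemma rdiagZ (c : R) a : rdiag (fun k => c * a k) = c%:C *: rdiag a.
Proof. by apply/matrixP => i j; rewrite !mxE rmorphM mulrnAr. Qed.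

Lemma unitary_row U i : unitary U -> \sum_j normc (U i j) ^+ 2 = 1.
Proof.
move=> /matrixP/(_ i i); rewrite !mxE eqxx => e.
apply: (@complexI R); rewrite rmorph_sum -[RHS]e /=.
by apply: eq_bigr => j _; rewrite !mxE -sqr_normcE.
Qed.

Lemma unitary_col U j : unitary U -> \sum_i normc (U i j) ^+ 2 = 1.
Proof.
move=> /unitary_adj/(@unitary_row _ j) <-.
apply: eq_bigr => i _; rewrite !mxE.
apply: (@complexI R); rewrite !sqr_normcE.
by rewrite conjCK mulrC.
Qed.

Definition phase (z : C) : C := if z == 0 then 1 else z / (normc z)%:C.

Lemma phaseE z : (normc z)%:C * phase z = z.
Proof.
rewrite /phase; case: eqVneq => [->|z0]; first by rewrite Normc.normc0 mul0r.
rewrite mulrC divfK//; apply: contraNneq z0 => nz0; apply/eqP.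
exact: Normc.eq0_normc (complexI nz0).
Qed.

Lemma phase_unit z : phase z * Num.conj (phase z) = 1.
Proof.
rewrite -sqr_normcE /phase; case: eqVneq => [_|z0].
  by rewrite Normc.normc1 expr1n.
rewrite Normc.normcM Normc.normcV.
have nz0 : normc z != 0 by apply: contraNneq z0 => /Normc.eq0_normc ->.
have -> : normc (normc z)%:C = normc z.
  by rewrite normc_real ger0_norm//; case: (z) => x y; exact: sqrtr_ge0.
by rewrite divff ?expr1n.
Qed.

Lemma normc_ge0 (z : C) : 0 <= normc z.
Proof. by case: z => x y; exact: sqrtr_ge0. Qed.

Definition psdmx A : Prop :=
  A ^t* = A /\ forall v : 'rV[C]_N, 0 <= (v *m A *m v ^t*) 0 0.

Lemma psdmxD A B : psdmx A -> psdmx B -> psdmx (A + B).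
Proof.
move=> [hA pA] [hB pB]; split=> [|v]; first by rewrite adjmxD hA hB.
by rewrite mulmxDr mulmxDl mxE addr_ge0.
Qed.

Lemma psdmx0 : psdmx 0.
Proof. by split=> [|v]; rewrite ?trmx0 ?map_mx0// mulmx0 mul0mx mxE. Qed.

Lemma psdmx_sum (I : Type) (r : seq I) (P : pred I) (F : I -> 'M[C]_N) :
  (forall i, P i -> psdmx (F i)) -> psdmx (\sum_(i <- r | P i) F i).
Proof. by move=> pF; apply: big_ind => //; [exact: psdmx0|exact: psdmxD]. Qed.

Lemma psdmx_sqmod A : psdmx (sqmodmx A).
Proof.
split=> [|v]; first by rewrite /sqmodmx adjmxM adjmxK.
rewrite /sqmodmx mulmxA -mulmxA.
have -> : A *m v ^t* = (v *m A ^t*) ^t* by rewrite adjmxM adjmxK.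
rewrite mxE sumr_ge0// => k _; rewrite [X in _ * X]mxE [X in _ * Num.conj X]mxE.
by rewrite -sqr_normcE lecR sqr_ge0.
Qed.

Lemma psdmx_conj A U : psdmx A -> psdmx (U *m A *m U ^t*).
Proof.
move=> [hA pA]; split=> [|v]; first by rewrite !adjmxM adjmxK hA mulmxA.
by have := pA (v *m U); rewrite adjmxM !mulmxA.
Qed.

Lemma psdmx_diag A i : psdmx A -> 0 <= complex.Re (A i i) /\
  (complex.Re (A i i))%:C = A i i.
Proof.
move=> [hA /(_ (delta_mx 0 i))].
rewrite trmx_delta map_delta_mx -rowE -colE mxE mxE => A0.
by split; [move: A0; rewrite lecE => /andP[]|rewrite RRe_real// ger0_real].
Qed.

Lemma hermitian_spectral A : A ^t* = A -> exists U a,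
  unitary U /\ A = U ^t* *m rdiag a *m U.
Proof.
move=> hA; pose U := spectralmx A.
have uU : unitary U by exact: spectral_unitary.
have /normal_spectral AE : A *m A ^t* = A ^t* *m A by rewrite hA.
have dE : diag_mx (spectral_diag A) = U *m A *m U ^t*.
  by rewrite [in RHS]AE !mulmxA uU mul1mx -mulmxA uU mulmx1.
have hd : (U *m A *m U ^t*) ^t* = U *m A *m U ^t*.
  by rewrite !adjmxM adjmxK hA mulmxA.
have dE' : diag_mx (spectral_diag A) =
    rdiag (fun k => complex.Re ((U *m A *m U ^t*) k k)).
  congr diag_mx; apply/rowP => k; rewrite mxE RRe_real.
    by rewrite -dE mxE eqxx mulr1n.
  apply/CrealP; have := congr1 (fun B : 'M[C]_N => B k k) hd.
  by rewrite mxE [X in Num.conj X]mxE.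
exists U, (fun k => complex.Re ((U *m A *m U ^t*) k k)).
by split=> //; rewrite -dE'.
Qed.

Lemma psdmx_spectral A : psdmx A -> exists2 U, unitary U &
  exists2 a, (forall k, 0 <= a k) & A = U ^t* *m rdiag a *m U.
Proof.
move=> pA; have [hA _] := pA; have [U [a [uU AE]]] := hermitian_spectral hA.
exists U => //; exists a => // k.
have [+ _] := psdmx_diag k (psdmx_conj U pA).
by rewrite AE !mulmxA uU mul1mx -mulmxA uU mulmx1 rdiagE eqxx.
Qed.

(** The two products of [A] with its adjoint have the same spectrum, so after suitable unitary
    changes of basis on the two sides both become the same diagonal matrix. The transformed [A],
    called [M], is then normal; the spectral theorem applies to it, and the phases of its
    eigenvalues are moved into a unitary. No partial isometry has to be extended over a kernel. *)
Lemma svd A : exists U V s, [/\ unitary U, unitary V,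
  forall k, 0 <= s k & A = U *m rdiag s *m V].
Proof.
have [Q uQ [d d0 QE]] := psdmx_spectral (psdmx_sqmod A).
have [P uP [e e0 PE]] := psdmx_spectral (psdmx_sqmod (A ^t*)).
rewrite /sqmodmx adjmxK in QE PE.
have [|p dp] := @char_poly_diag_perm _ _ (\row_k (d k)%:C) (\row_k (e k)%:C).
  have cU (f : 'I_N -> R) (W : 'M[C]_N) : unitary W ->
      char_poly (W ^t* *m rdiag f *m W) = char_poly (rdiag f).
    by move=> WW; rewrite char_poly_mulC mulmxA WW mul1mx.
  change (char_poly (rdiag d) = char_poly (rdiag e)).
  transitivity (char_poly (A ^t* *m A)); first by rewrite QE (cU d Q uQ).
  by rewrite char_poly_mulC PE (cU e P uP).
pose T : 'M[C]_N := perm_mx p.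
have uT : unitary T by exact: perm_mx_unitary.
have dT : rdiag d = T *m rdiag e *m T ^t*.
  rewrite tr_perm_mx (_ : map_mx _ _ = perm_mx p^-1); last first.
    by apply/matrixP => i j; rewrite !mxE rmorph_nat.
  rewrite -row_permE -col_permE; apply/matrixP => i j; rewrite !mxE.
  by have := dp i; rewrite !mxE => ->; rewrite (inj_eq perm_inj).
pose P' := T *m P; have uP' : unitary P' by exact: unitaryM.
have PE' : A *m A ^t* = P' ^t* *m rdiag d *m P'.
  have eT : rdiag e = T ^t* *m rdiag d *m T.
    by rewrite dT !mulmxA (unitary_adjmul uT) mul1mx -mulmxA (unitary_adjmul uT) mulmx1.
  rewrite PE eT.
  by rewrite /P' adjmxM !mulmxA.
clearbody P'.
pose M := P' *m A *m Q ^t*.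
have M1 : M *m M ^t* = rdiag d.
  rewrite /M !adjmxM adjmxK !mulmxA -(mulmxA _ (Q ^t*)) (unitary_adjmul uQ) mulmx1.
  rewrite -(mulmxA P') PE' !mulmxA uP' mul1mx -mulmxA.
  by rewrite uP' mulmx1.
have M2 : M ^t* *m M = rdiag d.
  rewrite /M !adjmxM adjmxK !mulmxA -(mulmxA _ (P' ^t*)) (unitary_adjmul uP') mulmx1.
  rewrite -(mulmxA Q) QE !mulmxA uQ mul1mx -mulmxA.
  by rewrite uQ mulmx1.
have /normal_spectral ME : M *m M ^t* = M ^t* *m M by rewrite M1 M2.
set W := spectralmx M in ME; set z := spectral_diag M in ME.
have uW : unitary W by exact: spectral_unitary.
pose ph : 'rV[C]_N := \row_k phase (z 0 k).
have uph : unitary (diag_mx ph).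
  rewrite /unitary tr_diag_mx map_diag_mx mulmx_diag.
  apply/matrixP => i j; rewrite !mxE; congr (_ *+ _); exact: phase_unit.
have zE : diag_mx z = rdiag (fun k => normc (z 0 k)) *m diag_mx ph.
  rewrite mulmx_diag; congr diag_mx; apply/rowP => k; rewrite !mxE.
  by rewrite phaseE.
exists (P' ^t* *m W ^t*), (diag_mx ph *m W *m Q), (fun k => normc (z 0 k)).
split.
- by apply: unitaryM; exact: unitary_adj.
- by apply: unitaryM => //; exact: unitaryM.
- by move=> k; exact: normc_ge0.
transitivity (P' ^t* *m M *m Q).
  rewrite /M !mulmxA (unitary_adjmul uP') mul1mx -mulmxA (unitary_adjmul uQ).
  by rewrite mulmx1.
by rewrite ME zE (mulmxA (P' ^t*)) !mulmxA.
Qed.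

End SingularValues.

(** * Schatten norms and the additivity of [sqnorm] *)

Section SchattenNorm.
Variable R : realType.
Local Notation C := R[i].

Lemma sqrtC_RtoC (x : R) : 0 <= x -> sqrtC (x%:C : C) = (Num.sqrt x)%:C.
Proof.
move=> x0; rewrite -{1}(sqr_sqrtr x0) rmorphXn /= sqrCK//.
by rewrite lecR sqrtr_ge0.
Qed.

Lemma unitary_rdiagM N (U : 'M[C]_N) a b : unitary U ->
  (U ^t* *m rdiag a *m U) *m (U ^t* *m rdiag b *m U) =
  U ^t* *m rdiag (fun k => a k * b k) *m U.
Proof.
move=> uU; rewrite -rdiagM !mulmxA -(mulmxA (U ^t* *m rdiag a) U).
by rewrite uU mulmx1.
Qed.

Lemma adjmx_unitary_rdiag N (U : 'M[C]_N) a :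
  (U ^t* *m rdiag a *m U) ^t* = U ^t* *m rdiag a *m U.
Proof. by rewrite !adjmxM adjmxK adjmx_rdiag mulmxA. Qed.

Lemma sqrtmx_spectral N (A U : 'M[C]_N) a : unitary U ->
  (forall k, 0 <= a k) -> A = U ^t* *m rdiag a *m U ->
  [/\ (sqrtmx A) ^t* = sqrtmx A, sqrtmx A *m sqrtmx A = A &
      exists p : {perm 'I_N}, forall k,
        spectral_diag (sqrtmx A) 0 k = (Num.sqrt (a (p k)))%:C].
Proof.
move=> uU a0 AE.
have nA : A *m A ^t* = A ^t* *m A by rewrite AE adjmx_unitary_rdiag.
have AS := normal_spectral nA.
set V := spectralmx A in AS.
have uV : unitary V by exact: spectral_unitary.
have [p dp] : exists p : {perm 'I_N}, forall j,
    spectral_diag A 0 j = (\row_k (a k)%:C) 0 (p j).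
  by apply: (diag_unitary_perm uV uU); rewrite -AS.
have BE : sqrtmx A = V ^t* *m rdiag (fun k => Num.sqrt (a (p k))) *m V.
  have e : map_mx sqrtC (spectral_diag A) = \row_k (Num.sqrt (a (p k)))%:C.
    by apply/rowP => k; rewrite !mxE dp mxE sqrtC_RtoC.
  by rewrite /sqrtmx e (invmx_unitary (spectral_unitarymx A)).
have hB : (sqrtmx A) ^t* = sqrtmx A by rewrite BE adjmx_unitary_rdiag.
split=> //.
  have e : spectral_diag A =
      \row_k (Num.sqrt (a (p k)) * Num.sqrt (a (p k)))%:C.
    by apply/rowP => k; rewrite mxE dp mxE -expr2 sqr_sqrtr.
  by rewrite BE (unitary_rdiagM _ _ uV) [RHS]AS e.
have nB : sqrtmx A *m (sqrtmx A) ^t* = (sqrtmx A) ^t* *m sqrtmx A by rewrite hB.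
have [p' dp'] : exists p' : {perm 'I_N}, forall j, spectral_diag (sqrtmx A) 0 j =
    (\row_k (Num.sqrt (a (p k)))%:C) 0 (p' j).
  apply: (diag_unitary_perm (spectral_unitary (sqrtmx A)) uV).
  by rewrite -(normal_spectral nB).
by exists (p' * p)%g => k; rewrite dp' mxE permM.
Qed.

Variables (N : nat) (nrm : ('I_N -> R) -> R).
Hypothesis rnE : symmetric_norm nrm.
Implicit Types (A B S T U V : 'M[C]_N) (a b s : 'I_N -> R).

Definition schatten S : R := nrm (fun k => (singvals S)`_k).

Lemma schatten_spectral S U a : unitary U -> (forall k, 0 <= a k) ->
  sqmodmx S = U ^t* *m rdiag a *m U ->
  schatten S = nrm (fun k => Num.sqrt (a k)).
Proof.
move=> uU a0 SE; have [_ _ [p dp]] := sqrtmx_spectral uU a0 SE.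
have [p' dp'] := sort_ord_perm (fun x y : R => y <= x)
  (fun k => complex.Re (spectral_diag (absmx S) 0 k)) 0.
rewrite -(nrm_perm rnE p) -(nrm_perm rnE p' (fun i => Num.sqrt (a (p i)))).
by congr nrm; apply: funext => k; rewrite /singvals dp' /absmx dp.
Qed.

Lemma schatten_svd U V s : unitary U -> unitary V ->
  (forall k, 0 <= s k) -> schatten (U *m rdiag s *m V) = nrm s.
Proof.
move=> uU uV s0.
rewrite (@schatten_spectral _ V (fun k => s k * s k) uV).
- by congr nrm; apply: funext => k; rewrite -expr2 sqrtr_sqr ger0_norm.
- by move=> k; exact: mulr_ge0.
- rewrite /sqmodmx !adjmxM adjmx_rdiag !mulmxA -(mulmxA _ (U ^t*)).
  by rewrite (unitary_adjmul uU) mulmx1 -(mulmxA _ _ (rdiag s)) rdiagM.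
Qed.

(** On positive semidefinite matrices this is [rpow nrm 2] of the eigenvalues, hence the functional
    on sums of [sqmodmx] to which 2-convexity and 2-concavity apply directly. *)
Definition sqnorm A : R := schatten (sqrtmx A) ^+ 2.

Lemma sqnorm_ge0 A : 0 <= sqnorm A. Proof. exact: sqr_ge0. Qed.

Lemma sqnorm_spectral A U a : unitary U -> (forall k, 0 <= a k) ->
  A = U ^t* *m rdiag a *m U -> sqnorm A = rpow nrm 2 a.
Proof.
move=> uU a0 AE; have [hB BB _] := sqrtmx_spectral uU a0 AE.
rewrite (rpow2 rnE)//; congr (_ ^+ 2); apply: (schatten_spectral uU a0).
by rewrite /sqmodmx hB BB.
Qed.

Lemma schatten_ge0 S : 0 <= schatten S.
Proof. by exact: (nrm_ge0 rnE (fun k => (singvals S)`_k)). Qed.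

Lemma schatten_unitaryl U S : unitary U -> schatten (U *m S) = schatten S.
Proof.
move=> uU; have [P [Q [s [uP uQ s0 ->]]]] := svd S.
by rewrite !mulmxA (schatten_svd uP uQ s0) (schatten_svd (unitaryM uU uP) uQ s0).
Qed.

Lemma schatten_unitaryr U S : unitary U -> schatten (S *m U) = schatten S.
Proof.
move=> uU; have [P [Q [s [uP uQ s0 ->]]]] := svd S.
by rewrite -(mulmxA _ Q) (schatten_svd uP uQ s0) (schatten_svd uP (unitaryM uQ uU) s0).
Qed.

Lemma schatten_hermitian U (a : 'I_N -> R) : unitary U ->
  schatten (U ^t* *m rdiag a *m U) = nrm (fun k => `|a k|).
Proof.
move=> uU; pose sg k : R := if a k < 0 then -1 else 1.
have usg : unitary (rdiag sg).
  rewrite /unitary adjmx_rdiag rdiagM; apply/matrixP => i j.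
  rewrite !mxE /sg; case: ifP => _; rewrite ?mulrNN mulr1 //=.
have -> : rdiag a = rdiag sg *m rdiag (fun k => `|a k|).
  rewrite rdiagM; congr diag_mx; apply/rowP => k; rewrite !mxE /sg.
  by case: ltP => ak; rewrite ?mulN1r ?mul1r; [rewrite ltr0_norm// opprK|rewrite ger0_norm].
rewrite !mulmxA.
by rewrite (schatten_svd (unitaryM (unitary_adj uU) usg) uU).
Qed.

(* Ky Fan: by the arithmetic-geometric mean inequality, the diagonal of [A] in a
   pair of orthonormal bases is dominated by a bistochastic average of the
   singular values. *)
Lemma schatten_diag_le U V A : unitary U -> unitary V ->
  nrm (fun k => normc ((U *m A *m V) k k)) <= schatten A.
Proof.
move=> uU uV; have [P [Q [s [uP uQ s0 ->]]]] := svd A.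
rewrite schatten_svd//.
pose X := U *m P; pose Y := Q *m V.
have uX : unitary X by exact: unitaryM.
have uY : unitary Y by exact: unitaryM.
pose D k l := 2^-1 * (normc (X k l) ^+ 2 + normc (Y l k) ^+ 2).
have D0 k l : 0 <= D k l by rewrite mulr_ge0// addr_ge0// sqr_ge0.
apply: (@le_trans _ _ (nrm (fun k => \sum_l D k l * s l))); last first.
  apply: (nrm_substochastic rnE) => // [k|l].
  - rewrite -mulr_sumr big_split/= (unitary_row _ uX) (unitary_col _ uY).
    by rewrite mulVf.
  - rewrite -mulr_sumr big_split/= (unitary_col _ uX) (unitary_row _ uY).
    by rewrite mulVf.
apply: (nrm_le rnE) => k.
rewrite [X in _ <= X]ger0_norm ?sumr_ge0// => [|l _]; last exact: mulr_ge0.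
have -> : U *m (P *m rdiag s *m Q) *m V = X *m rdiag s *m Y by rewrite !mulmxA.
rewrite ger0_norm ?normc_ge0//.
rewrite -lecR.
have -> : forall z : C, (normc z)%:C = `|z| by [].
rewrite mxE; apply: le_trans (ler_norm_sum _ _ _) _.
rewrite rmorph_sum /=; apply: ler_sum => l _.
rewrite /rdiag mul_mx_diag !mxE !normrM.
rewrite (_ : `|(s l)%:C| = (s l)%:C); last by rewrite ger0_norm// lecR.
rewrite -mulrA mulrCA.
have -> : forall x y : C, `|x| * `|y| = (normc x * normc y)%:C.
  by move=> x y; rewrite rmorphM.
rewrite -rmorphM lecR mulrC; apply: ler_wpM2r => //.
rewrite /D; set x := normc (X k l); set y := normc (Y l k).
have -> : normc (\sum_j U k j * P j l) = x by rewrite /x /X mxE.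
have -> : normc (\sum_j Q l j * V j k) = y by rewrite /y /Y mxE.
by have := sqr_ge0 (x - y); rewrite sqrrB; lra.
Qed.

(** The singular bases of [A + B] exhibit its singular values as the sum of the diagonals of [A] and
    [B] in these bases; each diagonal is bounded by [schatten_diag_le]. *)
Lemma schattenD A B : schatten (A + B) <= schatten A + schatten B.
Proof.
have [P [Q [s [uP uQ s0 ABE]]]] := svd (A + B).
rewrite [in leLHS]ABE schatten_svd//.
have sE k : (s k)%:C = ((P ^t*) *m A *m Q ^t*) k k + ((P ^t*) *m B *m Q ^t*) k k.
  have -> : ((P ^t*) *m A *m Q ^t*) k k + ((P ^t*) *m B *m Q ^t*) k k =
    ((P ^t*) *m (A + B) *m Q ^t*) k k by rewrite mulmxDr mulmxDl [RHS]mxE.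
  rewrite ABE !mulmxA (unitary_adjmul uP) mul1mx -mulmxA uQ mulmx1.
  by rewrite !mxE eqxx.
have uP' := unitary_adj uP.
have uQ' := unitary_adj uQ.
apply: le_trans (lerD (schatten_diag_le A uP' uQ') (schatten_diag_le B uP' uQ')).
apply: le_trans (nrmD rnE _ _).
apply: (nrm_le rnE) => k.
rewrite [X in _ <= X]ger0_norm ?addr_ge0 ?normc_ge0// -normc_real sE.
exact: le_normcD.
Qed.

Lemma schattenZ (c : C) A : schatten (c *: A) = normc c * schatten A.
Proof.
have [P [Q [s [uP uQ s0 ->]]]] := svd A.
have uu : unitary (phase c *: P).
  rewrite /unitary adjmxZ -scalemxAl -scalemxAr scalerA phase_unit.
  by rewrite scale1r uP.
have -> : c *: (P *m rdiag s *m Q) =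
    (phase c *: P) *m rdiag (fun k => normc c * s k) *m Q.
  by rewrite rdiagZ -!scalemxAl -scalemxAr -scalemxAl scalerA mulrC phaseE.
rewrite (schatten_svd uP uQ s0) (schatten_svd uu uQ) => [|k].
  by rewrite (nrmZ rnE) ger0_norm ?normc_ge0.
by rewrite mulr_ge0 ?normc_ge0.
Qed.

Local Opaque schatten sqrtmx rdiag.

Lemma unitary_diag_rdiag U V a k :
  (complex.Re ((U *m (V ^t* *m rdiag a *m V) *m U ^t*) k k)) =
  \sum_l normc ((U *m V ^t*) k l) ^+ 2 * a l.
Proof.
set M := U *m V ^t*.
have -> : U *m (V ^t* *m rdiag a *m V) *m U ^t* = M *m rdiag a *m M ^t*.
  by rewrite /M adjmxM adjmxK !mulmxA.
rewrite mxE.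
transitivity (complex.Re (\sum_l ((normc (M k l) ^+ 2 * a l)%:C : C))).
  congr complex.Re; apply: eq_bigr => l _.
  rewrite mulmx_rdiagE [X in _ * X]mxE [X in _ * Num.conj X]mxE.
  by rewrite mulrAC -sqr_normcE -rmorphM.
by rewrite -rmorph_sum.
Qed.

(** The bridge from spectral data to majorization: these are the coefficients of
    [unitary_diag_rdiag], expressing a diagonal in one eigenbasis through the eigenvalues in
    another. *)
Lemma sqr_unitary_bistochastic U V : unitary U -> unitary V ->
  let D k l := normc ((U *m V ^t*) k l) ^+ 2 in
  [/\ forall k l, 0 <= D k l, forall k, \sum_l D k l = 1 &
      forall l, \sum_k D k l = 1].
Proof.
move=> uU uV D.
have uM : unitary (U *m V ^t*) by apply: unitaryM => //; exact: unitary_adj.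
split=> [k l|k|l]; [exact: sqr_ge0|exact: unitary_row|exact: unitary_col].
Qed.

Local Opaque sqnorm.

Lemma sqnorm_sqmod S : sqnorm (sqmodmx S) = schatten S ^+ 2.
Proof.
have [U uU [a a0 SE]] := psdmx_spectral (psdmx_sqmod S).
by rewrite (sqnorm_spectral uU a0 SE) (rpow2 rnE a0) (schatten_spectral uU a0 SE).
Qed.

Lemma sqnorm_conj A U : psdmx A -> unitary U ->
  sqnorm (U *m A *m U ^t*) = sqnorm A.
Proof.
move=> pA uU; have [V uV [a a0 AE]] := psdmx_spectral pA.
have uVU : unitary (V *m U ^t*) by apply: unitaryM => //; exact: unitary_adj.
rewrite (sqnorm_spectral uV a0 AE); apply: (sqnorm_spectral uVU a0).
by rewrite AE adjmxM adjmxK !mulmxA.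
Qed.

Lemma sqnormZ (c : R) A : 0 <= c -> psdmx A ->
  sqnorm (c%:C *: A) = c * sqnorm A.
Proof.
move=> c0 pA; have [V uV [a a0 AE]] := psdmx_spectral pA.
rewrite (sqnorm_spectral uV a0 AE) -(rpowZ rnE (ltr0n _ 2) c0 a0).
apply: (sqnorm_spectral uV) => [k|]; first exact: mulr_ge0.
by rewrite rdiagZ AE -scalemxAr -scalemxAl.
Qed.

Lemma spectral_add_diag A B U V W a b c : unitary W ->
  A + B = W ^t* *m rdiag c *m W -> A = U ^t* *m rdiag a *m U ->
  B = V ^t* *m rdiag b *m V ->
  c = fun k => \sum_l normc ((W *m U ^t*) k l) ^+ 2 * a l +
    \sum_l normc ((W *m V ^t*) k l) ^+ 2 * b l.
Proof.
move=> uW ABE AE BE; apply: funext => k; rewrite -!unitary_diag_rdiag -AE -BE.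
transitivity (complex.Re ((W *m (A + B) *m W ^t*) k k)).
  rewrite ABE !mulmxA uW mul1mx -mulmxA uW mulmx1.
  by rewrite rdiagE eqxx.
by rewrite mulmxDr mulmxDl mxE raddfD.
Qed.

(** In an eigenbasis of the sum, its eigenvalues are the diagonal of [A] plus that of [B].
    Superadditivity separates the two diagonals, and each has a larger [rpow] than the eigenvalues
    of which it is an average. For the subadditive counterpart both inequalities are reversed. *)
Lemma sqnorm_superadditive A B : rpow_superadditive nrm 2 ->
  psdmx A -> psdmx B -> sqnorm A + sqnorm B <= sqnorm (A + B).
Proof.
move=> cE pA pB; have [W uW [c c0 ABE]] := psdmx_spectral (psdmxD pA pB).
have [U uU [a a0 AE]] := psdmx_spectral pA.
have [V uV [b b0 BE]] := psdmx_spectral pB.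
rewrite (sqnorm_spectral uW c0 ABE) (sqnorm_spectral uU a0 AE).
rewrite (sqnorm_spectral uV b0 BE).
have [D0 Dr Dc] := sqr_unitary_bistochastic uW uU.
have [D'0 D'r D'c] := sqr_unitary_bistochastic uW uV.
rewrite (spectral_add_diag uW ABE AE BE).
apply: le_trans (cE _ _ _ _); last 2 first.
- by move=> k; apply: sumr_ge0 => l _; rewrite mulr_ge0 ?sqr_ge0.
- by move=> k; apply: sumr_ge0 => l _; rewrite mulr_ge0 ?sqr_ge0.
by apply: lerD; apply: (rpow_bistochastic_ge rnE).
Qed.

Lemma sqnorm_subadditive A B : rpow_subadditive nrm 2 ->
  psdmx A -> psdmx B -> sqnorm (A + B) <= sqnorm A + sqnorm B.
Proof.
move=> cE pA pB; have [W uW [c c0 ABE]] := psdmx_spectral (psdmxD pA pB).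
have [U uU [a a0 AE]] := psdmx_spectral pA.
have [V uV [b b0 BE]] := psdmx_spectral pB.
rewrite (sqnorm_spectral uW c0 ABE) (sqnorm_spectral uU a0 AE).
rewrite (sqnorm_spectral uV b0 BE).
have [D0 Dr Dc] := sqr_unitary_bistochastic uW uU.
have [D'0 D'r D'c] := sqr_unitary_bistochastic uW uV.
rewrite (spectral_add_diag uW ABE AE BE).
apply: le_trans (cE _ _ _ _) _ => [k|k|].
- by apply: sumr_ge0 => l _; rewrite mulr_ge0 ?sqr_ge0.
- by apply: sumr_ge0 => l _; rewrite mulr_ge0 ?sqr_ge0.
apply: lerD.
- by apply: (rpow_substochastic_le rnE (ltr0n _ 2) cE D0) => // k;
    rewrite ?Dr ?Dc.
- by apply: (rpow_substochastic_le rnE (ltr0n _ 2) cE D'0) => // k;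
    rewrite ?D'r ?D'c.
Qed.

(** In an eigenbasis of [A], the diagonal of [A + B] dominates the eigenvalues of [A], and this
    diagonal is an average of the eigenvalues of [A + B]. *)
Lemma sqnorm_le A B : rpow_subadditive nrm 2 ->
  psdmx A -> psdmx B -> sqnorm A <= sqnorm (A + B).
Proof.
move=> cE pA pB; have [W uW [c c0 ABE]] := psdmx_spectral (psdmxD pA pB).
have [U uU [a a0 AE]] := psdmx_spectral pA.
rewrite (sqnorm_spectral uW c0 ABE) (sqnorm_spectral uU a0 AE).
have [D0 Dr Dc] := sqr_unitary_bistochastic uU uW.
apply: le_trans (rpow_substochastic_le rnE (ltr0n _ 2) cE D0 _ _ c0) => [|k|l].
- apply: (rpow_le rnE) => // k; rewrite a0 /= -unitary_diag_rdiag -ABE.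
  rewrite mulmxDr mulmxDl mxE raddfD /= (_ : a k = complex.Re ((U *m A *m U ^t*) k k)).
    by rewrite lerDl; case: (psdmx_diag k (psdmx_conj U pB)).
  rewrite AE !mulmxA uU mul1mx -mulmxA uU mulmx1.
  by rewrite rdiagE eqxx.
- by rewrite Dr.
- by rewrite Dc.
Qed.

End SchattenNorm.

(** Bound on the divided differences of the map sending [a] to [a * wa]. When [a] and [b] have
    opposite signs it holds without the factor [q - 1]. When they have the same sign, the growth
    condition compares [wb] with [wa] times the ratio to the power [q - 2], and the tangent of the
    power [q - 1] at 1 produces the factor [q - 1]. *)
Lemma weight_scalar_ineq (R : realType) (q a b wa wb : R) : 2 <= q ->
  0 <= wa -> 0 <= wb ->
  (0 < `|b| < `|a| -> wb <= wa /\ wa * `|b| `^ (q - 2) <= wb * `|a| `^ (q - 2)) ->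
  `|b| <= `|a| ->
  (a - b) * (a * wa - b * wb) <= (q - 1) * (a - b) ^+ 2 * (wa + wb).
Proof.
move=> q2 wa0 wb0 hw ba.
have q1 : 1 <= q - 1 by lra.
have base : (a - b) * (a * wa - b * wb) <= (a - b) ^+ 2 * (wa + wb) ->
    (a - b) * (a * wa - b * wb) <= (q - 1) * (a - b) ^+ 2 * (wa + wb).
  move=> /le_trans; apply; rewrite -mulrA ler_peMl//.
  by rewrite mulr_ge0 ?sqr_ge0 ?addr_ge0.
have [ab|ab] := leP (a * b) 0.
  apply: base; rewrite -subr_ge0.
  rewrite (_ : _ - _ = - (a * b) * (wa + wb) + (b ^+ 2 * wa + a ^+ 2 * wb)); last by ring.
  apply: addr_ge0; first by rewrite mulr_ge0 ?oppr_ge0 ?addr_ge0.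
  by apply: addr_ge0; apply: mulr_ge0 => //; exact: sqr_ge0.
have [|ltba] := leP `|a| `|b|.
  move=> leab; have /eqP : `|a| = `|b| by apply/le_anti; rewrite leab ba.
  rewrite eqr_norm2 => /orP[/eqP->|/eqP ab'].
    by rewrite subrr mul0r expr0n/= mulr0 mul0r.
  by move: ab; rewrite ab'; have := sqr_ge0 b; rewrite expr2; lra.
have b0 : 0 < `|b| by rewrite normr_gt0; apply: contraTneq ab => ->; rewrite mulr0 ltxx.
have [|wba wab] := hw; first by rewrite b0.
have a0 : 0 < `|a| by exact: lt_trans ltba.
have -> : (a - b) ^+ 2 = (`|a| - `|b|) ^+ 2.
  rewrite !sqrrB !real_normK ?num_real//; congr (_ - _ *+ 2 + _).
  by rewrite -normrM gtr0_norm.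
have -> : (a - b) * (a * wa - b * wb) =
    (`|a| - `|b|) * (`|a| * wa - `|b| * wb).
  transitivity (a ^+ 2 * wa + b ^+ 2 * wb - a * b * (wa + wb)); first by ring.
  rewrite -(real_normK (num_real a)) -(real_normK (num_real b)).
  by rewrite -[a * b]gtr0_norm// normrM; ring.
move: `|a| `|b| a0 b0 ltba wab => x y x0 y0 yx wab {ba hw base ab a b}.
have xy0 : 0 < x - y by rewrite subr_gt0.
have x1 : 0 < x `^ (q - 2) by exact: powR_gt0.
have rho := @powR_ge_tangent _ (q - 1) (y / x) q1 (divr_ge0 (ltW y0) (ltW x0)).
have rE : (y / x) `^ (q - 1) = y * y `^ (q - 2) / (x * x `^ (q - 2)).
  rewrite powRM ?(ltW y0) ?invr_ge0 ?(ltW x0)//.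
  have pE z : 0 < z -> z `^ (q - 1) = z * z `^ (q - 2).
    move=> z0; rewrite -(mulr_powRB1 (ltW z0) (lt_le_trans ltr01 q1)).
    by congr (_ * _ `^ _); ring.
  rewrite (pE y y0) -(powR_inv1 (ltW x0)) -powRrM mulN1r powRN.
  by rewrite (pE x x0).
rewrite rE in rho.
have rho' : x * x `^ (q - 2) * (1 + (q - 1) * (y / x - 1)) <= y * y `^ (q - 2).
  by move: rho; rewrite ler_pdivlMr ?mulr_gt0// mulrC.
move: (x `^ (q - 2)) (y `^ (q - 2)) x1 wab rho' {rho rE} => X Y X0 wab rho.
have rho2 : X * (x - (q - 1) * (x - y)) <= y * Y.
  apply: le_trans rho; rewrite le_eqVlt; apply/orP; left; apply/eqP.
  by field; rewrite gt_eqF.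
(* The growth condition multiplied by [y] bounds [y * wb] from below by [x * wa] times the ratio
   [y / x] to the power [q - 1], to which the tangent inequality applies. *)
have key : x * wa - y * wb <= (q - 1) * (x - y) * wa.
  suff : X * (x * wa - y * wb) <= X * ((q - 1) * (x - y) * wa).
    by rewrite ler_pM2l.
  have h1 := ler_wpM2l wa0 rho2; have h2 := ler_wpM2l (ltW y0) wab.
  lra.
rewrite [_ * (x - y) ^+ 2]mulrC expr2 -!mulrA ler_pM2l//.
apply: le_trans key _; rewrite -mulrA mulrCA; apply: ler_wpM2l; first exact: ltW.
by apply: ler_wpM2l; [lra|rewrite lerDl].
Qed.

Lemma sqr_le_of_halves (R : realFieldType) (q X u v A B D : R) : 2 <= q ->
  0 <= X -> X <= u + v -> u ^+ 2 <= 2 * (q - 1) * A ->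
  v ^+ 2 <= 2 * (q - 1) * B -> A <= 2^-1 * D -> B <= 2^-1 * D ->
  X ^+ 2 <= 4 * (q - 1) * D.
Proof.
move=> q2 X0 Xuv uA vB AD BD.
have q1 : 0 <= 2 * (q - 1) by lra.
have := ler_wpM2l q1 AD; have := ler_wpM2l q1 BD.
have : X ^+ 2 <= (u + v) ^+ 2 by rewrite ler_sqr ?nnegrE// (le_trans X0).
by have := sqr_ge0 (u - v); rewrite sqrrB sqrrD; lra.
Qed.

(** * Unitary conjugation and trace formulas for pairs of spectral decompositions *)

Section UnitaryConjugation.
Variables (R : realType) (N : nat).
Local Notation C := R[i].
Implicit Types (A B S T U V : 'M[C]_N).

Definition Ad V A : 'M[C]_N := V *m A *m V ^t*.

Lemma AdD V A B : Ad V (A + B) = Ad V A + Ad V B.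
Proof. by rewrite /Ad mulmxDr mulmxDl. Qed.

Lemma AdN V A : Ad V (- A) = - Ad V A.
Proof. by rewrite /Ad mulmxN mulNmx. Qed.

Lemma AdZ V (c : C) A : Ad V (c *: A) = c *: Ad V A.
Proof. by rewrite /Ad -scalemxAr -scalemxAl. Qed.

Lemma Ad0 V : Ad V 0 = 0.
Proof. by rewrite /Ad mulmx0 mul0mx. Qed.

Lemma Ad1 V : unitary V -> Ad V 1%:M = 1%:M.
Proof. by move=> uV; rewrite /Ad mulmx1. Qed.

Lemma Ad_sum V I (r : seq I) (P : pred I) (F : I -> 'M[C]_N) :
  Ad V (\sum_(i <- r | P i) F i) = \sum_(i <- r | P i) Ad V (F i).
Proof.
by elim/big_rec2: _ => [|i A B _ <-]; [exact: Ad0|exact: AdD].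
Qed.

Lemma AdM V A B : unitary V -> Ad V (A *m B) = Ad V A *m Ad V B.
Proof.
move=> uV; rewrite /Ad !mulmxA -(mulmxA (V *m A) (V ^t*)).
by rewrite (unitary_adjmul uV) mulmx1.
Qed.

Lemma Ad_adj V A : (Ad V A) ^t* = Ad V (A ^t*).
Proof. by rewrite /Ad !adjmxM adjmxK mulmxA. Qed.

Lemma Ad_comp U V A : Ad (U *m V) A = Ad U (Ad V A).
Proof. by rewrite /Ad adjmxM !mulmxA. Qed.

Lemma Ad_comm V A : unitary V -> V *m A = A *m V -> Ad V A = A.
Proof. by move=> uV VA; rewrite /Ad VA -mulmxA uV mulmx1. Qed.

Lemma Ad_anticomm V A : unitary V -> V *m A = - (A *m V) -> Ad V A = - A.
Proof. by move=> uV VA; rewrite /Ad VA mulNmx -mulmxA uV mulmx1. Qed.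

Lemma sqmodmx_Ad V S : unitary V -> sqmodmx (Ad V S) = Ad V (sqmodmx S).
Proof. by move=> uV; rewrite /sqmodmx Ad_adj (AdM _ _ uV). Qed.

Lemma adjmxN S : (- S) ^t* = - S ^t*.
Proof. by rewrite linearN /= map_mxN. Qed.

Lemma sqmodmxN S : sqmodmx (- S) = sqmodmx S.
Proof. by rewrite /sqmodmx adjmxN mulNmx mulmxN opprK. Qed.

Lemma sqmodmx_parallelogram S T :
  sqmodmx (T + S) + sqmodmx (T - S) = (sqmodmx T + sqmodmx S) *+ 2.
Proof.
rewrite /sqmodmx adjmxD adjmxB !mulmxDl !mulmxDr !mulNmx !mulmxN opprK.
set a := _ *m _; set b := _ *m _; set c := _ *m _; set d := _ *m _.
clearbody a b c d; apply/matrixP => i j; rewrite !mxE.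
by move: (a i j) (b i j) (c i j) (d i j) => {}a {}b {}c {}d; ring.
Qed.

Lemma scale_double A : A *+ 2 = (2%:C : C) *: A.
Proof. by rewrite -scaler_nat rmorph_nat. Qed.

Lemma ReM_real (x : R) (z : C) : complex.Re (x%:C * z) = x * complex.Re z.
Proof. by case: z => u v /=; rewrite mul0r subr0. Qed.

Definition rtr A : R := complex.Re (\tr A).

Lemma rtrD A B : rtr (A + B) = rtr A + rtr B.
Proof. by rewrite /rtr mxtraceD raddfD. Qed.

Lemma rtrN A : rtr (- A) = - rtr A.
Proof. by rewrite /rtr raddfN raddfN. Qed.

Lemma rtr0 : rtr 0 = 0.
Proof. by rewrite /rtr mxtrace0. Qed.

Lemma rtrMn A k : rtr (A *+ k) = rtr A *+ k.
Proof. by elim: k => [|k IH]; rewrite ?mulr0n ?rtr0// !mulrS rtrD IH. Qed.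

Lemma rtrC A B : rtr (A *m B) = rtr (B *m A).
Proof. by rewrite /rtr mxtrace_mulC. Qed.

Lemma rtr_sum I (r : seq I) (P : pred I) (F : I -> 'M[C]_N) :
  rtr (\sum_(i <- r | P i) F i) = \sum_(i <- r | P i) rtr (F i).
Proof.
by elim/big_rec2: _ => [|i A B _ <-]; rewrite ?rtr0 ?rtrD.
Qed.

Lemma rtr_Ad V A : unitary V -> rtr (Ad V A) = rtr A.
Proof. by move=> uV; rewrite /Ad rtrC mulmxA (unitary_adjmul uV) mul1mx. Qed.

Definition spec U (a : 'I_N -> R) : 'M[C]_N := U ^t* *m rdiag a *m U.

Lemma spec_Ad U V a : Ad V (spec U a) = spec (U *m V ^t*) a.
Proof. by rewrite /Ad /spec adjmxM adjmxK !mulmxA. Qed.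

Lemma specM U a b : unitary U ->
  spec U a *m spec U b = spec U (fun k => a k * b k).
Proof. exact: unitary_rdiagM. Qed.

Lemma rdiag_mulmxE a A i j : (rdiag a *m A) i j = (a i)%:C * A i j.
Proof. by rewrite mul_diag_mx !mxE. Qed.

Lemma specE U a : spec U a = U ^t* *m rdiag a *m U.
Proof. by []. Qed.

Lemma rtr_spec U a Z :
  rtr (spec U a *m Z) = \sum_k a k * complex.Re ((U *m Z *m U ^t*) k k).
Proof.
have -> : rtr (spec U a *m Z) = rtr (rdiag a *m (U *m Z *m U ^t*)).
  by rewrite rtrC /spec !mulmxA rtrC !mulmxA rtrC !mulmxA rtrC !mulmxA.
rewrite /rtr /mxtrace raddf_sum; apply: eq_bigr => k _.
by rewrite rdiag_mulmxE -ReM_real.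
Qed.

Lemma rtr_spec2 U V a b : unitary U -> unitary V ->
  rtr (spec U a *m spec V b) =
  \sum_k \sum_l normc ((U *m V ^t*) k l) ^+ 2 * (a k * b l).
Proof.
move=> uU uV; rewrite rtr_spec; apply: eq_bigr => k _.
rewrite /spec unitary_diag_rdiag mulr_sumr; apply: eq_bigr => l _.
by ring.
Qed.

Lemma rtr_specl U V a b : unitary U -> unitary V ->
  rtr (spec U a *m spec U b) =
  \sum_k \sum_l normc ((U *m V ^t*) k l) ^+ 2 * (a k * b k).
Proof.
move=> uU uV; have [_ Dr _] := sqr_unitary_bistochastic uU uV.
rewrite rtr_spec; apply: eq_bigr => k _; rewrite -mulr_suml Dr mul1r.
by rewrite /spec !mulmxA uU mul1mx -mulmxA uU mulmx1 rdiagE eqxx.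
Qed.

Lemma rtr_specr U V a b : unitary U -> unitary V ->
  rtr (spec V a *m spec V b) =
  \sum_k \sum_l normc ((U *m V ^t*) k l) ^+ 2 * (a l * b l).
Proof.
move=> uU uV; have [_ _ Dc] := sqr_unitary_bistochastic uU uV.
rewrite exchange_big /= rtr_spec; apply: eq_bigr => l _; rewrite -mulr_suml Dc mul1r.
by rewrite /spec !mulmxA uV mul1mx -mulmxA uV mulmx1 rdiagE eqxx.
Qed.

Lemma normc_conj (z : C) : normc (Num.conj z) = normc z.
Proof. by case: z => x y /=; rewrite sqrrN. Qed.

Lemma Re_mul_adjmx A k :
  complex.Re ((A *m A ^t*) k k) = \sum_l normc (A k l) ^+ 2.
Proof.
rewrite [X in complex.Re X]mxE raddf_sum; apply: eq_bigr => l _.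
by rewrite [X in _ * X]mxE [X in _ * Num.conj X]mxE -sqr_normcE.
Qed.

Lemma Re_adjmx_mul A k :
  complex.Re ((A ^t* *m A) k k) = \sum_l normc (A l k) ^+ 2.
Proof.
rewrite -{2}(adjmxK A) Re_mul_adjmx; apply: eq_bigr => l _.
by rewrite [X in normc X]mxE [X in Num.conj X]mxE normc_conj.
Qed.

Local Opaque spec rtr Ad.

(** A double spectral sum: the trace is spread over pairs of eigenvalues with the weights of
    [sqr_unitary_bistochastic]. [rtr_spec_diff2] uses the same weights, so a scalar inequality
    between the summands yields an inequality of traces although the matrices do not commute. *)
Lemma rtr_spec_diff U V a b : unitary U -> unitary V ->
  rtr ((spec U a - spec V a) *m (spec U b - spec V b)) =
  \sum_k \sum_l normc ((U *m V ^t*) k l) ^+ 2 * ((a k - a l) * (b k - b l)).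
Proof.
move=> uU uV; rewrite mulmxBl !mulmxBr !rtrD !rtrN !rtrD !rtrN.
rewrite [rtr (spec V a *m spec U b)]rtrC.
rewrite [X in X - _ - (_ - _)](rtr_specl a b uU uV).
rewrite [X in _ - X - (_ - _)](rtr_spec2 a b uU uV).
rewrite [X in _ - _ - (X - _)](rtr_spec2 b a uU uV).
rewrite [X in _ - _ - (_ - X)](rtr_specr a b uU uV).
rewrite !opprD opprK -!sumrN -!big_split /=; apply: eq_bigr => k _.
by rewrite -!sumrN -!big_split /=; apply: eq_bigr => l _; ring.
Qed.

Lemma rtr_spec_diff2 U V a w : unitary U -> unitary V ->
  let D := spec U a - spec V a in
  rtr ((spec U w + spec V w) *m (D *m D)) =
  \sum_k \sum_l normc ((U *m V ^t*) k l) ^+ 2 * ((a k - a l) ^+ 2 * (w k + w l)).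
Proof.
move=> uU uV D.
have hD : D ^t* = D by rewrite adjmxB !specE !adjmx_unitary_rdiag.
pose M := U *m V ^t*; pose G := U *m D *m V ^t*.
(* Written between the two eigenbases, [D] becomes the entrywise product of [M] with the differences
   [a k - a l]. *)
have GE k l : normc (G k l) ^+ 2 = normc (M k l) ^+ 2 * (a k - a l) ^+ 2.
  have -> : G = rdiag a *m M - M *m rdiag a.
    rewrite /G /D mulmxBr mulmxBl !specE !mulmxA uU mul1mx -!mulmxA.
    by rewrite uV mulmx1.
  rewrite mxE [X in _ + X]mxE rdiag_mulmxE mulmx_rdiagE [M k l * _]mulrC -mulrBl.
  rewrite Normc.normcM -[X in normc X * _]rmorphB normc_real exprMn real_normK ?num_real//.
  by rewrite mulrC.
have GG : U *m (D *m D) *m U ^t* = G *m G ^t*.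
  rewrite /G !adjmxM adjmxK hD !mulmxA -(mulmxA _ (V ^t*) V).
  by rewrite (unitary_adjmul uV) mulmx1.
have GG' : V *m (D *m D) *m V ^t* = G ^t* *m G.
  rewrite /G !adjmxM adjmxK hD !mulmxA -(mulmxA _ (U ^t*) U).
  by rewrite (unitary_adjmul uU) mulmx1.
rewrite mulmxDl rtrD !rtr_spec GG GG'.
rewrite [X in _ + X](_ : _ =
    \sum_k \sum_l normc (M k l) ^+ 2 * (a k - a l) ^+ 2 * w l); last first.
  rewrite exchange_big /=; apply: eq_bigr => l _.
  by rewrite Re_adjmx_mul mulr_sumr; apply: eq_bigr => k _; rewrite GE mulrC.
rewrite -big_split /=; apply: eq_bigr => k _.
rewrite Re_mul_adjmx mulr_sumr -big_split /=; apply: eq_bigr => l _.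
by rewrite GE; ring.
Qed.

End UnitaryConjugation.

(** * Khintchine inequalities under sign flips *)

Section SignFlips.
Variables (R : realType) (N : nat) (nrm : ('I_N -> R) -> R).
Hypothesis rnE : symmetric_norm nrm.
Local Notation C := R[i].
Implicit Types (A B S T U V X Z : 'M[C]_N) (a b w : 'I_N -> R).

(** A deterministic substitute for Rademacher signs: each sign can be changed alone by a
    conjugation, which preserves Schatten norms. *)
Definition sign_flips m (V y : 'I_m -> 'M[C]_N) :=
  (forall j, unitary (V j)) /\
  forall j k, Ad (V j) (y k) = if j == k then - y k else y k.

(* Conjugation by [V k] fixes everything but [y k], so superadditivity and the
   parallelogram identity pull the [y k] out of the square one at a time. *)
Lemma sqnorm_sum_flips m (V y : 'I_m -> 'M[C]_N) (s : seq 'I_m) B :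
  rpow_superadditive nrm 2 -> sign_flips V y -> uniq s ->
  psdmx B -> (forall j, Ad (V j) B = B) ->
  sqnorm nrm (sqmodmx (\sum_(j <- s) y j) + B) <=
  sqnorm nrm (\sum_(j <- s) sqmodmx (y j) + B).
Proof.
move=> cE [uV Vy]; elim: s B => [|k s IH] B /=.
  by rewrite !big_nil => _ pB VB; rewrite /sqmodmx mulmx0 lexx.
move=> /andP[ks us] pB VB; rewrite !big_cons.
set Y := \sum_(j <- s) y j; set S := \sum_(j <- s) sqmodmx (y j).
have VY : Ad (V k) Y = Y.
  rewrite /Y Ad_sum big_seq [RHS]big_seq; apply: eq_bigr => j js.
  by rewrite Vy; case: eqP => // kj; move: ks; rewrite kj js.
pose Z := sqmodmx (y k + Y) + B.
have pZ : psdmx Z := psdmxD (psdmx_sqmod _) pB.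
have VZ : Ad (V k) Z = sqmodmx (Y - y k) + B.
  by rewrite /Z AdD VB -(sqmodmx_Ad _ (uV k)) AdD VY Vy eqxx [- y k + Y]addrC.
have ZE : Z + Ad (V k) Z = (2%:C : C) *: (sqmodmx Y + (sqmodmx (y k) + B)).
  rewrite VZ /Z addrACA [y k + Y]addrC sqmodmx_parallelogram -mulr2n -mulrnDl.
  by rewrite scale_double addrA.
have pB' : psdmx (sqmodmx (y k) + B) := psdmxD (psdmx_sqmod _) pB.
apply: (@le_trans _ _ (sqnorm nrm (sqmodmx Y + (sqmodmx (y k) + B)))); last first.
  apply: le_trans (IH _ us pB' _) _.
  - move=> j; rewrite AdD VB -(sqmodmx_Ad _ (uV j)) Vy.
    by case: eqP => _; rewrite ?sqmodmxN.
  - by rewrite -/S addrA [S + _]addrC lexx.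
have := sqnorm_superadditive rnE cE pZ (psdmx_conj (V k) pZ).
rewrite (sqnorm_conj rnE pZ (uV k)) -[_ *m _ *m _]/(Ad (V k) Z) ZE.
rewrite (sqnormZ rnE (ler0n _ 2) (psdmxD (psdmx_sqmod Y) pB')) -/Z.
by move: (sqnorm nrm Z) (sqnorm nrm _) => u v; clear; lra.
Qed.

Lemma schatten_flips_concave m (V y : 'I_m -> 'M[C]_N) :
  rpow_superadditive nrm 2 -> sign_flips V y ->
  schatten nrm (\sum_j y j) ^+ 2 <= sqnorm nrm (\sum_j sqmodmx (y j)).
Proof.
move=> cE fVy; rewrite -(sqnorm_sqmod rnE).
have V0 j : Ad (V j) 0 = 0 by exact: Ad0.
have := sqnorm_sum_flips cE fVy (index_enum_uniq _) (@psdmx0 R N) V0.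
by rewrite !addr0.
Qed.

(** Matrix form of the domination clause of [has_weights]: the diagonal of [Z] in the basis [U] is a
    bistochastic average of its eigenvalues, and averaging does not increase a subadditive
    [rpow 2]. *)
Lemma rtr_weights_le q U w Z : has_weights nrm q -> unitary U ->
  (forall k, 0 <= w k) ->
  (forall g : 'I_N -> R, \sum_k w k * g k ^+ 2 <= nrm g ^+ 2) ->
  psdmx Z -> rtr (spec U w *m Z) <= sqnorm nrm Z.
Proof.
move=> wE uU w0 wg pZ; have [V uV [z z0 ZE]] := psdmx_spectral pZ.
rewrite (sqnorm_spectral rnE uV z0 ZE) rtr_spec.
have [D0 Dr Dc] := sqr_unitary_bistochastic uU uV.
pose d k := \sum_l normc ((U *m V ^t*) k l) ^+ 2 * z l.
have d0 k : 0 <= d k by apply: sumr_ge0 => l _; rewrite mulr_ge0.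
have dE k : complex.Re ((U *m Z *m U ^t*) k k) = d k.
  by rewrite ZE unitary_diag_rdiag.
apply: (@le_trans _ _ (rpow nrm 2 d)).
  rewrite (rpow2 rnE d0); apply: le_trans (wg _); apply: ler_sum => k _.
  by rewrite dE sqr_sqrtr.
apply: (rpow_substochastic_le rnE (ltr0n _ 2) (has_weights_subadditive rnE wE) D0) => //.
- by move=> k; rewrite Dr.
- by move=> k; rewrite Dc.
Qed.

(* With [X = sum_j y_j], [l] its eigenvalues and [f(l) = w l] for the weights [w]
   of [l], the square of the norm is [tr (X f(X))], and [tr (y_j f(X))] is a
   quarter of the trace of [(X - X_j) (f(X) - f(X_j))], [X_j] being [X] conjugated
   by [V j]; the growth condition on [w] bounds the divided differences of [f]. *)
Lemma khintchine_hermitian q m (V y : 'I_m -> 'M[C]_N) :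
  2 <= q -> has_weights nrm q -> sign_flips V y ->
  (forall j, (y j) ^t* = y j) ->
  schatten nrm (\sum_j y j) ^+ 2 <=
  2 * (q - 1) * sqnorm nrm (\sum_j sqmodmx (y j)).
Proof.
move=> q2 wE [uV Vy] hy.
set X := \sum_j y j.
have hX : X ^t* = X by rewrite adjmx_sum; apply: eq_bigr => j _; rewrite hy.
have [U [l [uU XE]]] := hermitian_spectral hX.
have [|w [w0 wx wg wm]] := wE (fun k => `|l k|); first by [].
pose f := spec U (fun k => l k * w k); pose h := spec U w.
have XfE : schatten nrm X ^+ 2 = rtr (X *m f).
  rewrite XE (schatten_hermitian rnE l uU) -wx -specE (specM _ _ uU).
  rewrite (_ : spec _ _ = spec U (fun k => w k * l k ^+ 2) *m 1%:M); last first.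
    rewrite mulmx1; congr spec; apply: funext => k; ring.
  rewrite rtr_spec mulmx1 uU; apply: eq_bigr => k _.
  by rewrite mxE eqxx mulr1 real_normK ?num_real.
have q1 : 0 <= q - 1 by clear -q2; lra.
have step j : rtr (y j *m f) <= 2 * (q - 1) * rtr (h *m sqmodmx (y j)).
  pose X' := Ad (V j) X; pose U' := U *m (V j) ^t*.
  have uU' : unitary U' := unitaryM uU (unitary_adj (uV j)).
  have X'E : X' = spec U' l by rewrite /X' XE -specE spec_Ad.
  have yE : X - X' = y j *+ 2.
    rewrite /X' /X Ad_sum -sumrB (bigD1 j) //= big1 => [|k kj].
      by rewrite addr0 Vy eqxx opprK mulr2n.
    by rewrite Vy eq_sym (negbTE kj) subrr.
  (* Conjugation preserves the trace and changes the sign of [y j], so the two terms in [f]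
     contribute equally; the doubling of [y j] gives the 4. With the 8 of [e2] this makes the
     constant [2 * (q - 1)]. *)
  have e1 : rtr ((X - X') *m (f - Ad (V j) f)) = 4 * rtr (y j *m f).
    rewrite yE mulmxBr rtrD rtrN !mulr2n !mulmxDl !rtrD.
    have -> : rtr (y j *m Ad (V j) f) = - rtr (y j *m f).
      rewrite -(rtr_Ad (y j *m f) (uV j)) (AdM _ _ (uV j)) Vy eqxx.
      by rewrite mulNmx rtrN opprK.
    by ring.
  have e2 : rtr ((h + Ad (V j) h) *m ((X - X') *m (X - X'))) =
      8 * rtr (h *m sqmodmx (y j)).
    have y2 : Ad (V j) (sqmodmx (y j)) = sqmodmx (y j).
      by rewrite -(sqmodmx_Ad _ (uV j)) Vy eqxx sqmodmxN.
    have -> : (X - X') *m (X - X') = sqmodmx (y j) *+ 4.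
      rewrite yE !mulr2n mulmxDl !mulmxDr {1}/sqmodmx hy -/(sqmodmx _).
      by rewrite -!mulr2n -mulrnA.
    rewrite -scaler_nat -scalemxAr mulmxDl.
    rewrite scaler_nat rtrMn -mulr_natl.
    rewrite rtrD (_ : rtr (Ad _ _ *m _) = rtr (h *m sqmodmx (y j))); first by ring.
    by rewrite -(rtr_Ad (h *m sqmodmx (y j)) (uV j)) (AdM _ _ (uV j)) y2.
  have : rtr ((X - X') *m (f - Ad (V j) f)) <=
      (q - 1) * rtr ((h + Ad (V j) h) *m ((X - X') *m (X - X'))).
    rewrite X'E /f /h !spec_Ad -/U' XE -specE.
    rewrite (rtr_spec_diff _ _ uU uU') (rtr_spec_diff2 _ _ uU uU').
    rewrite mulr_sumr; apply: ler_sum => k _; rewrite mulr_sumr.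
    apply: ler_sum => k' _; rewrite [leRHS]mulrCA; apply: ler_wpM2l.
      by rewrite sqr_ge0.
    rewrite mulrA.
    have [lk|/ltW lk] := leP `|l k'| `|l k|.
      exact: (weight_scalar_ineq q2 (w0 k) (w0 k') (wm k k')).
    have := weight_scalar_ineq q2 (w0 k') (w0 k) (wm k' k) lk.
    by rewrite -mulrNN -sqrrN !opprB [w k' + _]addrC.
  by rewrite e1 e2; move: (rtr _) (rtr _) => u v; clear; lra.
rewrite XfE.
have -> : rtr (X *m f) = \sum_j rtr (y j *m f) by rewrite mulmx_suml rtr_sum.
apply: le_trans (ler_sum _ (fun j _ => step j)) _.
rewrite -mulr_sumr; apply: ler_wpM2l; first by rewrite mulr_ge0.
rewrite -rtr_sum -mulmx_sumr.
apply: (rtr_weights_le wE uU w0 wg).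
by apply: psdmx_sum => j _; exact: psdmx_sqmod.
Qed.

(** The sign flips commute with the adjoint, hence act also on the real and imaginary parts [a j]
    and [b j] of [y j]. By the parallelogram identity the squares of these parts add up to half of
    the sum on the right; each part is estimated separately, and squaring the triangle inequality
    costs a factor 2. *)
Lemma khintchine q m (V y : 'I_m -> 'M[C]_N) :
  2 <= q -> has_weights nrm q -> sign_flips V y ->
  schatten nrm (\sum_j y j) ^+ 2 <=
  4 * (q - 1) * sqnorm nrm (\sum_j (sqmodmx (y j) + sqmodmx ((y j) ^t*))).
Proof.
move=> q2 wE [uV Vy].
pose c : C := 2^-1%:C; have c2 : c *+ 2 = 1.
  by rewrite /c -rmorphMn -mulr_natr mulVf// rmorph1.
pose a j := c *: (y j + (y j) ^t*); pose b j := (c * 'i) *: ((y j) ^t* - y j).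
have cc : Num.conj c = c by exact: conjC_real.
have ha j : (a j) ^t* = a j by rewrite adjmxZ cc adjmxD adjmxK addrC.
have hb j : (b j) ^t* = b j.
  rewrite adjmxZ rmorphM /= cc conjCi adjmxB adjmxK mulrN scaleNr.
  by rewrite -scalerN opprB.
have fa : sign_flips V a.
  split=> // j k; rewrite AdZ AdD -Ad_adj Vy; case: eqP => // _.
  by rewrite adjmxN -opprD scalerN.
have fb : sign_flips V b.
  split=> // j k; rewrite AdZ AdD AdN -Ad_adj Vy; case: eqP => // _.
  by rewrite adjmxN -opprD scalerN.
have yab j : y j = a j + 'i *: b j.
  have ici : 'i * (c * 'i) = - c by rewrite mulrCA -expr2 sqrCi mulrN1.
  rewrite /a /b scalerA ici scaleNr -scalerN opprB -scalerDr addrACA.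
  by rewrite subrr addr0 -mulr2n -scaler_nat scalerA mulr_natr c2 scale1r.
have pS M : psdmx (sqmodmx M) := psdmx_sqmod M.
have sqmodZ (z : C) M : sqmodmx (z *: M) = (normc z ^+ 2)%:C *: sqmodmx M.
  rewrite /sqmodmx adjmxZ -scalemxAl -scalemxAr scalerA sqr_normcE.
  by rewrite mulrC.
have nc : normc c = 2^-1 by rewrite normc_real ger0_norm.
have ni : normc ('i : C) = 1 by rewrite /= expr0n add0r expr1n sqrtr1.
set S := \sum_j (sqmodmx (y j) + sqmodmx ((y j) ^t*)).
have pSS : psdmx S by apply: psdmx_sum => j _; exact: psdmxD.
have abS : \sum_j sqmodmx (a j) + \sum_j sqmodmx (b j) = (2^-1%:C : C) *: S.
  rewrite -big_split /= /S scaler_sumr; apply: eq_bigr => j _.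
  rewrite /a /b !sqmodZ Normc.normcM nc ni mulr1 -scalerDr addrC [y j + _]addrC.
  rewrite [X in _ *: X]addrC sqmodmx_parallelogram scale_double scalerA.
  rewrite [X in _ = _ *: X]addrC; congr (_ *: _).
  by rewrite -rmorphM; congr (_%:C); field.
have subE := has_weights_subadditive rnE wE.
have hS : sqnorm nrm ((2^-1%:C : C) *: S) = 2^-1 * sqnorm nrm S.
  by rewrite (sqnormZ rnE _ pSS)// invr_ge0.
have pa : psdmx (\sum_j sqmodmx (a j)) by apply: psdmx_sum.
have pb : psdmx (\sum_j sqmodmx (b j)) by apply: psdmx_sum.
have la : sqnorm nrm (\sum_j sqmodmx (a j)) <= 2^-1 * sqnorm nrm S.
  by rewrite -hS -abS; exact: (sqnorm_le rnE).
have lb : sqnorm nrm (\sum_j sqmodmx (b j)) <= 2^-1 * sqnorm nrm S.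
  by rewrite -hS -abS addrC; exact: (sqnorm_le rnE).
have ka := khintchine_hermitian q2 wE fa ha.
have kb := khintchine_hermitian q2 wE fb hb.
have Xab : \sum_j y j = \sum_j a j + 'i *: \sum_j b j.
  by rewrite scaler_sumr -big_split; apply: eq_bigr.
have tri : schatten nrm (\sum_j y j) <=
    schatten nrm (\sum_j a j) + schatten nrm (\sum_j b j).
  rewrite Xab; apply: le_trans (schattenD rnE _ _) _.
  by rewrite (schattenZ rnE) ni mul1r.
exact: (sqr_le_of_halves q2 (schatten_ge0 rnE _) tri ka kb la lb).
Qed.

End SignFlips.

(** * Clifford systems *)

(** On the left, the constant of [khintchine] and the factor 2 lost when the conjugation by [Gam] is
    removed in [deriv_khintchine]; on the right, the square of the constant [4 * Num.sqrt q]. *)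
Lemma khintchine_constant (R : realFieldType) (q : R) : 2 <= q ->
  4 * (q - 1) * 2 <= 4 ^+ 2 * q.
Proof. by move=> q2; lra. Qed.

Section Words.
Variables (R : realType) (N : nat) (I : eqType).
Local Notation C := R[i].
Implicit Types (M V : 'M[C]_N) (b : I -> 'M[C]_N) (s : seq I).

Definition word s b : 'M[C]_N := \big[mulmx/1%:M]_(j <- s) b j.

Lemma word_nil b : word [::] b = 1%:M.
Proof. by rewrite /word big_nil. Qed.

Lemma word_cons k s b : word (k :: s) b = b k *m word s b.
Proof. by rewrite /word big_cons. Qed.

Lemma eq_word s b b' : (forall k, k \in s -> b k = b' k) -> word s b = word s b'.
Proof.
elim: s => [|k s IH] bb'; first by rewrite !word_nil.
rewrite !word_cons bb' ?mem_head// IH// => j js; apply: bb'.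
by rewrite inE js orbT.
Qed.

Lemma Ad_word V s b : unitary V -> Ad V (word s b) = word s (fun k => Ad V (b k)).
Proof.
move=> uV; elim: s => [|k s IH]; first by rewrite !word_nil (Ad1 uV).
by rewrite !word_cons (AdM _ _ uV) IH.
Qed.

Lemma word_scale s b (f : I -> C) :
  word s (fun k => f k *: b k) = (\prod_(k <- s) f k) *: word s b.
Proof.
elim: s => [|k s IH]; first by rewrite !word_nil big_nil scale1r.
by rewrite !word_cons big_cons IH -scalemxAl -scalemxAr scalerA.
Qed.

Lemma word_mull_comm M s j b b' : uniq s -> j \in s ->
  (forall k, k \in s -> k != j -> M *m b k = b k *m M) ->
  (forall k, k \in s -> b' k = if k == j then M *m b k else b k) ->
  M *m word s b = word s b'.
Proof.
elim: s => //= k s IH /andP[ks us]; rewrite inE => js Mb bb'.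
rewrite !word_cons mulmxA.
have [kj|kj] := eqVneq k j.
  rewrite (bb' k (mem_head _ _)) kj eqxx; congr (_ *m _); apply: eq_word => l ls.
  rewrite bb' ?inE ?ls ?orbT//; case: eqP => // lj.
  by move: ks; rewrite kj -lj ls.
rewrite (bb' k (mem_head _ _)) (negbTE kj) Mb ?mem_head// -mulmxA.
rewrite IH//.
- by move: js; rewrite eq_sym (negbTE kj).
- by move=> l ls; apply: Mb; rewrite inE ls orbT.
- by move=> l ls; apply: bb'; rewrite inE ls orbT.
Qed.

(** The sign counts the letters preceding [j]. Its existence is enough, since the lemma serves to
    show that words span a space stable under left multiplication. *)
Lemma word_mull_anticomm M s j b b' : uniq s -> j \in s ->
  (forall k, k \in s -> k != j -> M *m b k = - (b k *m M)) ->
  (forall k, k \in s -> b' k = if k == j then M *m b k else b k) ->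
  exists e : bool, M *m word s b = (-1) ^+ e *: word s b'.
Proof.
elim: s => //= k s IH /andP[ks us]; rewrite inE => js Mb bb'.
rewrite !word_cons mulmxA.
have [kj|kj] := eqVneq k j.
  exists false; rewrite expr0 scale1r (bb' k (mem_head _ _)) kj eqxx.
  congr (_ *m _); apply: eq_word => l ls.
  rewrite bb' ?inE ?ls ?orbT//; case: eqP => // lj.
  by move: ks; rewrite kj -lj ls.
have [|||e IHe] := IH us.
- by move: js; rewrite eq_sym (negbTE kj).
- by move=> l ls; apply: Mb; rewrite inE ls orbT.
- by move=> l ls; apply: bb'; rewrite inE ls orbT.
exists (~~ e); rewrite (bb' k (mem_head _ _)) (negbTE kj) Mb ?mem_head//.
rewrite mulNmx -mulmxA IHe -scalemxAr; case: (e); rewrite ?expr0 ?expr1.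
  by rewrite scaleN1r opprK scale1r.
by rewrite scaleN1r scale1r.
Qed.

Lemma word_linear s j b1 b2 b3 : uniq s ->
  (forall k, k != j -> b1 k = b3 k) -> (forall k, k != j -> b2 k = b3 k) ->
  b1 j + b2 j = b3 j *+ 2 ->
  word s b1 + word s b2 = word s b3 *+ 2.
Proof.
move=> + e1 e2 e3; elim: s => [|k s IH] /=.
  by move=> _; rewrite !word_nil mulr2n.
move=> /andP[ks us]; rewrite !word_cons.
have [kj|kj] := eqVneq k j; last by rewrite e1// e2// -mulmxDr IH// !mulr2n mulmxDr.
have w1 b : (forall k, k != j -> b k = b3 k) -> word s b = word s b3.
  move=> bb; apply: eq_word => l ls; apply: bb.
  by apply: contraNneq ks => lj; rewrite kj -lj.
rewrite (w1 b1 e1) (w1 b2 e2) kj -mulmxDl e3.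
by rewrite !mulr2n mulmxDl.
Qed.

Lemma word_rem s j b : uniq s ->
  word s (fun k => if k == j then 1%:M else b k) = word [seq k <- s | k != j] b.
Proof.
elim: s => [|k s IH] /=; first by rewrite !word_nil.
move=> /andP[ks us]; rewrite word_cons IH//.
by case: eqP => kj /=; rewrite ?mul1mx ?word_cons.
Qed.

End Words.

Section Clifford.
Variables (R : realType) (N n : nat).
Local Notation C := R[i].
Variables (Q P : 'I_n -> 'M[C]_N) (Gam : 'M[C]_N).
Implicit Types (A : {set 'I_n}) (S T V : 'M[C]_N).

(** [Gam] is the grading, which anticommutes with all 2n generators. Multiplied by one generator, it
    gives a unitary that changes the sign of that generator alone. *)
Definition clifford : Prop :=
  [/\ forall j, (Q j) ^t* = Q j /\ (P j) ^t* = P j,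
      forall j, Q j *m Q j = 1%:M /\ P j *m P j = 1%:M,
      forall j k, Q j *m P k = - (P k *m Q j),
      forall j k, j != k -> Q j *m Q k = - (Q k *m Q j) /\
                            P j *m P k = - (P k *m P j) &
      [/\ Gam ^t* = Gam, Gam *m Gam = 1%:M,
          forall j, Gam *m Q j = - (Q j *m Gam) &
          forall j, Gam *m P j = - (P j *m Gam)]].

Hypothesis cliff : clifford.

Let Qadj j : (Q j) ^t* = Q j. Proof. by case: cliff => + _ _ _ _ => /(_ j)[]. Qed.
Let Padj j : (P j) ^t* = P j. Proof. by case: cliff => + _ _ _ _ => /(_ j)[]. Qed.
Let QQ1 j : Q j *m Q j = 1%:M. Proof. by case: cliff => _ + _ _ _ => /(_ j)[]. Qed.
Let PP1 j : P j *m P j = 1%:M. Proof. by case: cliff => _ + _ _ _ => /(_ j)[]. Qed.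
Let QP j k : Q j *m P k = - (P k *m Q j). Proof. by case: cliff. Qed.
Let QQ j k : j != k -> Q j *m Q k = - (Q k *m Q j).
Proof. by case: cliff => _ _ _ + _ => /[apply] -[]. Qed.
Let PP j k : j != k -> P j *m P k = - (P k *m P j).
Proof. by case: cliff => _ _ _ + _ => /[apply] -[]. Qed.
Let Gadj : Gam ^t* = Gam. Proof. by case: cliff => _ _ _ _ []. Qed.
Let GG1 : Gam *m Gam = 1%:M. Proof. by case: cliff => _ _ _ _ []. Qed.
Let GQ j : Gam *m Q j = - (Q j *m Gam). Proof. by case: cliff => _ _ _ _ []. Qed.
Let GP j : Gam *m P j = - (P j *m Gam). Proof. by case: cliff => _ _ _ _ []. Qed.

Let unitary_P j : unitary (P j). Proof. by rewrite /unitary Padj PP1. Qed.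
Let unitary_Gam : unitary Gam. Proof. by rewrite /unitary Gadj GG1. Qed.

(* [flipper j] commutes with all generators except [P j], with which it
   anticommutes. *)
Definition flipper j := P j *m Gam.

Lemma unitary_flipper j : unitary (flipper j).
Proof. exact: unitaryM. Qed.

Lemma Ad_flipper_Q j k : Ad (flipper j) (Q k) = Q k.
Proof.
apply: Ad_comm; first exact: unitary_flipper.
by rewrite /flipper -mulmxA GQ mulmxN !mulmxA QP mulNmx.
Qed.

Lemma Ad_flipper_P j k : Ad (flipper j) (P k) = if j == k then - P k else P k.
Proof.
case: eqP => [<-|/eqP jk].
  apply: Ad_anticomm; first exact: unitary_flipper.
  by rewrite /flipper -!mulmxA GP mulmxN.
apply: Ad_comm; first exact: unitary_flipper.
by rewrite /flipper -mulmxA GP mulmxN !mulmxA (PP jk) mulNmx opprK.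
Qed.

Definition gen (c s : 'I_n -> R) k : 'M[C]_N := (c k)%:C *: Q k + (s k)%:C *: P k.

Definition ordered A : seq 'I_n := [seq j <- index_enum 'I_n | j \in A].

Lemma ordered_uniq A : uniq (ordered A).
Proof. by rewrite filter_uniq// index_enum_uniq. Qed.

Lemma mem_ordered A j : (j \in ordered A) = (j \in A).
Proof. by rewrite mem_filter mem_index_enum andbT. Qed.

(** A family of words closed under all the operations used: a rotation acts linearly on the pairs
    [(c k, s k)], and [cexp] sets [s] to 0. It contains [Qword], [dword] and all their rotations. *)
Definition gword A c s := word (ordered A) (gen c s).
Definition Qword A := word (ordered A) Q.

Lemma Qword_gword A : Qword A = gword A (fun=> 1) (fun=> 0).
Proof. by apply: eq_word => k _; rewrite /gen scale1r scale0r addr0. Qed.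

Lemma Ad_flipper_Qword j A : Ad (flipper j) (Qword A) = Qword A.
Proof.
rewrite /Qword (Ad_word _ _ (unitary_flipper j)); apply: eq_word => k _.
exact: Ad_flipper_Q.
Qed.

(* Averaging over the [flipper j] kills the words that contain some [P j]. *)
Definition cexp1 j S : 'M[C]_N := (2^-1%:C : C) *: (S + Ad (flipper j) S).
Definition cexp S : 'M[C]_N := foldr cexp1 S (index_enum 'I_n).

Lemma cexp1D j S T : cexp1 j (S + T) = cexp1 j S + cexp1 j T.
Proof. by rewrite /cexp1 AdD addrACA scalerDr. Qed.

Lemma cexp1Z j (c : C) S : cexp1 j (c *: S) = c *: cexp1 j S.
Proof. by rewrite /cexp1 AdZ -scalerDr !scalerA mulrC. Qed.

Lemma cexpD S T : cexp (S + T) = cexp S + cexp T.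
Proof. by rewrite /cexp; elim: index_enum => //= j l ->; rewrite cexp1D. Qed.

Lemma cexpZ (c : C) S : cexp (c *: S) = c *: cexp S.
Proof. by rewrite /cexp; elim: index_enum => //= j l ->; rewrite cexp1Z. Qed.

Lemma cexp_sum J (r : seq J) (p : pred J) (F : J -> 'M[C]_N) :
  cexp (\sum_(i <- r | p i) F i) = \sum_(i <- r | p i) cexp (F i).
Proof.
elim/big_rec2: _ => [|i S T _ <-]; last exact: cexpD.
by rewrite -[X in cexp X](scale0r 0) cexpZ scale0r.
Qed.

Lemma cexp1_gword j A c s :
  cexp1 j (gword A c s) = gword A c (fun k => if k == j then 0 else s k).
Proof.
rewrite /cexp1 /gword (Ad_word _ _ (unitary_flipper j)).
rewrite (word_linear (j := j) (b3 := gen c (fun k => if k == j then 0 else s k))).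
- rewrite scale_double scalerA -rmorphM mulVf ?pnatr_eq0// scale1r//.
- exact: ordered_uniq.
- by move=> k /negbTE kj; rewrite /gen kj.
- move=> k /negbTE kj; rewrite /gen kj AdD !AdZ Ad_flipper_Q Ad_flipper_P.
  by rewrite eq_sym kj.
- rewrite /gen eqxx AdD !AdZ Ad_flipper_Q Ad_flipper_P eqxx scalerN scale0r.
  by rewrite addr0 addrACA subrr addr0 mulr2n.
Qed.

Lemma cexp_gword A c s : cexp (gword A c s) = gword A c (fun=> 0).
Proof.
rewrite /cexp; have : forall k, k \in index_enum 'I_n by move=> k; exact: mem_index_enum.
move: (index_enum 'I_n) => l lP.
transitivity (gword A c (fun k => if k \in l then 0 else s k)); last first.
  by congr gword; apply: funext => k; rewrite lP.
elim: l {lP} => [//|j l /= ->]; rewrite cexp1_gword; congr gword.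
by apply: funext => k; rewrite inE; case: eqP.
Qed.

(** The exponential of [(t / 2) *: (P j *m Q j)], since [P j *m Q j] squares to -1. The angle is
    halved because conjugation doubles it. *)
Definition rot1 (t : R) j : 'M[C]_N :=
  ((cos (t / 2))%:C : C)%:M + ((sin (t / 2))%:C : C) *: (P j *m Q j).
Definition rot (t : R) := word (index_enum 'I_n) (rot1 t).

Let B j := P j *m Q j.
Let Badj j : (B j) ^t* = - B j.
Proof. by rewrite /B adjmxM Padj Qadj QP. Qed.
Let BQ j : B j *m Q j = P j. Proof. by rewrite /B -mulmxA QQ1 mulmx1. Qed.
Let QB j : Q j *m B j = - P j.
Proof. by rewrite /B mulmxA QP mulNmx -mulmxA QQ1 mulmx1. Qed.
Let BP j : B j *m P j = - Q j.
Proof. by rewrite /B -mulmxA QP mulmxN mulmxA PP1 mul1mx. Qed.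
Let PB j : P j *m B j = Q j. Proof. by rewrite /B mulmxA PP1 mul1mx. Qed.
Let BB j : B j *m B j = - 1%:M.
Proof. by rewrite {2}/B mulmxA BP mulNmx QQ1. Qed.

Let rot1_adj t j : (rot1 t j) ^t* =
  ((cos (t / 2))%:C : C)%:M - ((sin (t / 2))%:C : C) *: B j.
Proof.
rewrite adjmxD adjmxZ conjC_real Badj scalerN.
by rewrite tr_scalar_mx map_scalar_mx; congr (_%:M + _); exact: conjC_real.
Qed.

Let Ad_rot1 t j S : Ad (rot1 t j) S =
  ((cos (t / 2) ^+ 2)%:C : C) *: S
  + ((cos (t / 2) * sin (t / 2))%:C : C) *: (B j *m S - S *m B j)
  - ((sin (t / 2) ^+ 2)%:C : C) *: (B j *m S *m B j).
Proof.
rewrite /Ad rot1_adj /rot1 -/(B j).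
move: (cos _) (sin _) => c s.
rewrite mulmxDl !mulmxBr !mulmxDl !mul_scalar_mx !mul_mx_scalar.
rewrite -?scalemxAl -?scalemxAr -?scalemxAl -?scalemxAr !scalerDr !scalerA.
by rewrite -!rmorphM -!expr2 scalerN opprD !addrA.
Qed.

Lemma unitary_rot1 t j : unitary (rot1 t j).
Proof.
have := Ad_rot1 t j 1%:M; rewrite /unitary /Ad mulmx1 => ->.
rewrite mul1mx mulmx1 subrr scaler0 addr0 BB scalerN opprK -scalerDl -rmorphD.
by rewrite cos2Dsin2 scale1r.
Qed.

Lemma unitary_word (J : eqType) (s : seq J) (b : J -> 'M[C]_N) :
  (forall k, unitary (b k)) -> unitary (word s b).
Proof.
move=> ub; elim: s => [|k s IH]; first by rewrite word_nil; exact: unitary1.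
by rewrite word_cons; exact: unitaryM.
Qed.

Lemma unitary_rot t : unitary (rot t).
Proof. by apply: unitary_word => k; exact: unitary_rot1. Qed.

Let cos_half (t : R) : cos t = cos (t / 2) ^+ 2 - sin (t / 2) ^+ 2.
Proof. by rewrite {1}(splitr t) cosD -!expr2. Qed.
Let sin_half (t : R) : sin t = cos (t / 2) * sin (t / 2) *+ 2.
Proof. by rewrite {1}(splitr t) sinD mulrC mulr2n. Qed.

Let dbl t (M : 'M[C]_N) : ((cos (t / 2) * sin (t / 2))%:C : C) *: (M + M) =
  ((sin t)%:C : C) *: M.
Proof. by rewrite [in RHS]sin_half mulr2n rmorphD scalerDl scalerDr. Qed.

Let Ad_rot1_Q t j k : Ad (rot1 t j) (Q k) =
  if j == k then ((cos t)%:C : C) *: Q k + ((sin t)%:C : C) *: P k else Q k.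
Proof.
case: eqP => [<-|/eqP jk]; last first.
  have com : B j *m Q k = Q k *m B j.
    by rewrite /B -mulmxA (QQ jk) mulmxN !mulmxA QP mulNmx.
  rewrite Ad_rot1 com subrr scaler0 addr0 -mulmxA BB mulmxN mulmx1 scalerN opprK.
  by rewrite -scalerDl -rmorphD cos2Dsin2 scale1r.
rewrite Ad_rot1 BQ QB PB opprK dbl addrAC -scalerBl.
by rewrite -rmorphB -cos_half.
Qed.

Let Ad_rot1_P t j k : Ad (rot1 t j) (P k) =
  if j == k then - ((sin t)%:C : C) *: Q k + ((cos t)%:C : C) *: P k else P k.
Proof.
case: eqP => [<-|/eqP jk]; last first.
  have com : B j *m P k = P k *m B j.
    by rewrite /B -mulmxA QP mulmxN !mulmxA (PP jk) mulNmx opprK.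
  rewrite Ad_rot1 com subrr scaler0 addr0 -mulmxA BB mulmxN mulmx1 scalerN opprK.
  by rewrite -scalerDl -rmorphD cos2Dsin2 scale1r.
rewrite Ad_rot1 BP PB mulNmx QB opprK -opprD scalerN dbl addrAC -scalerBl.
by rewrite -rmorphB -cos_half addrC scaleNr.
Qed.

Lemma Ad_rot_Q t k : Ad (rot t) (Q k) = ((cos t)%:C : C) *: Q k + ((sin t)%:C : C) *: P k.
Proof.
rewrite /rot; have kin := mem_index_enum k; have := index_enum_uniq 'I_n.
have fix_ s S : (forall j, j \in s -> Ad (rot1 t j) S = S) -> 
    Ad (word s (rot1 t)) S = S.
  elim: s => [|j s IH] jS; first by rewrite word_nil /Ad mul1mx adjmx1 mulmx1.
  rewrite word_cons Ad_comp IH; first by rewrite jS ?mem_head.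
  by move=> l ls; apply: jS; rewrite inE ls orbT.
elim: (index_enum 'I_n) kin => //= j s IH; rewrite inE word_cons Ad_comp.
have [jk _ /andP[js _]|jk /= ks /andP[_ us]] := eqVneq k j.
  rewrite jk fix_ ?Ad_rot1_Q ?eqxx// => l ls; rewrite Ad_rot1_Q.
  by case: eqP => // lj; move: js; rewrite -lj ls.
by rewrite IH// AdD !AdZ Ad_rot1_Q Ad_rot1_P eq_sym (negbTE jk).
Qed.

Lemma Ad_rot_P t k : Ad (rot t) (P k) = - ((sin t)%:C : C) *: Q k + ((cos t)%:C : C) *: P k.
Proof.
rewrite /rot; have kin := mem_index_enum k; have := index_enum_uniq 'I_n.
have fix_ s S : (forall j, j \in s -> Ad (rot1 t j) S = S) -> 
    Ad (word s (rot1 t)) S = S.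
  elim: s => [|j s IH] jS; first by rewrite word_nil /Ad mul1mx adjmx1 mulmx1.
  rewrite word_cons Ad_comp IH; first by rewrite jS ?mem_head.
  by move=> l ls; apply: jS; rewrite inE ls orbT.
elim: (index_enum 'I_n) kin => //= j s IH; rewrite inE word_cons Ad_comp.
have [jk _ /andP[js _]|jk /= ks /andP[_ us]] := eqVneq k j.
  rewrite jk fix_ ?Ad_rot1_P ?eqxx// => l ls; rewrite Ad_rot1_P.
  by case: eqP => // lj; move: js; rewrite -lj ls.
by rewrite IH// AdD !AdZ Ad_rot1_Q Ad_rot1_P eq_sym (negbTE jk).
Qed.

Lemma Ad_rot_gword t A c s : Ad (rot t) (gword A c s) =
  gword A (fun k => c k * cos t - s k * sin t) (fun k => c k * sin t + s k * cos t).
Proof.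
rewrite /gword (Ad_word _ _ (unitary_rot t)); apply: eq_word => k _.
rewrite /gen AdD !AdZ Ad_rot_Q Ad_rot_P !scalerDr !scalerA addrACA -!scalerDl.
by rewrite mulrN -!rmorphM -!rmorphN -!rmorphD.
Qed.

(* The word [Q_A] with the letter [Q_j] replaced by [P_j]. *)
Definition dword A j := gword A (fun k => (k != j)%:R) (fun k => (k == j)%:R).

(** [P j *m Q j] commutes with every letter other than [Q j], so it travels to that letter and turns
    it into [P j] without producing a sign. *)
Lemma PQ_Qword A j : j \in A -> P j *m (Q j *m Qword A) = dword A j.
Proof.
move=> jA; rewrite mulmxA -/(B j) /Qword /dword /gword.
apply: (word_mull_comm (j := j)) => [|||k _].
- exact: ordered_uniq.
- by rewrite mem_ordered.
- move=> k _ kj; rewrite /B -mulmxA QQ ?mulmxN ?mulmxA 1?eq_sym//.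
  by rewrite QP mulNmx.
- rewrite /gen; case: eqP => [->|_] /=.
    by rewrite scale0r add0r scale1r BQ.
  by rewrite scale0r addr0 scale1r.
Qed.

(** After the rotation, the [Q] component of the letter [P j] is [- sin t] and that of each of the
    other [#|A| - 1] letters is [cos t]; [cexp] keeps exactly these components. *)
Lemma cexp_rot_dword A j t : j \in A ->
  cexp (Ad (rot t) (dword A j)) = ((- (sin t * cos t ^+ #|A|.-1))%:C : C) *: Qword A.
Proof.
move=> jA; rewrite /dword Ad_rot_gword cexp_gword Qword_gword.
rewrite /gword.
have e k : k \in ordered A -> gen (fun k => (k != j)%:R * cos t - (k == j)%:R * sin t) (fun=> 0) k =
    ((if k == j then - sin t else cos t)%:C : C) *: gen (fun=> 1) (fun=> 0) k.
  move=> _; rewrite /gen !scale0r !addr0 scale1r; congr (_%:C *: _).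
  by case: eqP => _ /=; rewrite ?mul1r ?mul0r ?sub0r ?subr0.
rewrite (eq_word e) word_scale; congr (_ *: _).
rewrite -rmorph_prod; congr (_%:C).
rewrite big_filter (bigD1 j)//= eqxx mulNr; congr (- (_ * _)).
rewrite (eq_bigr (fun=> cos t)) => [|k /andP[_ /negbTE->]//].
rewrite (eq_bigl (mem (A :\ j))) => [|k]; last by rewrite !inE andbC.
by rewrite prodr_const; congr (_ ^+ _); rewrite [in RHS](cardsD1 j) jA.
Qed.

Lemma Ad_rotD a b A c s :
  Ad (rot a) (Ad (rot b) (gword A c s)) = Ad (rot (a + b)) (gword A c s).
Proof.
rewrite !Ad_rot_gword cosD sinD; congr gword; apply: funext => k; ring.
Qed.

Lemma Ad_rot_2pi t A c s :
  Ad (rot (t + 2 * pi)) (gword A c s) = Ad (rot t) (gword A c s).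
Proof. by rewrite !Ad_rot_gword mulr_natl cosD2pi sinD2pi. Qed.

Lemma Q_Qword A j : j \in A ->
  exists e : bool, Q j *m Qword A = (-1) ^+ e *: Qword (A :\ j).
Proof.
move=> jA; pose b k := if k == j then 1%:M else Q k.
have [|||k kA|e ->] := @word_mull_anticomm R N _ (Q j) (ordered A) j Q b.
- exact: ordered_uniq.
- by rewrite mem_ordered.
- by move=> k _ kj; rewrite QQ// eq_sym.
- by rewrite /b; case: eqP => // ->; rewrite QQ1.
exists e; congr (_ *: _); rewrite /b word_rem ?ordered_uniq// /Qword /ordered.
rewrite -filter_predI; congr word; apply: eq_filter => k /=.
by rewrite !inE.
Qed.

Lemma Q_Qword_span A j : exists (c : C) A', Q j *m Qword A = c *: Qword A'.
Proof.
have [jA|jA] := boolP (j \in A).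
  by have [e ->] := Q_Qword jA; exists ((-1) ^+ e), (A :\ j).
have jA' : j \in j |: A by rewrite setU11.
have [e] := Q_Qword jA'; rewrite setU1K// => h.
exists ((-1) ^+ e), (j |: A).
have -> : Qword A = (-1) ^+ e *: (Q j *m Qword (j |: A)).
  by rewrite h scalerA -expr2 sqrr_sign scale1r.
by rewrite -scalemxAr mulmxA QQ1 mul1mx.
Qed.

Lemma unitary_Qword A : unitary (Qword A).
Proof. by apply: unitary_word => j; rewrite /unitary Qadj QQ1. Qed.

(** If [j] lies in exactly one of the two sets, conjugation by [Q j *m Gam], which changes the sign
    of [Q j] only, reverses the product while preserving its trace. *)
Lemma tr_Qword_mul A A' : A != A' -> \tr ((Qword A') ^t* *m Qword A) = 0.
Proof.
move=> AA'.
have /existsP[j jAA'] : [exists j, (j \in A) != (j \in A')].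
  apply: contraNT AA' => /existsPn h; apply/eqP/setP => j.
  by apply/eqP; have := h j; rewrite negbK.
have uQG : unitary (Q j *m Gam).
  by apply: unitaryM; rewrite /unitary ?Qadj ?QQ1 ?Gadj ?GG1.
have AdQ k : Ad (Q j *m Gam) (Q k) = ((-1) ^+ (k == j) : C) *: Q k.
  case: eqP => [->|/eqP kj].
    rewrite expr1 scaleN1r; apply: Ad_anticomm => //.
    by rewrite -mulmxA GQ mulmxN mulmxA.
  rewrite expr0 scale1r; apply: Ad_comm => //; rewrite -mulmxA GQ mulmxN !mulmxA.
  by rewrite (QQ kj) mulNmx.
have AdW D : Ad (Q j *m Gam) (Qword D) = ((-1) ^+ (j \in D) : C) *: Qword D.
  rewrite /Qword (Ad_word _ _ uQG).
  rewrite (eq_word (b' := fun k => ((-1) ^+ (k == j) : C) *: Q k)) => [|k _]; last exact: AdQ.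
  rewrite word_scale; congr (_ *: _); rewrite big_filter.
  have [jD|jD] := boolP (j \in D).
    by rewrite (bigD1 j)//= eqxx big1 ?mulr1// => k /andP[_ /negbTE->].
  by rewrite big1// => k kD; case: eqP => // kj; move: jD; rewrite -kj kD.
have e : \tr (Ad (Q j *m Gam) ((Qword A') ^t* *m Qword A)) =
    - \tr ((Qword A') ^t* *m Qword A).
  rewrite (AdM _ _ uQG) -Ad_adj !AdW adjmxZ -scalemxAl -scalemxAr scalerA.
  rewrite rmorphXn rmorphN1 -signr_addb mxtraceZ.
  by case: (j \in A) (j \in A') jAA' => -[] //= _; rewrite expr1 mulN1r.
have : \tr ((Qword A') ^t* *m Qword A) = - \tr ((Qword A') ^t* *m Qword A).
  by rewrite -e /Ad [in RHS]mxtrace_mulC mulmxA (unitary_adjmul uQG) mul1mx.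
by move/eqP; rewrite -addr_eq0 -mulr2n mulrn_eq0 /= => /eqP.
Qed.

Lemma tr_Qword_sqr A : \tr ((Qword A) ^t* *m Qword A) = N%:R.
Proof. by rewrite (unitary_adjmul (unitary_Qword A)) mxtrace1. Qed.

(** * The derivation sum_j P_j D_j and the symmetric gradient *)

Section Gradient.
Variables (nrm : ('I_N -> R) -> R) (rnE : symmetric_norm nrm).
Variable t : {set 'I_n} -> C.

Let sqnormE S : schatten nrm (sqrtmx S) ^+ 2 = sqnorm nrm S.
Proof. by []. Qed.

Lemma schatten_Ad V S : unitary V -> schatten nrm (Ad V S) = schatten nrm S.
Proof.
move=> uV; rewrite /Ad (schatten_unitaryr rnE _ (unitary_adj uV)).
exact: (schatten_unitaryl rnE).
Qed.

Local Opaque schatten sqnorm sqrtmx.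

Let le_sqr_le (x y : R) : 0 <= y -> x ^+ 2 <= y ^+ 2 -> x <= y.
Proof.
move=> y0 xy; rewrite leNgt; apply/negP => yx.
by move: xy; rewrite leNgt ltr_sqr ?nnegrE ?yx// (ltW (le_lt_trans y0 yx)).
Qed.

Definition partial j : 'M[C]_N :=
  \sum_A t A *: (if j \in A then Q j *m Qword A else 0).
Definition grad2 : 'M[C]_N :=
  \sum_j (sqmodmx ((partial j) ^t*) + sqmodmx (partial j)).
(* [\sum_j P_j D_j(T)]. *)
Definition deriv : 'M[C]_N := \sum_A t A *: \sum_(j in A) dword A j.

Lemma sum_P_partial : \sum_j P j *m partial j = deriv.
Proof.
rewrite /deriv /partial; under eq_bigr do rewrite mulmx_sumr.
rewrite exchange_big /=; apply: eq_bigr => A _.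
rewrite scaler_sumr [RHS]big_mkcond /=; apply: eq_bigr => j _.
by case: ifP => jA; [rewrite -scalemxAr PQ_Qword|rewrite scaler0 mulmx0].
Qed.

Lemma Ad_flipper_partial j k : Ad (flipper j) (partial k) = partial k.
Proof.
rewrite /partial Ad_sum; apply: eq_bigr => A _; rewrite AdZ; congr (_ *: _).
case: ifP => _; last exact: Ad0.
by rewrite (AdM _ _ (unitary_flipper j)) Ad_flipper_Q Ad_flipper_Qword.
Qed.

Lemma sign_flips_partial : sign_flips flipper (fun j => P j *m partial j).
Proof.
split=> [j|j k]; first exact: unitary_flipper.
rewrite (AdM _ _ (unitary_flipper j)) Ad_flipper_partial Ad_flipper_P.
by case: eqP => _; rewrite ?mulNmx.
Qed.

Lemma sqmodmx_P_partial j : sqmodmx (P j *m partial j) = sqmodmx (partial j).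
Proof. by rewrite /sqmodmx adjmxM Padj !mulmxA -(mulmxA _ (P j) (P j)) PP1 mulmx1. Qed.

(** The square of the adjoint is [Z] conjugated by [P j]. As [Z] is fixed by [flipper j], this
    equals conjugation by [Gam], which no longer depends on [j] and can be pulled out of the sum. *)
Lemma sqmodmx_P_partial_adj j :
  sqmodmx ((P j *m partial j) ^t*) = Ad Gam (sqmodmx ((partial j) ^t*)).
Proof.
set Z := sqmodmx ((partial j) ^t*).
have -> : sqmodmx ((P j *m partial j) ^t*) = Ad (P j) Z.
  by rewrite /Z /sqmodmx adjmxK adjmxM Padj adjmxK /Ad Padj !mulmxA.
have ZE : Ad (flipper j) Z = Z.
  by rewrite /Z -(sqmodmx_Ad _ (unitary_flipper j)) -Ad_adj Ad_flipper_partial.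
by rewrite -[in LHS]ZE -Ad_comp /flipper mulmxA PP1 mul1mx.
Qed.

Let S1 := \sum_j sqmodmx (partial j).
Let S2 := \sum_j sqmodmx ((partial j) ^t*).

Let grad2E : grad2 = S1 + S2.
Proof. by rewrite /grad2 big_split addrC. Qed.

Let psd1 : psdmx S1.
Proof. by apply: psdmx_sum => j _; exact: psdmx_sqmod. Qed.

Let psd2 : psdmx S2.
Proof. by apply: psdmx_sum => j _; exact: psdmx_sqmod. Qed.

Let sum_sqmodmx : \sum_j sqmodmx (P j *m partial j) = S1.
Proof. by apply: eq_bigr => j _; exact: sqmodmx_P_partial. Qed.

Let sum_sqmodmx2 : \sum_j (sqmodmx (P j *m partial j) +
    sqmodmx ((P j *m partial j) ^t*)) = S1 + Ad Gam S2.
Proof.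
rewrite big_split sum_sqmodmx Ad_sum; congr (_ + _).
by apply: eq_bigr => j _; exact: sqmodmx_P_partial_adj.
Qed.

(** [P j] is unitary and disappears from the squares, leaving [S1]; superadditivity allows the
    nonnegative contribution of [S2] to be added. *)
Lemma deriv_concave : rpow_superadditive nrm 2 ->
  schatten nrm deriv <= schatten nrm (sqrtmx grad2).
Proof.
move=> cE; apply: le_sqr_le; first exact: (schatten_ge0 rnE).
have := schatten_flips_concave rnE cE sign_flips_partial.
rewrite sum_P_partial sum_sqmodmx => h; apply: le_trans h _.
have e := sqnormE grad2; rewrite [leRHS]e grad2E.
apply: le_trans (sqnorm_superadditive rnE cE psd1 psd2).
by rewrite lerDl; exact: sqnorm_ge0.
Qed.

(** Khintchine bounds the derivation by [S1 + Ad Gam S2], not by [S1 + S2]. Subadditivity separates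
    the two terms, the conjugation drops out of each norm, and monotonicity bounds both by the
    whole. *)
Lemma deriv_khintchine q : 2 <= q -> has_weights nrm q ->
  schatten nrm deriv <= 4 * Num.sqrt q * schatten nrm (sqrtmx grad2).
Proof.
move=> q2 wE.
have q0 : 0 <= q by apply: le_trans q2.
have g0 : 0 <= 4 * Num.sqrt q * schatten nrm (sqrtmx grad2).
  by apply: mulr_ge0; [rewrite mulr_ge0 ?sqrtr_ge0|exact: (schatten_ge0 rnE)].
apply: (le_sqr_le g0).
have := khintchine rnE q2 wE sign_flips_partial.
rewrite sum_P_partial sum_sqmodmx2 => h; apply: le_trans h _.
have e := sqnormE grad2.
rewrite [leRHS]exprMn [X in _ <= _ * X]e exprMn (sqr_sqrtr q0) grad2E.
have subE := has_weights_subadditive rnE wE.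
have h1 := sqnorm_subadditive rnE subE psd1 (psdmx_conj Gam psd2).
rewrite (sqnorm_conj rnE psd2 unitary_Gam) in h1.
have h2 := sqnorm_le rnE subE psd1 psd2.
have h3 := sqnorm_le rnE subE psd2 psd1.
rewrite [S2 + S1]addrC in h3.
have h4 : sqnorm nrm (S1 + Ad Gam S2) <= 2 * sqnorm nrm (S1 + S2).
  by rewrite mulr_natl mulr2n; exact: le_trans h1 (lerD h2 h3).
have h5 := sqnorm_ge0 nrm (S1 + S2).
have q1 : 0 <= 4 * (q - 1) by rewrite mulr_ge0// subr_ge0 (le_trans _ q2)// ler1n.
apply: le_trans (ler_wpM2l q1 h4) _.
by rewrite mulrA; apply: ler_wpM2r => //; exact: khintchine_constant.
Qed.

Lemma schatten_cexp1 j S : schatten nrm (cexp1 j S) <= schatten nrm S.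
Proof.
rewrite /cexp1 (schattenZ rnE) normc_real ger0_norm ?invr_ge0//.
have := schattenD rnE S (Ad (flipper j) S).
have -> : schatten nrm (Ad (flipper j) S) = schatten nrm S.
  exact: schatten_Ad (unitary_flipper j).
by move=> h; rewrite ler_pdivrMl// mulr_natl mulr2n; exact: h.
Qed.

Lemma schatten_cexp S : schatten nrm (cexp S) <= schatten nrm S.
Proof.
rewrite /cexp; elim: (index_enum _) => [|j l IH]; first exact: lexx.
exact: le_trans (schatten_cexp1 j _) IH.
Qed.

Lemma cexp_rot_deriv (a : R) : cexp (Ad (rot a) deriv) =
  \sum_(A : {set 'I_n}) ((- (#|A|%:R * (sin a * cos a ^+ #|A|.-1)))%:C : C) *: (t A *: Qword A).
Proof.
rewrite /deriv Ad_sum cexp_sum; apply: eq_bigr => A _.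
rewrite AdZ cexpZ Ad_sum cexp_sum.
rewrite (eq_bigr (fun=> ((- (sin a * cos a ^+ #|A|.-1))%:C : C) *: Qword A)); last first.
  by move=> j jA; exact: cexp_rot_dword.
rewrite sumr_const -scaler_nat !scalerA; congr (_ *: _).
rewrite [RHS]mulrC -?mulrA; congr (t A * _).
by rewrite mulr_natl -rmorphMn mulNrn mulr_natl.
Qed.

Lemma schatten_cexp_rot_deriv (a : R) :
  schatten nrm (\sum_(A : {set 'I_n})
    ((#|A|%:R * (sin a * cos a ^+ #|A|.-1))%:C : C) *: (t A *: Qword A))
  <= schatten nrm deriv.
Proof.
have -> : \sum_(A : {set 'I_n})
    ((#|A|%:R * (sin a * cos a ^+ #|A|.-1))%:C : C) *: (t A *: Qword A) =
    (-1 : C) *: cexp (Ad (rot a) deriv).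
  rewrite cexp_rot_deriv scaler_sumr; apply: eq_bigr => A _.
  by rewrite scaleN1r -scaleNr -rmorphN opprK.
rewrite (schattenZ rnE) normcN Normc.normc1 mul1r.
apply: le_trans (schatten_cexp _) _.
by rewrite (schatten_Ad _ (unitary_rot a)).
Qed.

End Gradient.

End Clifford.

Section QwordSpan.
Variables (R : realType) (N n : nat).
Local Notation C := R[i].
Variables (Q P : 'I_n -> 'M[C]_N) (Gam : 'M[C]_N).
Hypothesis cliff : clifford Q P Gam.
Implicit Types (A : {set 'I_n}) (S T : 'M[C]_N) (t : {set 'I_n} -> C).

Definition Qspan T : Prop := exists t, T = \sum_(A : {set 'I_n}) t A *: Qword Q A.

Lemma Qword0 : Qword Q finset.set0 = 1%:M.
Proof.
rewrite /Qword /ordered (eq_filter (a2 := pred0)) ?filter_pred0 ?word_nil//.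
by move=> j; rewrite /= inE.
Qed.

Lemma Qspan_Qword A : Qspan (Qword Q A).
Proof.
exists (fun B => (B == A)%:R); rewrite (bigD1 A)//= eqxx scale1r big1 ?addr0//.
by move=> B /negbTE->; rewrite scale0r.
Qed.

Lemma QspanD S T : Qspan S -> Qspan T -> Qspan (S + T).
Proof.
move=> [s ->] [t ->]; exists (fun A => s A + t A).
by rewrite -big_split; apply: eq_bigr => A _; rewrite scalerDl.
Qed.

Lemma QspanZ (c : C) T : Qspan T -> Qspan (c *: T).
Proof.
move=> [t ->]; exists (fun A => c * t A).
by rewrite scaler_sumr; apply: eq_bigr => A _; rewrite scalerA.
Qed.

Lemma Qspan0 : Qspan 0.
Proof. by rewrite -(scale0r (Qword Q finset.set0)); apply/QspanZ/Qspan_Qword. Qed.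

Lemma Qspan_mul j T : Qspan T -> Qspan (Q j *m T).
Proof.
move=> [t ->]; rewrite mulmx_sumr.
elim/big_ind: _ => [||A _]; [exact: Qspan0|exact: QspanD|].
rewrite -scalemxAr; apply: QspanZ.
have [c [A' ->]] := Q_Qword_span cliff A j.
exact/QspanZ/Qspan_Qword.
Qed.

Lemma tr_Qword_sum A t :
  \tr ((Qword Q A) ^t* *m \sum_(B : {set 'I_n}) t B *: Qword Q B) = t A * N%:R.
Proof.
rewrite mulmx_sumr raddf_sum /= (bigD1 A)//= big1 ?addr0.
  by rewrite -scalemxAr mxtraceZ (tr_Qword_sqr cliff).
move=> B BA; rewrite -scalemxAr mxtraceZ (tr_Qword_mul cliff BA).
exact: mulr0.
Qed.

End QwordSpan.

(** * Jordan-Wigner realization of the Clifford system *)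

Section Tensors.
Variables (R : realType) (n : nat).
Local Notation C := R[i].
Implicit Types F G : 'I_n -> 'M[C]_2.

Lemma tensmxsM F G : tensmxs F *m tensmxs G = tensmxs (fun k => F k *m G k).
Proof.
apply/matrixP => a b; rewrite !mxE.
rewrite (reindex (@enum_rank (Omega n))) /=; last first.
  by apply: onW_bij; exact: enum_rank_bij.
under eq_bigr => w _ do rewrite !mxE enum_rankK -big_split /=.
under [RHS]eq_bigr => k _ do rewrite mxE.
by rewrite bigA_distr_bigA.
Qed.

Lemma eq_tensmxs F G : F =1 G -> tensmxs F = tensmxs G.
Proof.
by move=> FG; apply/matrixP => a b; rewrite !mxE; apply: eq_bigr => k _; rewrite FG.
Qed.

Lemma tensmxs_adj F : (tensmxs F) ^t* = tensmxs (fun k => (F k) ^t*).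
Proof.
apply/matrixP => a b; rewrite !mxE rmorph_prod /=.
by apply: eq_bigr => k _; rewrite !mxE.
Qed.

Lemma tensmxs1 : tensmxs (fun=> 1%:M : 'M[C]_2) = 1%:M :> cubemx R n.
Proof.
apply/matrixP => a b; rewrite !mxE; under eq_bigr do rewrite mxE.
have [->|ab] := eqVneq a b; first by rewrite big1// => k _; rewrite eqxx.
have [k kab] : exists k, (enum_val a : Omega n) k != (enum_val b : Omega n) k.
  apply/existsP; apply: contraNT ab => /existsPn h.
  by apply/eqP/enum_val_inj/ffunP => k; apply/eqP; rewrite -[_ == _]negbK h.
by rewrite (bigD1 k)//= (negbTE kab) mul0r.
Qed.

Lemma tensmxsN F G m : G m = - F m -> (forall k, k != m -> G k = F k) ->
  tensmxs G = - tensmxs F.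
Proof.
move=> Gm GF; apply/matrixP => a b; rewrite !mxE (bigD1 m)//= [in RHS](bigD1 m)//=.
rewrite Gm mxE mulNr; congr (- (_ * _)).
by apply: eq_bigr => k km; rewrite GF.
Qed.

Lemma tensmxs_anticomm F G m : F m *m G m = - (G m *m F m) ->
  (forall k, k != m -> F k *m G k = G k *m F k) ->
  tensmxs F *m tensmxs G = - (tensmxs G *m tensmxs F).
Proof. by move=> Fm FG; rewrite !tensmxsM; exact: tensmxsN Fm FG. Qed.

Lemma tensmxs_involution F : (forall k, F k *m F k = 1%:M) ->
  tensmxs F *m tensmxs F = 1%:M.
Proof. by move=> FF; rewrite tensmxsM -tensmxs1; exact: eq_tensmxs. Qed.

End Tensors.

Section Pauli.
Variable R : realType.
Local Notation C := R[i].

(** Up to sign, the remaining Pauli matrix: a hermitian unitary anticommuting with both [U2] and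
    [Q2]. *)
Definition V2 : 'M[C]_2 := 'i%C *: (U2 R *m Q2 R).

Let ord2P (i : 'I_2) : i = 0 \/ i = 1.
Proof. by case: i => [[|[|//]] h]; [left|right]; exact: val_inj. Qed.

Local Ltac pauli :=
  let i := fresh "i" in let j := fresh "j" in
  apply/matrixP => i j; rewrite !mxE ?big_ord_recl ?big_ord0 ?mxE;
  case: (ord2P i) => ->; case: (ord2P j) => -> /=;
  rewrite ?(rmorph0, rmorph1, rmorphN1, mulr0, mul0r, mul1r, mulr1, mulN1r, opprK,
    addr0, add0r, oppr0).

Lemma U2_sqr : U2 R *m U2 R = 1%:M.
Proof. by pauli. Qed.

Lemma Q2_sqr : Q2 R *m Q2 R = 1%:M.
Proof. by pauli. Qed.

Lemma Q2_U2 : Q2 R *m U2 R = - (U2 R *m Q2 R).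
Proof. by pauli. Qed.

Lemma U2_adj : (U2 R) ^t* = U2 R.
Proof. by pauli. Qed.

Lemma Q2_adj : (Q2 R) ^t* = Q2 R.
Proof. by pauli. Qed.

Let iC : 'i%C * 'i%C = -1 :> C.
Proof. by rewrite -expr2 sqr_i. Qed.

Lemma V2_sqr : V2 *m V2 = 1%:M.
Proof.
rewrite /V2 -scalemxAl -scalemxAr scalerA iC !mulmxA -(mulmxA (U2 R) (Q2 R)) Q2_U2.
by rewrite mulmxN mulmxA U2_sqr mul1mx mulNmx Q2_sqr scaleN1r opprK.
Qed.

Lemma V2_adj : V2 ^t* = V2.
Proof.
rewrite /V2 adjmxZ adjmxM U2_adj Q2_adj Q2_U2 scalerN -scaleNr.
congr (_ *: _); apply/eqP; rewrite eq_complex /= !oppr0 opprK.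
by rewrite !eqxx.
Qed.

Lemma V2_U2 : V2 *m U2 R = - (U2 R *m V2).
Proof.
by rewrite /V2 -scalemxAl -scalemxAr -scalerN -mulmxA Q2_U2 mulmxN.
Qed.

Lemma Q2_V2 : Q2 R *m V2 = - (V2 *m Q2 R).
Proof.
by rewrite /V2 -scalemxAl -scalemxAr -scalerN mulmxA Q2_U2 mulNmx.
Qed.

End Pauli.

Section ConcreteClifford.
Variables (R : realType) (n : nat).
Local Notation C := R[i].
Implicit Types (j k l : 'I_n) (A : {set 'I_n}) (T : cubemx R n).

Definition site (M : 'M[C]_2) j l : 'M[C]_2 :=
  if (l < j)%N then U2 R else if l == j then M else 1%:M.

(** The same string of [U2] as in [fermion j], with [V2] at site [j]. The string provides the
    anticommutation between different sites, and [V2] the anticommutation with [fermion j]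
    itself. *)
Definition fermion_dual j : cubemx R n := tensmxs (site (V2 R) j).
Definition grading : cubemx R n := tensmxs (fun=> U2 R).

Let site_sqr M j l : M *m M = 1%:M -> site M j l *m site M j l = 1%:M.
Proof.
by rewrite /site => MM; case: ifP => _; [exact: U2_sqr|case: ifP => _//; exact: mulmx1].
Qed.

Let site_adj M j l : M ^t* = M -> (site M j l) ^t* = site M j l.
Proof.
by rewrite /site => MM; case: ifP => _; [exact: U2_adj|case: ifP => _//; exact: adjmx1].
Qed.

Let site_lt M L j k : M *m U2 R = - (U2 R *m M) -> (j < k)%N ->
  tensmxs (site M j) *m tensmxs (site L k) = - (tensmxs (site L k) *m tensmxs (site M j)).
Proof.
move=> MU jk; apply: (@tensmxs_anticomm _ _ _ _ j) => [|l lj].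
  by rewrite /site ltnn eqxx jk MU.
rewrite /site (negbTE lj); case: (ltnP l j) => [lt|_]; last by rewrite mulmx1 mul1mx.
by rewrite (ltn_trans lt jk).
Qed.

Let site_neq M L j k : M *m U2 R = - (U2 R *m M) -> L *m U2 R = - (U2 R *m L) ->
  j != k ->
  tensmxs (site M j) *m tensmxs (site L k) = - (tensmxs (site L k) *m tensmxs (site M j)).
Proof.
move=> MU LU jk; case: (ltngtP j k) => [lt|lt|/val_inj e].
- exact: site_lt.
- by apply/esym/(canLR (@opprK _)); exact: site_lt.
- by rewrite e eqxx in jk.
Qed.

Let site_grading M j : M *m U2 R = - (U2 R *m M) ->
  grading *m tensmxs (site M j) = - (tensmxs (site M j) *m grading).
Proof.
move=> MU; apply/esym/(canLR (@opprK _)).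
apply: (@tensmxs_anticomm _ _ _ _ j) => [|l lj]; first by rewrite /site ltnn eqxx.
by rewrite /site (negbTE lj); case: ifP => _ //; rewrite mul1mx mulmx1.
Qed.

Lemma fermion_clifford : clifford (@fermion R n) fermion_dual grading.
Proof.
split.
- move=> j; split; rewrite tensmxs_adj; apply: eq_tensmxs => l.
    exact: (site_adj j l (Q2_adj R)).
  exact: (site_adj j l (V2_adj R)).
- move=> j; split; apply: tensmxs_involution => l.
    exact: (site_sqr j l (Q2_sqr R)).
  exact: (site_sqr j l (V2_sqr R)).
- move=> j k; have [<-|jk] := eqVneq j k; last first.
    exact: (site_neq (Q2_U2 R) (V2_U2 R) jk).
  apply: (@tensmxs_anticomm _ _ _ _ j) => [|l lj].
    by rewrite /site ltnn eqxx; exact: Q2_V2.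
  by rewrite /site (negbTE lj); case: ifP => _.
- move=> j k jk; split; first exact: (site_neq (Q2_U2 R) (Q2_U2 R) jk).
  exact: (site_neq (V2_U2 R) (V2_U2 R) jk).
- split; first by rewrite tensmxs_adj; apply: eq_tensmxs => l; exact: U2_adj.
  + by apply: tensmxs_involution => l; exact: U2_sqr.
  + by move=> j; exact: (site_grading j (Q2_U2 R)).
  + by move=> j; exact: (site_grading j (V2_U2 R)).
Qed.

Lemma fermion_setE A : fermion_set R A = Qword (@fermion R n) A.
Proof. by rewrite /Qword /word /ordered big_filter. Qed.

Lemma fermion_alg_span T : fermion_alg T -> Qspan (@fermion R n) T.
Proof.
(* Stability of the span under left multiplication is proved for an element and its adjoint
   together, since the algebra is generated using adjoints as well. *)
pose stable U := forall S, Qspan (@fermion R n) S -> Qspan (@fermion R n) (U *m S).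
suff h : forall U, fermion_alg U -> stable U /\ stable (U ^t*).
  move=> /h[hT _]; rewrite -[T]mulmx1 -(Qword0 (@fermion R n)).
  exact/hT/Qspan_Qword.
move=> U; elim=> {U} [j||S U _ [s1 s2] _ [u1 u2]|c U _ [u1 u2]|S U _ [s1 s2] _ [u1 u2]|U _ [u1 u2]].
- have [adjQ _ _ _ _] := fermion_clifford.
  by rewrite (proj1 (adjQ j)); split=> S; exact: (Qspan_mul fermion_clifford).
- by rewrite adjmx1; split=> S; rewrite mul1mx.
- rewrite adjmxD; split=> X hX; rewrite mulmxDl; apply: QspanD.
  + exact: s1. + exact: u1. + exact: s2. + exact: u2.
- rewrite adjmxZ; split=> X hX; rewrite -scalemxAl; apply: QspanZ.
  + exact: u1. + exact: u2.
- rewrite adjmxM; split=> X hX; rewrite -mulmxA.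
  + exact/s1/u1. + exact/u2/s2.
- by rewrite adjmxK; split.
Qed.

Lemma card_Omega : #|Omega n| = (2 ^ n)%N.
Proof. by rewrite card_ffun !card_ord. Qed.

Let N0 : #|Omega n|%:R != 0 :> C.
Proof. by rewrite card_Omega natrX expf_neq0// pnatr_eq0. Qed.

Lemma coord_fermion_basis (t : {set 'I_n} -> C) A :
  coord (fermion_basis R n) (enum_rank A)
    (\sum_(B : {set 'I_n}) t B *: Qword (@fermion R n) B) = t A.
Proof.
have reidx (s : {set 'I_n} -> C) : \sum_(B : {set 'I_n}) s B *: Qword (@fermion R n) B =
    \sum_(k < #|{set 'I_n}|) s (enum_val k) *: (fermion_basis R n)`_k.
  rewrite (reindex (@enum_val _ {set 'I_n})); last first.
    by apply: onW_bij; exact: enum_val_bij.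
  apply: eq_bigr => k _; congr (_ *: _).
  by rewrite -tnth_nth tnth_mktuple fermion_setE.
(* Linear independence follows from orthogonality for the trace: pairing a vanishing combination
   with a word isolates its coefficient. *)
have fr : free (fermion_basis R n).
  apply/freeP => k k0 l; pose s B := k (enum_rank B).
  have : \sum_(B : {set 'I_n}) s B *: Qword (@fermion R n) B = 0.
    by rewrite reidx -[RHS]k0; apply: eq_bigr => m _; rewrite /s enum_valK.
  move=> s0; have := tr_Qword_sum fermion_clifford (enum_val l) s.
  rewrite s0 mulmx0 mxtrace0 => /esym/eqP.
  by rewrite mulf_eq0 (negbTE N0) orbF /s enum_valK => /eqP.
by rewrite reidx coord_sum_free// enum_rankK.
Qed.

Lemma lin_extE (L : {set 'I_n} -> cubemx R n) (t : {set 'I_n} -> C) T :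
  T = \sum_(A : {set 'I_n}) t A *: Qword (@fermion R n) A ->
  lin_ext L T = \sum_(A : {set 'I_n}) t A *: L A.
Proof.
by move=> ->; apply: eq_bigr => A _; rewrite coord_fermion_basis.
Qed.

Lemma fermDE j (t : {set 'I_n} -> C) T :
  T = \sum_(A : {set 'I_n}) t A *: Qword (@fermion R n) A ->
  fermD j T = partial (@fermion R n) t j.
Proof.
move=> TE; rewrite /fermD (lin_extE _ TE) /partial; apply: eq_bigr => A _.
by rewrite fermion_setE.
Qed.

Lemma grad_sE (t : {set 'I_n} -> C) T :
  T = \sum_(A : {set 'I_n}) t A *: Qword (@fermion R n) A ->
  grad_s T = sqrtmx (grad2 (@fermion R n) t).
Proof.
move=> TE; suff e : \sum_(j < n) (sqmodmx ((fermD j T) ^t*) + sqmodmx (fermD j T)) =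
    grad2 (@fermion R n) t by rewrite /grad_s e.
by apply: eq_bigr => j _; have e := fermDE j TE; rewrite e.
Qed.

Lemma number_powE (a : R) (t : {set 'I_n} -> C) T :
  T = \sum_(A : {set 'I_n}) t A *: Qword (@fermion R n) A ->
  number_pow a T = \sum_(A : {set 'I_n})
    ((if A == finset.set0 then 0 else #|A|%:R `^ a)%:C : C) *: (t A *: Qword (@fermion R n) A).
Proof.
move=> TE; rewrite /number_pow (lin_extE _ TE); apply: eq_bigr => A _.
rewrite fermion_setE; case: ifP => _; first by rewrite scaler0 scale0r.
by rewrite !scalerA mulrC.
Qed.

Lemma sub_ntraceE (t : {set 'I_n} -> C) T :
  T = \sum_(A : {set 'I_n}) t A *: Qword (@fermion R n) A ->
  T - ntrace T *: 1%:M = \sum_(A : {set 'I_n})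
    ((if A == finset.set0 then 0 else 1)%:C : C) *: (t A *: Qword (@fermion R n) A).
Proof.
move=> TE; have -> : ntrace T = t finset.set0.
  rewrite /ntrace -card_Omega.
  have := tr_Qword_sum fermion_clifford finset.set0 t.
  by rewrite -TE Qword0 adjmx1 mul1mx => ->; rewrite mulfK.
rewrite [in LHS]TE (bigD1 finset.set0)//= [in RHS](bigD1 finset.set0)//= eqxx.
rewrite scale0r add0r Qword0 addrAC subrr add0r.
by apply: eq_bigr => A /negbTE->; rewrite scale1r.
Qed.

End ConcreteClifford.

(** * Integrals of powers of - ln cos *)

Lemma is_derive_continuous (R : realType) (f : R -> R) (x d : R) :
  is_derive x 1 f d -> {for x, continuous f}.
Proof. by move=> [df _]; exact/differentiable_continuous/derivable1_diffP. Qed.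

Section LogCos.
Variable R : realType.
Implicit Types (a t x y : R) (k : nat).
Local Notation mu := (@lebesgue_measure R).

Definition lcos t : R := - ln (cos t).

Lemma pihalf_gt0 : 0 < pi / 2 :> R.
Proof. by case/andP: (pihalf_02 R). Qed.

Lemma pihalf_le_pi : pi / 2 <= pi :> R.
Proof. by rewrite ler_pdivrMr// ler_peMr ?pi_ge0// ler1n. Qed.

Lemma cos_itv t : 0 < t < pi / 2 -> 0 < cos t < 1.
Proof.
move=> t0; have c0 : 0 < cos t.
  by apply: cos_gt0_pihalf; case/andP: t0 => t0 ->;
    rewrite andbT (lt_trans _ t0)// oppr_lt0 pihalf_gt0.
rewrite c0 /=; have s0 := sin_gt0_pihalf t0.
have := cos2Dsin2 t; nra.
Qed.

Lemma lcos_gt0 t : 0 < t < pi / 2 -> 0 < lcos t.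
Proof. by move=> /cos_itv ct; rewrite oppr_gt0 ln_lt0. Qed.

Lemma is_derive_lcos t : 0 < cos t -> is_derive t 1 lcos (tan t).
Proof.
move=> ct; have dl := is_derive1_ln ct.
have dc := is_derive_cos t.
have -> : lcos = - (@ln R \o cos) by [].
have d := is_deriveN (is_derive1_comp dl dc); apply: (is_derive_eq d).
by rewrite /tan mulrN opprK mulrC.
Qed.

Lemma cos_seg_gt0 t x : 0 < t < pi / 2 -> 0 <= x <= t -> 0 < cos x.
Proof.
move=> /andP[t0 t1] /andP[x0 xt]; apply: cos_gt0_pihalf.
by rewrite (lt_le_trans _ x0) ?oppr_lt0 ?pihalf_gt0// (le_lt_trans xt).
Qed.

Lemma tan_ge t : 0 < t < pi / 2 -> t <= tan t.
Proof.
move=> t01; have [t0 t1] := andP t01.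
have [x|y|x xt] := @MVT_segment R tan (fun x => (cos x) ^- 2) 0 t (ltW t0).
- rewrite in_itv /= => /andP[x0 xt]; apply: is_derive_tan.
  by rewrite gt_eqF// (cos_seg_gt0 t01)// (ltW x0) ltW.
- move: y; apply/continuous_in_subspaceT => x; rewrite inE /= in_itv /= => x0t.
  by apply: continuous_tan; rewrite gt_eqF// (cos_seg_gt0 t01).
move: xt; rewrite in_itv /= => x0t; rewrite tan0 !subr0 => ->.
rewrite ler_peMl ?(ltW t0)// invf_ge1 ?exprn_gt0 ?(cos_seg_gt0 t01)//.
Qed.

(** Controls the singularity at 0: the power [- a] of [lcos] is of order at most [- 2 * a] in [t].
    It is integrable for [a < 1/2], and stays bounded for [a = 1/2] once multiplied by a factor
    vanishing linearly. *)
Lemma lcos_ge t : 0 < t < pi / 2 -> t ^+ 2 / 2 <= lcos t.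
Proof.
move=> t01; have [t0 t1] := andP t01.
pose h x := lcos x - x ^+ 2 / 2.
have dh x : 0 < cos x -> is_derive x 1 h (tan x - x).
  move=> cx; have d1 := is_derive_lcos cx.
  apply: is_derive_eq; rewrite /GRing.scale /=.
  by field.
have [x|y|x xt] := @MVT_segment R h (fun x => tan x - x) 0 t (ltW t0).
- rewrite in_itv /= => /andP[x0 xt]; apply: dh.
  by rewrite (cos_seg_gt0 t01)// (ltW x0) ltW.
- move: y; apply: derivable_within_continuous => x; rewrite in_itv /= => x0t.
  by have [] := dh x (cos_seg_gt0 t01 x0t).
move: xt; rewrite in_itv /= => /andP[x0 xt] e.
rewrite -subr_ge0 -/(h t).
have h0 : h 0 = 0 by rewrite /h /lcos cos0 ln1 expr0n /= mul0r oppr0 addr0.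
rewrite h0 !subr0 in e; rewrite e mulr_ge0 ?(ltW t0)// subr_ge0.
have [->|xn0] := eqVneq x 0; first by rewrite tan0.
by apply: tan_ge; rewrite lt0r xn0 x0 (le_lt_trans xt).
Qed.

(** [ln (1 + x) <= x] at the square of the tangent, since the inverse square of the cosine is one
    plus that square. *)
Lemma lcos_le t : 0 < t < pi / 2 -> 2 * lcos t <= tan t ^+ 2.
Proof.
move=> /cos_itv/andP[c0 c1]; have := cos2_tan2 (lt0r_neq0 c0).
move=> e; have -> : tan t ^+ 2 = (cos t) ^- 2 - 1 by rewrite e; ring.
have := @le_ln1Dx R ((cos t) ^- 2 - 1); rewrite [1 + _]addrC subrK.
rewrite lnV ?posrE ?exprn_gt0// lnXn// => h.
rewrite /lcos mulrN mulr_natl; apply: h.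
have : 0 < (cos t) ^- 2 by rewrite invr_gt0 exprn_gt0.
lra.
Qed.

Lemma powR_lcosN_bound a t : 0 <= a -> a <= 2^-1 -> 0 < t < pi / 2 ->
  lcos t `^ (- a) * t <= 4.
Proof.
move=> a0 a1 t01; have [t0 t1] := andP t01.
have l0 := lcos_gt0 t01; have lt := lcos_ge t01.
have t2 : t <= 2 by rewrite (le_trans (ltW t1))// ltW ?pihalf_lt2.
have [l1|l1] := leP 1 (lcos t).
  have : lcos t `^ (- a) <= lcos t `^ 0 by rewrite ler_powR// oppr_le0.
  rewrite powRr0 => h; have := powR_ge0 (lcos t) (- a); nra.
have h1 : lcos t `^ (- a) <= lcos t `^ (- 2^-1).
  by apply: ger_powR; rewrite ?l0 ?(ltW l1)// lerN2.
have h2 : lcos t `^ (- 2^-1) * t <= 4.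
  rewrite powRN powR12_sqrt ?(ltW l0)// mulrC ler_pdivrMr ?sqrtr_gt0//.
  have := sqr_sqrtr (ltW l0); have := sqrtr_gt0 (lcos t); rewrite l0 => s0 e.
  have : (t / 2) ^+ 2 <= Num.sqrt (lcos t) ^+ 2 by rewrite e; nra.
  rewrite ler_sqr ?nnegrE ?(ltW s0)// ?divr_ge0 ?(ltW t0)//; lra.
by apply: le_trans h2; rewrite ler_pM2r.
Qed.

Lemma sin_le_id t : 0 <= t -> sin t <= t.
Proof.
move=> t0; have [|x _] := @MVT_segment R sin cos 0 t t0.
  by apply/continuous_subspaceT/continuous_sin.
by rewrite sin0 !subr0 => ->; rewrite ler_piMl ?cos_le1.
Qed.

Definition quarter : set R := `]0, pi / 2[%classic.

Lemma in_quarter t : quarter t -> 0 < t < pi / 2.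
Proof. by rewrite /quarter /= in_itv. Qed.

Lemma measurable_quarter : @measurable _ (measurableTypeR R) quarter.
Proof. exact: measurable_itv. Qed.

Lemma measurable_powR_lcos a (D : set (measurableTypeR R)) :
  measurable_fun D (fun t => lcos t `^ a).
Proof.
apply: measurable_funTS.
apply: (measurableT_comp (measurable_powR a)).
apply: measurableT_comp => //.
apply: (measurableT_comp (@measurable_ln R)).
by apply: continuous_measurable_fun; exact: continuous_cos.
Qed.

Lemma measure_quarter_fin : (mu quarter < +oo)%E.
Proof.
by rewrite /quarter lebesgue_measure_itv /= lte_fin pihalf_gt0 -EFinB ltry.
Qed.

Lemma integrable_bounded_quarter (f : R -> R) M : measurable_fun quarter f ->
  (forall t, 0 < t < pi / 2 -> `|f t| <= M) -> mu.-integrable quarter (EFin \o f).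
Proof.
move=> mf fM; apply: measurable_bounded_integrable => //.
- exact: measurable_quarter.
- exact: measure_quarter_fin.
exists M; split; first exact: num_real.
by move=> x Mx t /= /in_quarter /fM h; apply: le_trans h (ltW Mx).
Qed.

(* The derivative of [- cos ^ k], which is the factor [k * sin * cos ^ (k - 1)]
   produced by differentiating a word of length [k] along the rotation. *)
Definition dcos k t : R := k%:R * (sin t * cos t ^+ k.-1).

Lemma dcos_bound k t : 0 < t < pi / 2 -> 0 <= dcos k t <= k%:R * t.
Proof.
move=> t01; have [t0 t1] := andP t01; have /andP[c0 c1] := cos_itv t01.
have s0 := sin_gt0_pihalf t01.
apply/andP; split; first by rewrite /dcos !mulr_ge0 ?(ltW s0) ?exprn_ge0 ?(ltW c0).
rewrite /dcos ler_wpM2l//; apply: le_trans (sin_le_id (ltW t0)).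
by rewrite ler_piMr ?(ltW s0)// exprn_ile1 ?(ltW c0) ?(ltW c1).
Qed.

Lemma continuous_dcos k : continuous (dcos k).
Proof.
move=> t; apply: cvgM; first exact: cvg_cst.
apply: cvgM; first exact: continuous_sin.
exact: (continuous_comp (@continuous_cos R t) (@exprn_continuous R k.-1 _)).
Qed.

Lemma measurable_dcos k (D : set R) : measurable_fun D (dcos k).
Proof. apply: measurable_funTS; apply: continuous_measurable_fun.
exact: continuous_dcos. Qed.

Lemma integrable_powR_dcos a k : 0 <= a -> a <= 2^-1 ->
  mu.-integrable quarter (EFin \o (fun t => lcos t `^ (- a) * dcos k t)).
Proof.
move=> a0 a1; apply: (integrable_bounded_quarter (M := k%:R * 4)).
  by apply: measurable_funM; [exact: measurable_powR_lcos|exact: measurable_dcos].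
move=> t t01; have /andP[d0 d1] := dcos_bound k t01.
rewrite ger0_norm; last exact: mulr_ge0 (powR_ge0 _ _) d0.
apply: le_trans (ler_wpM2l (powR_ge0 _ _) d1) _.
by rewrite mulrCA ler_wpM2l// powR_lcosN_bound.
Qed.

Lemma itv_quarter_ooE (f : R -> R) : mu.-integrable `[0, pi / 2] (EFin \o f) ->
  \int[mu]_(t in quarter) f t = \int[mu]_(t in `[0, pi / 2]) f t.
Proof.
move=> fi; rewrite /quarter Rintegral_itv_obnd_cbnd; last first.
  by apply: integrableS fi => //; apply: subset_itv; rewrite bnd_simp.
rewrite Rintegral_itv_bndo_bndc//.
by apply: integrableS fi => //; apply: subset_itv; rewrite bnd_simp.
Qed.

Lemma quarter_FTC (f F : R -> R) : continuous f -> (forall x, is_derive x 1 F (f x)) ->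
  \int[mu]_(t in quarter) f t = F (pi / 2) - F 0.
Proof.
move=> cf dF; rewrite itv_quarter_ooE; last first.
  apply: continuous_compact_integrable; first exact: segment_compact.
  exact: continuous_subspaceT.
have Fc x : F y @[y --> x] --> F x.
  exact: is_derive_continuous (dF x).
rewrite /Rintegral (@continuous_FTC2 _ f F)//.
- exact: pihalf_gt0.
- exact: continuous_subspaceT.
- split => [x _| |]; first by have [] := dF x.
  + exact: cvg_at_right_filter.
  + exact: cvg_at_left_filter.
- by move=> x _; rewrite derive1E; have [_ ->] := dF x.
Qed.

Lemma integral_dcos k : (0 < k)%N -> \int[mu]_(t in quarter) dcos k t = 1.
Proof.
have dF x : is_derive x 1 (fun t => - cos t ^+ k) (dcos k x).
  have -> : (fun t : R => - cos t ^+ k) = - (cos ^+ k).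
    by apply/funext => t; rewrite !fctE.
  have d := is_deriveN (is_deriveX k (is_derive_cos x)).
  by apply: (is_derive_eq d); rewrite /dcos /GRing.scale /=; ring.
move=> k0; rewrite (quarter_FTC (@continuous_dcos k) dF).
by rewrite cos_pihalf cos0 expr0n expr1n gtn_eqF//= oppr0 add0r opprK.
Qed.

Lemma integral_cos_quarter : \int[mu]_(t in quarter) cos t = 1.
Proof.
rewrite (quarter_FTC (F := sin)) ?sin_pihalf ?sin0 ?subr0//.
exact: continuous_cos.
Qed.

Lemma integral_powRN_bound a b x : 0 < x -> x < b -> a < 1 ->
  (\int[mu]_(t in `[x, b]) (t `^ (- a))%:E <= (b `^ (1 - a) / (1 - a))%:E)%E.
Proof.
move=> x0 xb a1; have a10 : 1 - a != 0 by rewrite gt_eqF// subr_gt0.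
pose F (t : R) : R := t `^ (1 - a) / (1 - a).
have dF t : 0 < t -> is_derive t 1 F (t `^ (- a)).
  move=> t0; have d := is_derive1_powR (1 - a) t0.
  apply: is_derive_eq; rewrite /GRing.scale /=.
  have -> : 1 - a - 1 = - a by ring.
  by field.
have Fc t : 0 < t -> F y @[y --> t] --> F t.
  by move=> t0; exact: is_derive_continuous (dF t t0).
rewrite (@continuous_FTC2 _ (fun t => t `^ (- a)) F)//.
- by rewrite -EFinB lee_fin lerBlDr lerDl divr_ge0 ?powR_ge0// subr_ge0 ltW.
- apply/continuous_in_subspaceT => t; rewrite inE /= in_itv /= => /andP[xt _].
  have t0 := lt_le_trans x0 xt.
  exact: is_derive_continuous (is_derive1_powR (- a) t0).
- split => [t| |]; first by rewrite in_itv /= => /andP[xt _]; have [] := dF t (lt_trans x0 xt).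
  + by apply/cvg_at_right_filter/Fc.
  + by apply/cvg_at_left_filter/Fc; exact: lt_trans xb.
- move=> t; rewrite in_itv /= => /andP[xt _]; rewrite derive1E.
  by have [_ ->] := dF t (lt_trans x0 xt).
Qed.

Lemma integrable_powRN a : 0 <= a -> a < 1 ->
  mu.-integrable quarter (EFin \o (fun t => t `^ (- a))).
Proof.
move=> a0 a1; set p := pi / 2 : R; have p0 : 0 < p by exact: pihalf_gt0.
(* [m.+2] keeps the left endpoint strictly below [p] already for [m = 0]. *)
pose A (m : nat) : set R := `[p / m.+2%:R, p]%classic.
have mf (D : set R) : measurable_fun D (EFin \o (fun t : R => t `^ (- a))).
  by apply/measurable_EFinP/measurable_funTS; exact: measurable_powR.
have xm m : 0 < p / m.+2%:R :> R by rewrite divr_gt0.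
have h : (\int[mu]_(t in A m) (t `^ (- a))%:E @[m --> \oo] -->
    \int[mu]_(t in \bigcup_m A m) (t `^ (- a))%:E)%E.
  apply: ge0_nondecreasing_set_cvg_integral => //.
  - move=> m l ml; rewrite subsetEset; apply: subset_itvr; rewrite bnd_simp.
    by rewrite ler_pM2l// lef_pV2 ?posrE// ler_nat.
  - by move=> m; exact: measurable_itv.
  - by move=> m; exact: mf.
  - by move=> m x _; rewrite lee_fin powR_ge0.
have le : (\int[mu]_(t in \bigcup_m A m) (t `^ (- a))%:E <= (p `^ (1 - a) / (1 - a))%:E)%E.
  rewrite -(cvg_lim _ h)//; apply: lime_le; first exact: cvgP h.
  near=> m; apply: integral_powRN_bound => //.
  by rewrite ltr_pdivrMr// ltr_pMr// ltr1n.
have sub : quarter `<=` \bigcup_m A m.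
  move=> t /in_quarter/andP[t0 tp]; exists (Num.trunc (p / t)) => //.
  rewrite /A /= in_itv /= (ltW tp) andbT ler_pdivrMr// mulrC -ler_pdivrMr//.
  by rewrite ltW// (lt_trans (truncnS_gt _))// ltr_nat.
apply: (integrableS _ measurable_quarter sub).
  by apply: bigcup_measurable => m _; exact: measurable_itv.
apply/integrableP; split; first exact: mf.
under eq_integral => t _ do rewrite /= ger0_norm ?powR_ge0//.
exact: le_lt_trans le (ltry _).
Unshelve. all: by end_near. Qed.

Lemma integrable_powR_lcos a : 0 <= a -> a < 2^-1 ->
  mu.-integrable quarter (EFin \o (fun t => lcos t `^ (- a))).
Proof.
move=> a0 a1.
have h := integrable_powRN (mulr_ge0 (ler0n R 2) a0); have {h}: 2 * a < 1 by lra.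
move=> /(integrable_powRN (mulr_ge0 (ler0n R 2) a0)) h.
have {}h := integrableZl measurable_quarter (2 `^ a) h.
apply: (le_integrable measurable_quarter _ _ h).
  by apply/measurable_EFinP; exact: measurable_powR_lcos.
move=> t /in_quarter t01; have [t0 t1] := andP t01; have lt := lcos_ge t01.
rewrite /= lee_fin !ger0_norm ?mulr_ge0 ?powR_ge0//.
have t2 : 0 < t ^+ 2 / 2 by rewrite divr_gt0 ?exprn_gt0.
have -> : 2 `^ a * t `^ (- (2 * a)) = (t ^+ 2 / 2) `^ (- a).
  rewrite powRM ?exprn_ge0 ?invr_ge0 ?(ltW t0)// -powR_inv1// -powRrM mulrNN mul1r mulrC.
  by rewrite -mulrN powRrM powR_mulrn// ltW.
rewrite !powRN lef_pV2 ?posrE ?powR_gt0 ?(lcos_gt0 t01)//.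
by rewrite ge0_ler_powR ?nnegrE ?(ltW t2) ?(ltW (lcos_gt0 t01)).
Qed.

End LogCos.

(** * Gamma integrals through the substitution u = - k ln (cos t) *)

Section GammaIntegrals.
Variable R : realType.
Implicit Types (a t x y z u : R) (k m : nat).
Local Notation mu := (@lebesgue_measure R).
Local Notation lcos := (@lcos R).
Local Notation quarter := (@quarter R).

Definition lcosV u : R := acos (expR (- u)).

Lemma lcosV_itv u : 0 < u -> 0 < lcosV u < pi / 2.
Proof.
move=> u0; have e0 := expR_gt0 (- u).
have e1 : expR (- u) < 1 by rewrite -expR0 ltr_expR oppr_lt0.
have eN : -1 < expR (- u) by rewrite (lt_trans _ e0)// oppr_lt0.
have a0 : 0 < lcosV u by apply: acos_gt0; rewrite (ltW eN) e1.
rewrite a0 /= ltNge; apply/negP => h.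
have : cos (lcosV u) <= cos (pi / 2).
  have p2 := pihalf_le_pi R.
  have ap : lcosV u <= pi by apply: acos_lepi; rewrite (ltW eN) (ltW e1).
  rewrite leNgt ltr_cos ?in_itv /=; last 2 first.
  - by rewrite (ltW a0).
  - by rewrite (ltW (pihalf_gt0 R)).
  by rewrite -leNgt.
rewrite cos_pihalf acosK ?in_itv /= ?(ltW eN) ?(ltW e1)//.
by rewrite leNgt e0.
Qed.

Lemma lcosVK u : 0 < u -> lcos (lcosV u) = u.
Proof.
move=> u0; rewrite /lcos /lcosV acosK ?expRK ?opprK//.
rewrite in_itv /= (le_trans _ (expR_ge0 _)) ?oppr_le0//=.
by rewrite -expR0 ler_expR oppr_le0 ltW.
Qed.

Lemma ltr_lcos x y : 0 < x < pi / 2 -> 0 < y < pi / 2 -> (lcos x < lcos y) = (x < y).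
Proof.
move=> x0 y0; have /andP[cx _] := cos_itv x0; have /andP[cy _] := cos_itv y0.
rewrite /lcos ltrN2 ltr_ln// ltr_cos// in_itv /=.
- by case/andP: x0 => {}x0 xp; rewrite (ltW x0) (le_trans (ltW xp) (pihalf_le_pi R)).
- by case/andP: y0 => {}y0 yp; rewrite (ltW y0) (le_trans (ltW yp) (pihalf_le_pi R)).
Qed.

Lemma ler_lcos x y : 0 < x < pi / 2 -> 0 < y < pi / 2 -> (lcos x <= lcos y) = (x <= y).
Proof. by move=> x0 y0; rewrite leNgt ltr_lcos// -leNgt. Qed.

Lemma near_cos_gt0 z : 0 < cos z -> \forall z' \near z, 0 < cos z'.
Proof. by move=> cz; exact: (cvgr_gt _ (@continuous_cos R z)). Qed.

Let G a u : R := u `^ (- a) * expR (- u).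

Lemma continuous_powR_expR a u : 0 < u -> {for u, continuous (G a)}.
Proof.
move=> u0; have c := is_derive_continuous (is_derive1_powR (- a) u0).
apply: cvgM; first exact: c.
have c2 : {for u, continuous (@expR R \o -%R)}.
  by apply: continuous_comp; [exact: opp_continuous|exact: continuous_expR].
exact: c2.
Qed.

Lemma expR_lcos k t : 0 < cos t -> expR (- (k%:R * lcos t)) = cos t ^+ k.
Proof. by move=> ct; rewrite /lcos mulrN opprK expRM_natl lnK ?posrE. Qed.

Lemma powR_expR_lcos a k t : (0 < k)%N -> 0 < t < pi / 2 ->
  G a (k%:R * lcos t) * (k%:R * tan t) = k%:R `^ (- a) * (lcos t `^ (- a) * dcos k t).
Proof.
move=> k0 t0; have /andP[c0 _] := cos_itv t0; have l0 := lcos_gt0 t0.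
rewrite /G expR_lcos// powRM ?(ltW l0)// /dcos /tan -(prednK k0) exprS /=.
by rewrite -!mulrA; field; rewrite gt_eqF.
Qed.

(** For [u = k * lcos t] one has [du = k * tan t dt], and [expR (- u)] is the k-th power of [cos t];
    their product is [dcos k t]. *)
Lemma lcos_substitution a k x y : (0 < k)%N -> 0 < x < pi / 2 -> 0 < y < pi / 2 -> x <= y ->
  (\int[mu]_(u in `[(k%:R * lcos x)%R, (k%:R * lcos y)%R]) (G a u)%:E =
   \int[mu]_(t in `[x, y]) (k%:R `^ (- a) * (lcos t `^ (- a) * dcos k t))%:E)%E.
Proof.
move=> k0 x01 y01 xy; pose F t : R := k%:R * lcos t.
have [x0 x1] := andP x01; have [y0 y1] := andP y01.
have kR : 0 < k%:R :> R by rewrite ltr0n.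
have xyq t : x <= t -> t <= y -> 0 < t < pi / 2.
  by move=> xt ty; rewrite (lt_le_trans x0)//= (le_lt_trans ty).
have dF t : 0 < cos t -> is_derive t 1 F (k%:R * tan t).
  move=> ct; have d := is_derive_lcos ct.
  exact: (is_deriveZ k%:R d).
have F'E t : 0 < cos t -> derive1 F t = k%:R * tan t.
  by move=> ct; rewrite derive1E; have [_ ->] := dF t ct.
have F'c t : 0 < cos t -> {for t, continuous (derive1 F)}.
  move=> ct; change (derive1 F s @[s --> t] --> derive1 F t); rewrite (F'E t ct).
  have : (k%:R * tan s) @[s --> t] --> k%:R * tan t.
    by apply: cvgM; [exact: cvg_cst|apply: continuous_tan; rewrite gt_eqF].
  apply: cvg_trans; apply: near_eq_cvg; near=> s; rewrite F'E//.
  by near: s; exact: near_cos_gt0.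
have Fc t : 0 < cos t -> {for t, continuous F}.
  by move=> ct; exact: is_derive_continuous (dF t ct).
have /andP[cx _] := cos_itv x01; have /andP[cy _] := cos_itv y01.
rewrite (@integration_by_substitution_increasing _ F (G a) x y)//.
- apply: eq_integral => t; rewrite inE /= in_itv /= => /andP[xt ty].
  have t0 := xyq _ xt ty; have /andP[ct _] := cos_itv t0.
  by rewrite fctE /= F'E// -powR_expR_lcos.
- move=> s t; rewrite !in_itv /= => /andP[xs sy] /andP[xt ty] st.
  by rewrite /F ltr_pM2l// ltr_lcos// xyq.
- move=> t; rewrite in_itv /= => /andP[xt ty]; apply: F'c.
  by have /andP[] := cos_itv (xyq t (ltW xt) (ltW ty)).
- by apply/cvg_ex; exists (derive1 F x); apply/cvg_at_right_filter/F'c.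
- by apply/cvg_ex; exists (derive1 F y); apply/cvg_at_left_filter/F'c.
- split => [t| |].
  + rewrite in_itv /= => /andP[xt ty].
    have /andP[ct _] := cos_itv (xyq t (ltW xt) (ltW ty)).
    by have [] := dF t ct.
  + exact/cvg_at_right_filter/Fc.
  + exact/cvg_at_left_filter/Fc.
- apply/continuous_in_subspaceT => u; rewrite inE /= in_itv /= => /andP[xu _].
  apply: continuous_powR_expR; apply: lt_le_trans xu.
  by rewrite mulr_gt0// lcos_gt0.
Unshelve. all: by end_near. Qed.

Lemma archi_itv u : 0 < u -> exists m, m.+1%:R^-1 <= u <= m.+1%:R.
Proof.
move=> u0; exists (maxn (Num.trunc u) (Num.trunc u^-1)); apply/andP; split.
  rewrite -[leRHS]invrK lef_pV2 ?posrE ?invr_gt0//.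
  by rewrite (le_trans (ltW (truncnS_gt _)))// ler_nat ltnS leq_maxr.
by rewrite (le_trans (ltW (truncnS_gt _)))// ler_nat ltnS leq_maxl.
Qed.

Lemma bigcup_archi_itv : \bigcup_m `[m.+1%:R^-1, m.+1%:R]%classic = `]0, +oo[%classic :> set R.
Proof.
apply/seteqP; split => u /=.
  move=> [m _] /=; rewrite !in_itv /= andbT => /andP[h _].
  by rewrite (lt_le_trans _ h)// invr_gt0.
rewrite in_itv /= andbT => /archi_itv[m h]; exists m => //=.
Qed.

Lemma bigcup_lcosV k : (0 < k)%N ->
  \bigcup_m `[lcosV (m.+1%:R^-1 / k%:R), lcosV (m.+1%:R / k%:R)]%classic = quarter.
Proof.
move=> k0; have kR : 0 < k%:R :> R by rewrite ltr0n.
have q1 m : 0 < lcosV (m.+1%:R^-1 / k%:R) < pi / 2 by rewrite lcosV_itv// divr_gt0 ?invr_gt0.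
have q2 m : 0 < lcosV (m.+1%:R / k%:R) < pi / 2 by rewrite lcosV_itv// divr_gt0.
apply/seteqP; split => t /=.
  move=> [m _] /=; rewrite /quarter /= !in_itv /= => /andP[h1 h2].
  have /andP[l0 _] := q1 m; have /andP[_ l1] := q2 m.
  by rewrite (lt_le_trans l0)// (le_lt_trans h2).
move=> /in_quarter t0; have l0 := lcos_gt0 t0.
have [|m /andP[h1 h2]] := @archi_itv (lcos t * k%:R); first exact: mulr_gt0.
exists m; first by [].
rewrite /= in_itv /= -(ler_lcos (q1 m) t0) -(ler_lcos t0 (q2 m)) lcosVK ?divr_gt0 ?invr_gt0//.
by rewrite lcosVK ?divr_gt0// ler_pdivrMr// ler_pdivlMr// h1.
Qed.

(** The substitution is made on segments; these exhaust the half-line of the Gamma integral, their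
    preimages exhaust the quarter, and monotone convergence applies to both nonnegative
    integrands. *)
Lemma integral_lcos_Gamma a k : (0 < k)%N ->
  (\int[mu]_(t in quarter) (k%:R `^ (- a) * (lcos t `^ (- a) * dcos k t))%:E =
   \int[mu]_(u in `]0%R, +oo[) (G a u)%:E)%E.
Proof.
move=> k0; have kR : 0 < k%:R :> R by rewrite ltr0n.
rewrite -(bigcup_lcosV k0) -bigcup_archi_itv.
pose A m : set R := `[lcosV (m.+1%:R^-1 / k%:R), lcosV (m.+1%:R / k%:R)]%classic.
pose B m : set R := `[m.+1%:R^-1, m.+1%:R]%classic.
have q1 m : 0 < lcosV (m.+1%:R^-1 / k%:R) < pi / 2 by rewrite lcosV_itv// divr_gt0 ?invr_gt0.
have q2 m : 0 < lcosV (m.+1%:R / k%:R) < pi / 2 by rewrite lcosV_itv// divr_gt0.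
have inc m l : (m <= l)%N -> l.+1%:R^-1 <= m.+1%:R^-1 :> R /\ m.+1%:R <= l.+1%:R :> R.
  by move=> ml; rewrite lef_pV2 ?posrE// ler_nat ltnS.
have mG (D : set (measurableTypeR R)) : measurable_fun D (EFin \o G a).
  apply/measurable_EFinP; apply: measurable_funTS; apply: measurable_funM.
    exact: measurable_powR.
  by apply: measurableT_comp => //; apply: measurableT_comp.
have mH (D : set (measurableTypeR R)) : measurable_fun D
    (EFin \o (fun t => k%:R `^ (- a) * (lcos t `^ (- a) * dcos k t))).
  apply/measurable_EFinP; apply: measurable_funM => //; apply: measurable_funM.
    exact: measurable_powR_lcos.
  exact: measurable_dcos.
have cA : (\int[mu]_(t in A m) (k%:R `^ (- a) * (lcos t `^ (- a) * dcos k t))%:E @[m --> \oo]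
    --> \int[mu]_(t in \bigcup_m A m) (k%:R `^ (- a) * (lcos t `^ (- a) * dcos k t))%:E)%E.
  apply: ge0_nondecreasing_set_cvg_integral.
  - move=> m l ml; rewrite subsetEset; apply: subset_itv; rewrite bnd_simp.
      rewrite -ler_lcos// !lcosVK ?divr_gt0 ?invr_gt0// ler_pM2r ?invr_gt0//.
      by have [] := inc m l ml.
    rewrite -ler_lcos// !lcosVK ?divr_gt0// ler_pM2r ?invr_gt0//.
    by have [] := inc m l ml.
  - by move=> m; exact: measurable_itv.
  - by move=> m; exact: mH.
  - move=> m t; rewrite /A /= in_itv /= => /andP[h1 h2]; rewrite lee_fin.
    have /andP[l0 _] := q1 m; have /andP[_ l1] := q2 m.
    have t0 : 0 < t < pi / 2 by rewrite (lt_le_trans l0)// (le_lt_trans h2).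
    have /andP[d0 _] := dcos_bound k t0.
    apply: mulr_ge0; first exact: powR_ge0.
    exact: mulr_ge0 (powR_ge0 _ _) d0.
have cB : (\int[mu]_(u in B m) (G a u)%:E @[m --> \oo]
    --> \int[mu]_(u in \bigcup_m B m) (G a u)%:E)%E.
  apply: ge0_nondecreasing_set_cvg_integral.
  - move=> m l ml; rewrite subsetEset; have [h1 h2] := inc m l ml.
    by apply: subset_itv; rewrite bnd_simp.
  - by move=> m; exact: measurable_itv.
  - by move=> m; exact: mG.
  - by move=> m t _; rewrite lee_fin mulr_ge0 ?powR_ge0 ?expR_ge0.
have e : (fun m => \int[mu]_(u in B m) (G a u)%:E)%E =
    (fun m => \int[mu]_(t in A m) (k%:R `^ (- a) * (lcos t `^ (- a) * dcos k t))%:E)%E.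
  apply/funext => m; rewrite /A -lcos_substitution//.
    rewrite !lcosVK ?divr_gt0 ?invr_gt0// ![k%:R * _]mulrC !divfK ?gt_eqF//.
  rewrite -ler_lcos// !lcosVK ?divr_gt0 ?invr_gt0// ler_pM2r ?invr_gt0//.
  by rewrite (@le_trans _ _ 1) ?ler1n// invf_le1// ler1n.
rewrite e in cB; exact: cvg_unique cA cB.
Qed.

Lemma integral_powR_dcos a k : (0 < k)%N -> 0 <= a -> a <= 2^-1 ->
  \int[mu]_(t in quarter) (lcos t `^ (- a) * dcos k t) = k%:R `^ a * Gamma (1 - a).
Proof.
move=> k0 a0 a1.
have kR : 0 < k%:R :> R by rewrite ltr0n.
have -> : Gamma (1 - a) = k%:R `^ (- a) * \int[mu]_(t in quarter) (lcos t `^ (- a) * dcos k t).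
  rewrite -RintegralZl; [|exact: measurable_quarter|exact: integrable_powR_dcos].
  rewrite /Gamma /Rintegral (integral_lcos_Gamma a k0); congr (fine _).
  apply: eq_integral => u _; rewrite /G.
  by have -> : 1 - a - 1 = - a by ring.
by rewrite mulrA -powRD; [rewrite subrr powRr0 mul1r|rewrite (gt_eqF kR) implybT].
Qed.

Lemma powRN_ge_expR a x : 0 <= a -> a <= 1 -> 0 < x -> expR (- x) <= x `^ (- a).
Proof.
move=> a0 a1 x0; rewrite powRN expRN lef_pV2 ?posrE ?expR_gt0 ?powR_gt0//.
have [x1|x1] := leP 1 x.
  rewrite (le_trans (ler1_powR x1 a1))// (le_trans _ (expR_ge1Dx x))// lerDr//.
apply: (@le_trans _ _ (x `^ 0)); first by apply: ger_powR; rewrite // x0 ltW.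
by rewrite powRr0 -expR0 ler_expR ltW.
Qed.

(** A divergent real integral would have the value 0, so positivity of the integrand is not enough.
    The integral is transported to the quarter, where integrability is known, and bounded below
    there by that of [cos t * sin t]. *)
Lemma Gamma_gt0 a : 0 <= a -> a <= 2^-1 -> 0 < Gamma (1 - a) :> R.
Proof.
move=> a0 a1; have := integral_powR_dcos (ltn0Sn 0) a0 a1.
rewrite powR1 mul1r => <-.
have h : mu.-integrable quarter (EFin \o (fun t => 2^-1 * dcos 2 t)).
  apply: (integrable_bounded_quarter (M := 2)).
    by apply: measurable_funM => //; exact: measurable_dcos.
  move=> t t0; have /andP[d0 d1] := dcos_bound 2 t0.
  have [t1 t2] := andP t0; have t3 := pihalf_lt2 R.
  by rewrite ger0_norm; lra.
apply: (@lt_le_trans _ _ (\int[mu]_(t in quarter) (2^-1 * dcos 2 t))).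
  rewrite RintegralZl; [|exact: measurable_quarter|].
    by rewrite integral_dcos// mulr1 invr_gt0.
  apply: (integrable_bounded_quarter (M := 4)); first exact: measurable_dcos.
  move=> t t0; have /andP[d0 d1] := dcos_bound 2 t0.
  have [t1 t2] := andP t0; have t3 := pihalf_lt2 R.
  by rewrite ger0_norm; lra.
apply: le_Rintegral; [exact: measurable_quarter|exact: h|exact: integrable_powR_dcos|].
move=> t /in_quarter t0; have /andP[c0 _] := cos_itv t0.
have l0 := lcos_gt0 t0; have s0 := sin_gt0_pihalf t0.
have := powRN_ge_expR a0 _ l0; rewrite {1}/lcos opprK lnK// => h1.
have {}h1 := h1 (le_trans a1 _); rewrite /dcos /= expr0 expr1 mulr1 mul1r.
have -> : 2^-1 * (2 * (sin t * cos t)) = cos t * sin t by field.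
rewrite ler_pM2r//; apply: h1.
by rewrite invf_le1// ler1n.
Qed.

(** Compares the factor produced by the rotations with the normalization of [HE]. An exact value is
    avoided: by [lcos_le] the integrand on the quarter is at least [Num.sqrt 2 * cos t], of integral
    [Num.sqrt 2], and [pi <= 4] concludes. *)
Lemma Gamma_half_ge : Num.sqrt (2 * pi) <= 2 * Gamma 2^-1 :> R.
Proof.
have h0 : (0 : R) <= 2^-1 by rewrite invr_ge0.
have := integral_powR_dcos (ltn0Sn 0) h0 (lexx _).
have -> : 1 - 2^-1 = 2^-1 :> R by lra.
rewrite powR1 mul1r => <-.
have ci : mu.-integrable quarter (EFin \o cos).
  apply: (integrable_bounded_quarter (M := 1)).
    by apply: measurable_funTS; apply: continuous_measurable_fun; exact: continuous_cos.
  by move=> t _; exact: cos_max.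
have ci' : mu.-integrable quarter (EFin \o (fun t => Num.sqrt 2 * cos t)).
  apply: (integrable_bounded_quarter (M := Num.sqrt 2)).
    apply: measurable_funM => //; apply: measurable_funTS.
    by apply: continuous_measurable_fun; exact: continuous_cos.
  move=> t _; rewrite normrM ger0_norm ?sqrtr_ge0//.
  by rewrite ler_piMr ?sqrtr_ge0 ?cos_max.
have : \int[mu]_(t in quarter) (Num.sqrt 2 * cos t) <=
    \int[mu]_(t in quarter) (lcos t `^ (- 2^-1) * dcos 1 t).
  apply: le_Rintegral; [exact: measurable_quarter|exact: ci'|exact: integrable_powR_dcos|].
  move=> t /in_quarter t0; have /andP[c0 _] := cos_itv t0.
  have l0 := lcos_gt0 t0; have s0 := sin_gt0_pihalf t0; have lt := lcos_le t0.
  rewrite /dcos mul1r /= expr0 mulr1 powRN powR12_sqrt ?(ltW l0)//.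
  rewrite [leRHS]mulrC ler_pdivlMr ?sqrtr_gt0// mulrAC -sqrtrM// -ler_pdivlMr//.
  have t1 : 0 <= sin t / cos t by rewrite divr_ge0 ?ltW.
  by rewrite -(ger0_norm t1) -sqrtr_sqr ler_sqrt ?sqr_ge0.
rewrite RintegralZl//; last exact: measurable_quarter.
rewrite integral_cos_quarter mulr1 => h.
apply: (@le_trans _ _ (2 * Num.sqrt 2)); last by rewrite ler_pM2l.
have -> : 2 * Num.sqrt 2 = Num.sqrt (2 ^+ 2 * 2) :> R.
  by rewrite sqrtrM ?exprn_ge0// sqrtr_sqr ger0_norm.
have h2 := pihalf_lt2 R; rewrite ltr_pdivrMr// in h2.
by rewrite ler_sqrt; lra.
Qed.

End GammaIntegrals.

(** * Principal values *)

Section BoundedLipschitz.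
Variable R : realType.
Implicit Types (f g : R -> R) (K x y : R).

(** Lipschitz continuity tames the singularity of the kernel in a symmetric difference; boundedness
    makes the class closed under products, hence under matrix multiplication of entries. *)
Definition bounded_lipschitz f := exists K,
  (forall x, `|f x| <= K) /\ (forall x y, `|f x - f y| <= K * `|x - y|).

Lemma bounded_lipschitz_cst K : bounded_lipschitz (fun=> K).
Proof.
exists `|K|; split=> [//|x y].
by rewrite subrr normr0 mulr_ge0.
Qed.

Lemma bounded_lipschitzD f g : bounded_lipschitz f -> bounded_lipschitz g ->
  bounded_lipschitz (fun x => f x + g x).
Proof.
move=> [K [fK fl]] [L [gL gl]]; exists (K + L); split => [x|x y].
  by rewrite (le_trans (ler_normD _ _))// lerD.
by rewrite opprD addrACA (le_trans (ler_normD _ _))// mulrDl lerD.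
Qed.

Lemma bounded_lipschitzM f g : bounded_lipschitz f -> bounded_lipschitz g ->
  bounded_lipschitz (fun x => f x * g x).
Proof.
move=> [K [fK fl]] [L [gL gl]].
have K0 : 0 <= K := le_trans (normr_ge0 _) (fK 0).
have L0 : 0 <= L := le_trans (normr_ge0 _) (gL 0).
exists (K * L * 2); split => [x|x y].
  rewrite normrM (le_trans (ler_pM _ _ (fK x) (gL x)))// ler_peMr ?mulr_ge0//.
  by rewrite ler1n.
have -> : f x * g x - f y * g y = (f x - f y) * g x + f y * (g x - g y) by ring.
apply: le_trans (ler_normD _ _) _; rewrite !normrM.
have h1 : `|f x - f y| * `|g x| <= K * `|x - y| * L by apply: ler_pM.
have h2 : `|f y| * `|g x - g y| <= K * (L * `|x - y|) by apply: ler_pM.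
lra.
Qed.

Lemma bounded_lipschitzN f : bounded_lipschitz f -> bounded_lipschitz (fun x => - f x).
Proof.
move=> fl; have := bounded_lipschitzM (bounded_lipschitz_cst (-1)) fl.
by under eq_fun do rewrite mulN1r.
Qed.

Lemma bounded_lipschitz_sum (I : Type) (r : seq I) (P : pred I) (F : I -> R -> R) :
  (forall i, bounded_lipschitz (F i)) -> bounded_lipschitz (fun x => \sum_(i <- r | P i) F i x).
Proof.
move=> Fl; elim: r => [|i r IH].
  by under eq_fun do rewrite big_nil; exact: bounded_lipschitz_cst.
under eq_fun do rewrite big_cons; case: (P i) => //.
exact: bounded_lipschitzD.
Qed.

Lemma bounded_lipschitz_scale f (c : R) : bounded_lipschitz f ->
  bounded_lipschitz (fun x => f (c * x)).
Proof.
move=> [K [fK fl]]; have K0 : 0 <= K := le_trans (normr_ge0 _) (fK 0).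
exists (K * (1 + `|c|)); split => [x|x y].
  by rewrite (le_trans (fK _))// ler_peMr// lerDl.
rewrite (le_trans (fl _ _))// -mulrBr normrM -mulrA ler_wpM2l//.
by rewrite ler_wpM2r// lerDr.
Qed.

Let lipschitz_deriv f g : (forall x, is_derive x 1 f (g x)) -> (forall x, `|g x| <= 1) ->
  forall x y, `|f x - f y| <= `|x - y|.
Proof.
move=> df g1; suff h x y : y <= x -> `|f x - f y| <= `|x - y|.
  move=> x y; have [/h//|/ltW/h] := leP y x.
  by rewrite distrC (distrC y).
move=> yx; have [|z _ ->] := @MVT_segment R f g y x yx.
  by apply: continuous_subspaceT => s; exact: is_derive_continuous (df s).
by rewrite normrM ler_piMl.
Qed.

Lemma bounded_lipschitz_sin : bounded_lipschitz sin.
Proof.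
exists 1; split => [x|x y]; first exact: sin_max.
rewrite mul1r; apply: (lipschitz_deriv (g := cos)) => z; exact: cos_max.
Qed.

Lemma bounded_lipschitz_cos : bounded_lipschitz cos.
Proof.
exists 1; split => [x|x y]; first exact: cos_max.
rewrite mul1r; apply: (lipschitz_deriv (g := fun x => - sin x)) => z.
by rewrite normrN sin_max.
Qed.

Lemma bounded_lipschitz_continuous f : bounded_lipschitz f -> continuous f.
Proof.
move=> [K [fK fl]] x; have K0 : 0 <= K := le_trans (normr_ge0 _) (fK 0).
apply/cvgrPdist_le => e e0; have e1 : 0 < e / (K + 1) by rewrite divr_gt0// ltr_wpDl.
near=> y.
have h : `|x - y| <= e / (K + 1).
  by near: y; move: (@cvg_id _ (nbhs x)) => /cvgrPdist_le /(_ _ e1).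
apply: le_trans (fl _ _) _; apply: le_trans (ler_wpM2l K0 h) _.
rewrite mulrCA ler_piMr ?(ltW e0)// ler_pdivrMr ?ltr_wpDl// mul1r.
by rewrite lerDl.
Unshelve. all: by end_near. Qed.

Lemma bounded_lipschitz_measurable f (D : set (measurableTypeR R)) :
  bounded_lipschitz f -> measurable_fun D f.
Proof.
move=> fl; apply: measurable_funTS; apply: continuous_measurable_fun.
exact: bounded_lipschitz_continuous.
Qed.

End BoundedLipschitz.

Section PrincipalValue.
Variable R : realType.
Local Notation mu := (@lebesgue_measure R).
Local Notation lcos := (@lcos R).
Local Notation quarter := (@quarter R).
Implicit Types (e t x : R).

Lemma Rintegral_opp (D : set R) (f : R -> R) : @measurable _ (measurableTypeR R) D ->
  measurable_fun (setT : set (measurableTypeR R)) f ->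
  mu.-integrable ((-%R : R -> R) @^-1` D) (EFin \o (fun t => f (- t))) ->
  \int[mu]_(t in D) f t = \int[mu]_(t in (-%R : R -> R) @^-1` D) f (- t).
Proof.
move=> mD mf fi; rewrite /Rintegral; congr (fine _).
pose N : measurableTypeR R -> measurableTypeR R := -%R.
have mN : measurable_fun setT N by by apply: continuous_measurable_fun; exact: opp_continuous.
rewrite -(@integral_pushforward _ _ _ _ R N mN mu D (EFin \o f))//.
  by apply: eq_measure_integral => A mA _; exact/esym/lebesgue_measureN.
exact/measurable_EFinP.
Qed.

Variables (u : R -> R) (x : R).
Hypothesis ul : bounded_lipschitz u.

(** [k] is the integrand [phi t * u (x - t)] on the punctured interval of radius [pi / 2], and [H]
    is what remains of it when [t] and [- t] are folded together. *)
Let k t : R := if 0 < t then lcos t `^ (- 2^-1) * u (x - t)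
  else - (lcos t `^ (- 2^-1) * u (x - t)).
Let H t : R := lcos t `^ (- 2^-1) * (u (x - t) - u (x + t)).

Let mu_shift (f : R -> R) (D : set (measurableTypeR R)) : continuous f ->
  measurable_fun D (fun t => u (f t)).
Proof.
move=> cf; apply: measurable_funTS; apply: continuous_measurable_fun => t.
apply: (continuous_comp (cf t)); exact: bounded_lipschitz_continuous.
Qed.

Let mk (D : set (measurableTypeR R)) : measurable_fun D k.
Proof.
have m : measurable_fun (setT : set (measurableTypeR R)) (fun t => lcos t `^ (- 2^-1) * u (x - t)).
  apply: measurable_funM; first exact: measurable_powR_lcos.
  by apply: mu_shift => t; apply: cvgB; [exact: cvg_cst|exact: cvg_id].
apply: measurable_funTS; apply: measurable_fun_ifT => //; last exact: measurable_funN.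
by apply: measurable_fun_ltr.
Qed.

Let mkN (D : set (measurableTypeR R)) : measurable_fun D (fun t => k (- t)).
Proof.
have -> : (fun t => k (- t)) = (fun t => if t < 0 then lcos t `^ (- 2^-1) * u (x + t)
    else - (lcos t `^ (- 2^-1) * u (x + t))).
  by apply/funext => t; rewrite /k oppr_gt0 /lcos cosN opprK.
have m : measurable_fun (setT : set (measurableTypeR R)) (fun t => lcos t `^ (- 2^-1) * u (x + t)).
  apply: measurable_funM; first exact: measurable_powR_lcos.
  by apply: mu_shift => t; apply: cvgD; [exact: cvg_cst|exact: cvg_id].
apply: measurable_funTS; apply: measurable_fun_ifT => //; last exact: measurable_funN.
by apply: measurable_fun_ltr.
Qed.

Let mH (D : set (measurableTypeR R)) : measurable_fun D H.
Proof.
apply: measurable_funM; first exact: measurable_powR_lcos.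
apply: measurable_funB.
  by apply: mu_shift => t; apply: cvgB; [exact: cvg_cst|exact: cvg_id].
by apply: mu_shift => t; apply: cvgD; [exact: cvg_cst|exact: cvg_id].
Qed.

Let H_bound : exists M, 0 <= M /\ forall t, 0 < t < pi / 2 -> `|H t| <= M.
Proof.
have [K [uK lK]] := ul; have K0 : 0 <= K := le_trans (normr_ge0 _) (uK 0).
exists (K * 8); split => [|t t0]; first by rewrite mulr_ge0.
have h0 : (0 : R) <= 2^-1 by rewrite invr_ge0.
have b := powR_lcosN_bound h0 (lexx _) t0; have p0 := powR_ge0 (lcos t) (- 2^-1).
rewrite /H normrM ger0_norm// (le_trans (ler_wpM2l p0 (lK _ _)))//.
have -> : x - t - (x + t) = - (2 * t) by ring.
have [t1 _] := andP t0; rewrite normrN ger0_norm ?mulr_ge0 ?(ltW t1)//.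
have -> : lcos t `^ (- 2^-1) * (K * (2 * t)) = K * (2 * (lcos t `^ (- 2^-1) * t)) by ring.
by rewrite ler_wpM2l// (_ : 8 = 2 * 4) ?ler_wpM2l// -natrM.
Qed.

Lemma integrable_powR_lcos_diff : mu.-integrable quarter (EFin \o H).
Proof.
have [M [_ hM]] := H_bound.
by apply: (integrable_bounded_quarter (M := M)) => //; exact: mH.
Qed.

Let k_bound e : 0 < e -> exists M, forall t, e < `|t| < pi / 2 -> `|k t| <= M.
Proof.
move=> e0; have [K [uK _]] := ul; have K0 : 0 <= K := le_trans (normr_ge0 _) (uK 0).
exists (4 / e * K) => t /andP[et tp].
have h0 : (0 : R) <= 2^-1 by rewrite invr_ge0.
have t0 : 0 < `|t| := lt_trans e0 et.
have := powR_lcosN_bound h0 (lexx _) (introT andP (conj t0 tp)).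
have -> : lcos `|t| = lcos t by rewrite /lcos cos_norm.
move=> b; have -> : `|k t| = lcos t `^ (- 2^-1) * `|u (x - t)|.
  by rewrite /k; case: ifP => _; rewrite ?normrN normrM (ger0_norm (powR_ge0 _ _)).
apply: ler_pM => //; rewrite ?powR_ge0//.
rewrite ler_pdivlMr// (le_trans _ b)// ler_wpM2l ?powR_ge0// ltW//.
Qed.

Let bounded_fin_integrable (D : set R) (f : R -> R) M : @measurable _ (measurableTypeR R) D ->
  (mu D < +oo)%E -> measurable_fun (D : set (measurableTypeR R)) f ->
  (forall t, D t -> `|f t| <= M) -> mu.-integrable D (EFin \o f).
Proof.
move=> mD muD mf fM; apply: measurable_bounded_integrable => //.
exists M; split; first exact: num_real.
by move=> y My t /= /fM h; apply: le_trans h (ltW My).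
Qed.

Let mu_itv_fin (a b : R) (b1 b2 : bool) : (mu [set` Interval (BSide b1 a) (BSide b2 b)] < +oo)%E.
Proof.
by rewrite lebesgue_measure_itv /=; case: ifP => _; rewrite ?ltry// -EFinB ltry.
Qed.

Lemma phi_quarter t : `|t| < pi / 2 -> phi t = Num.sg t * lcos t `^ (- 2^-1).
Proof.
move=> tp; rewrite /phi; case: ifP => // /negbT/negP[].
by move: tp; rewrite ltr_norml => /andP[h1 h2]; rewrite !ltW.
Qed.

Lemma phi_out t : pi / 2 <= `|t| -> phi t = 0.
Proof.
move=> tp; rewrite /phi; case: ifP => // /andP[h1 h2].
have : `|t| = pi / 2 by apply: le_anti; rewrite tp ler_norml h1 h2.
(* At the endpoints the cosine vanishes, and the conventions [ln 0 = 0] and [powR 0 (- 2^-1) = 0]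
   make [phi] vanish as well. *)
move=> e; rewrite -cos_norm e cos_pihalf ln0// oppr0 powR0 ?mulr0//.
Qed.

(** The kernel is odd and vanishes beyond [pi / 2], so the negative half of the truncated domain
    folds onto the positive half. *)
Lemma truncated_integral e : 0 < e -> e < pi / 2 ->
  \int[mu]_(t in [set t : R | e < `|t| <= pi]) (phi t * u (x - t)) =
  \int[mu]_(t in `]e, pi / 2[) H t.
Proof.
move=> e0 ep; set I : set R := `]e, pi / 2[%classic.
pose J : set R := `](- (pi / 2)), (- e)[%classic.
have IJ t : (I `|` J) t <-> e < `|t| < pi / 2.
  rewrite /I /J /= !in_itv /=; split.
    move=> [/andP[h1 h2]|/andP[h1 h2]].
      by rewrite ger0_norm ?h1// ltW// (lt_trans e0).
    have t0 : t < 0 by rewrite (lt_trans h2)// oppr_lt0.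
    by rewrite ltr0_norm// ltrNr h2 ltrNl h1.
  have [t0|t0] := leP 0 t; first by rewrite ger0_norm//; left.
  by rewrite ltr0_norm// ltrNr ltrNl andbC; right.
have p2 := pihalf_le_pi R.
have mI : @measurable _ (measurableTypeR R) I by exact: measurable_itv.
have mJ : @measurable _ (measurableTypeR R) J by exact: measurable_itv.
have -> : \int[mu]_(t in [set t : R | e < `|t| <= pi]) (phi t * u (x - t)) =
    \int[mu]_(t in I `|` J) k t.
  rewrite Rintegral_mkcond [RHS]Rintegral_mkcond; apply: eq_Rintegral => t _.
  rewrite !patchE; case: (boolP (t \in I `|` J)) => [|tIJ].
    rewrite inE => /IJ/andP[h1 h2].
    rewrite ifT ?inE /= ?h1 ?(ltW (lt_le_trans h2 p2))// phi_quarter// /k.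
    have [t0|t0|t0] := ltgtP t 0.
    - by rewrite ltr0_sg// mulN1r mulNr.
    - by rewrite gtr0_sg// mul1r.
    - by move: h1; rewrite t0 normr0 => /(lt_trans e0); rewrite ltxx.
  case: ifPn => //; rewrite inE /= => /andP[h1 h2].
  rewrite phi_out ?mul0r// leNgt; apply: contraNN tIJ => h3.
  by rewrite inE; apply/IJ; rewrite h1.
have [M kM] := k_bound e0.
have kU : mu.-integrable (I `|` J) (EFin \o k).
  apply: (bounded_fin_integrable (M := M)); first exact: measurableU.
  - apply: (@le_lt_trans _ _ (mu I + mu J)%E); first exact: measureU2.
    by rewrite lte_add_pinfty ?mu_itv_fin.
  - exact: mk.
  - by move=> t /IJ; exact: kM.
have kI : mu.-integrable I (EFin \o k).
  by apply: integrableS kU; [exact: measurableU|exact: mI|left].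
have JE : (-%R : R -> R) @^-1` J = I.
  by apply/seteqP; split => t; rewrite /I /J /= !in_itv /= !ltrN2 andbC.
have kNI : mu.-integrable I (EFin \o (fun t => k (- t))).
  apply: (bounded_fin_integrable (M := M)) ; [exact: mI|exact: mu_itv_fin|exact: mkN|].
  by move=> t It; apply: kM; rewrite normrN; apply/IJ; left.
rewrite Rintegral_setU//; last first.
  apply/disj_setPS => t []; rewrite /I /J /= !in_itv /= => /andP[h1 _] /andP[_ h2].
  have := lt_trans (lt_trans e0 h1) h2; rewrite oppr_gt0 => /(lt_trans e0).
  by rewrite ltxx.
rewrite (Rintegral_opp mJ (@mk setT)) JE//.
rewrite -RintegralD//.
apply: eq_Rintegral => t; rewrite inE /I /= in_itv /= => /andP[h1 _].
have t0 := lt_trans e0 h1; rewrite /k /H opprK oppr_gt0 t0 ltNge (ltW t0) /=.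
have -> : lcos (- t) = lcos t by rewrite /lcos cosN.
by ring.
Qed.

(** The Lipschitz bound on [u] compensates the singularity of order [1 / t], so [H] is bounded and
    the truncation at [e] misses at most a multiple of [e]. The limit therefore exists at every
    point. *)
Lemma principal_value :
  \int[mu]_(t in [set t : R | e < `|t| <= pi]) (phi t * u (x - t)) @[e --> 0^'+]
  --> \int[mu]_(t in quarter) H t.
Proof.
have [M [M0 HM]] := H_bound; have p0 := pihalf_gt0 R.
apply/cvgrPdist_le => d d0; near=> e.
have e0 : 0 < e by near: e; exact: nbhs_right_gt.
have ep : e < pi / 2 by near: e; exact: nbhs_right_lt.
have ed : e < d / (M + 1) by near: e; apply: nbhs_right_lt; rewrite divr_gt0// ltr_wpDl.
rewrite truncated_integral//.
rewrite -(@Rintegral_itvB _ H (BRight 0) (BLeft (pi / 2)) e) ?bnd_simp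
  ?(ltW e0)//; last exact: integrable_powR_lcos_diff.
rewrite /quarter opprB addrCA subrr addr0.
have Hi : mu.-integrable `]0, e] (EFin \o H).
  apply: integrableS integrable_powR_lcos_diff; [exact: measurable_quarter|exact: measurable_itv|].
  by apply: subset_itvl; rewrite bnd_simp.
apply: le_trans (le_normr_Rintegral _ Hi) _; first exact: measurable_itv.
apply: (@le_trans _ _ (\int[mu]_(t in `]0, e]) M)).
  apply: le_Rintegral; first exact: measurable_itv.
  - exact: (integrable_norm Hi).
  - apply: (bounded_fin_integrable (M := M));
      [exact: measurable_itv|exact: mu_itv_fin|exact: measurable_cst|].
    by move=> t _; rewrite ger0_norm.
  - by move=> t; rewrite /= in_itv /= => /andP[t0 te]; apply: HM; rewrite t0 (le_lt_trans te).
rewrite Rintegral_cst; last exact: measurable_itv.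
have me : fine (mu `]0, e]%classic) = e.
  by rewrite lebesgue_measure_itv /= lte_fin e0 /= subr0.
rewrite [X in _ * X]me.
apply: le_trans (ler_wpM2l M0 (ltW ed)) _.
rewrite mulrCA ler_piMr ?(ltW d0)// ler_pdivrMr ?ltr_wpDl// mul1r.
by rewrite lerDl.
Unshelve. all: by end_near. Qed.

End PrincipalValue.

(** * Integrals of matrix combinations and matrix-valued principal values *)

Section LinearCombinations.
Variable R : realType.
Local Notation mu := (@lebesgue_measure R).
Local Notation C := R[i].

Lemma Rintegral_lincomb (I : finType) (D : set R) (b : I -> R) (f : I -> R -> R) :
  @measurable _ (measurableTypeR R) D ->
  (forall k, mu.-integrable D (EFin \o f k)) ->
  mu.-integrable D (EFin \o (fun t => \sum_k b k * f k t)) /\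
  \int[mu]_(t in D) (\sum_k b k * f k t) = \sum_k b k * \int[mu]_(t in D) f k t.
Proof.
move=> mD fi; elim: (index_enum I) => [|k s [IH1 IH2]].
  under eq_fun do rewrite big_nil; split; last by rewrite big_nil Rintegral_cst// mul0r.
  exact: integrable0.
have bi : mu.-integrable D (EFin \o (fun t => b k * f k t)).
  exact: (integrableZl mD (b k) (fi k)).
split.
  under eq_fun do rewrite big_cons.
  exact: (integrableD mD bi IH1).
under eq_Rintegral do rewrite big_cons.
by rewrite RintegralD// RintegralZl// IH2 big_cons.
Qed.

Lemma Re_sum (I : Type) (r : seq I) (P : pred I) (F : I -> C) :
  complex.Re (\sum_(k <- r | P k) F k) = \sum_(k <- r | P k) complex.Re (F k).
Proof. by apply: (big_morph (@complex.Re R)) => // -[a b] [c d]. Qed.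

Lemma Im_sum (I : Type) (r : seq I) (P : pred I) (F : I -> C) :
  complex.Im (\sum_(k <- r | P k) F k) = \sum_(k <- r | P k) complex.Im (F k).
Proof. by apply: (big_morph (@complex.Im R)) => // -[a b] [c d]. Qed.

Lemma ImM_real (a : R) (z : C) : complex.Im (a%:C * z) = a * complex.Im z.
Proof. by case: z => x y; rewrite /= mul0r addr0. Qed.

Lemma complex_ext (z w : C) : complex.Re z = complex.Re w -> complex.Im z = complex.Im w -> z = w.
Proof. by case: z => a b; case: w => c d /= -> ->. Qed.

(** A pointwise identity between two matrix combinations is integrated by testing real and imaginary
    parts of entries. It serves to carry conjugations and conditional expectations through the
    integrals that define [Lphi]. *)
Lemma lincomb_mx_transfer N (K L : finType) (D : set R) (B : K -> 'M[C]_N) (E : L -> 'M[C]_N)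
    (w : R -> R) (f : K -> R -> R) (h : L -> R -> R) :
  @measurable _ (measurableTypeR R) D ->
  (forall k, mu.-integrable D (EFin \o (fun t => w t * f k t))) ->
  (forall l, mu.-integrable D (EFin \o (fun t => w t * h l t))) ->
  (forall t, D t -> \sum_k (f k t)%:C *: B k = \sum_l (h l t)%:C *: E l) ->
  \sum_k (\int[mu]_(t in D) (w t * f k t))%:C *: B k =
  \sum_l (\int[mu]_(t in D) (w t * h l t))%:C *: E l.
Proof.
move=> mD fi hi fh.
have entry (J : finType) (r : J -> R) (M : J -> 'M[C]_N) i j :
    (\sum_k (r k)%:C *: M k) i j = \sum_k (r k)%:C * M k i j.
  by rewrite summxE; apply: eq_bigr => k _; rewrite mxE.
have key (p : C -> R) : (forall (J : finType) (r : J -> R) (z : J -> C),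
      p (\sum_k (r k)%:C * z k) = \sum_k p (z k) * r k) ->
    forall i j, p ((\sum_k (\int[mu]_(t in D) (w t * f k t))%:C *: B k) i j) =
      p ((\sum_l (\int[mu]_(t in D) (w t * h l t))%:C *: E l) i j).
  move=> pE i j; rewrite !entry !pE.
  have [_ <-] := Rintegral_lincomb (fun k => p (B k i j)) mD fi.
  have [_ <-] := Rintegral_lincomb (fun l => p (E l i j)) mD hi.
  apply: eq_Rintegral => t /set_mem Dt.
  have := congr1 (fun M : 'M[C]_N => p (M i j)) (fh t Dt).
  rewrite /= !entry !pE => e.
  transitivity (w t * \sum_k p (B k i j) * f k t).
    by rewrite mulr_sumr; apply: eq_bigr => k _; ring.
  by rewrite e mulr_sumr; apply: eq_bigr => k _; ring.
apply/matrixP => i j; apply: complex_ext; apply: key => J r z.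
  by rewrite Re_sum; apply: eq_bigr => k _; rewrite ReM_real mulrC.
by rewrite Im_sum; apply: eq_bigr => k _; rewrite ImM_real mulrC.
Qed.

End LinearCombinations.

Section LipschitzMatrices.
Variables (R : realType) (N : nat).
Local Notation C := R[i].
Implicit Types (F G : R -> 'M[C]_N).

Definition mx_lipschitz G := forall i j,
  bounded_lipschitz (fun x => complex.Re (G x i j)) /\
  bounded_lipschitz (fun x => complex.Im (G x i j)).

Lemma mx_lipschitz_cst (M : 'M[C]_N) : mx_lipschitz (fun=> M).
Proof. by move=> i j; split; exact: bounded_lipschitz_cst. Qed.

Lemma mx_lipschitzD F G : mx_lipschitz F -> mx_lipschitz G -> mx_lipschitz (fun x => F x + G x).
Proof.
have ReD (z w : C) : complex.Re (z + w) = complex.Re z + complex.Re w by case: z; case: w.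
have ImD (z w : C) : complex.Im (z + w) = complex.Im z + complex.Im w by case: z; case: w.
move=> Fl Gl i j; have [f1 f2] := Fl i j; have [g1 g2] := Gl i j; split.
  under eq_fun do rewrite mxE ReD; exact: bounded_lipschitzD.
under eq_fun do rewrite mxE ImD; exact: bounded_lipschitzD.
Qed.

Lemma mx_lipschitz_real (f : R -> R) G : bounded_lipschitz f -> mx_lipschitz G ->
  mx_lipschitz (fun x => (f x)%:C *: G x).
Proof.
move=> fl Gl i j; have [g1 g2] := Gl i j; split.
  under eq_fun do rewrite mxE ReM_real; exact: bounded_lipschitzM.
under eq_fun do rewrite mxE ImM_real; exact: bounded_lipschitzM.
Qed.

Lemma mx_lipschitzM F G : mx_lipschitz F -> mx_lipschitz G -> mx_lipschitz (fun x => F x *m G x).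
Proof.
have ReM (z w : C) : complex.Re (z * w) = complex.Re z * complex.Re w - complex.Im z * complex.Im w.
  by case: z; case: w.
have ImM (z w : C) : complex.Im (z * w) = complex.Re z * complex.Im w + complex.Im z * complex.Re w.
  by case: z; case: w.
move=> Fl Gl i j; split.
  under eq_fun do rewrite mxE Re_sum; apply: bounded_lipschitz_sum => k.
  have [f1 f2] := Fl i k; have [g1 g2] := Gl k j.
  under eq_fun do rewrite ReM; apply: bounded_lipschitzD; first exact: bounded_lipschitzM.
  exact/bounded_lipschitzN/bounded_lipschitzM.
under eq_fun do rewrite mxE Im_sum; apply: bounded_lipschitz_sum => k.
have [f1 f2] := Fl i k; have [g1 g2] := Gl k j.
under eq_fun do rewrite ImM; apply: bounded_lipschitzD; exact: bounded_lipschitzM.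
Qed.

Lemma mx_lipschitz_adj G : mx_lipschitz G -> mx_lipschitz (fun x => (G x) ^t*).
Proof.
move=> Gl i j; have [g1 g2] := Gl j i; split.
  have -> : (fun x => complex.Re (((G x) ^t*) i j)) = (fun x => complex.Re (G x j i)).
    by apply/funext => x; rewrite !mxE; case: (G x j i).
  exact: g1.
have -> : (fun x => complex.Im (((G x) ^t*) i j)) = (fun x => - complex.Im (G x j i)).
  by apply/funext => x; rewrite !mxE; case: (G x j i).
exact: bounded_lipschitzN.
Qed.

Lemma mx_lipschitz_measurable G : mx_lipschitz G ->
  mx_measurable (@measurable _ (measurableTypeR R)) G.
Proof.
move=> Gl i j B mB; have [g1 g2] := Gl i j; split.
  have := bounded_lipschitz_measurable (D := setT) g1 measurableT mB.
  by rewrite setTI.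
have := bounded_lipschitz_measurable (D := setT) g2 measurableT mB.
by rewrite setTI.
Qed.

(** Coordinates over the reals, indexed by an entry and by the choice of its real or imaginary part,
    because [Lphi] is defined by separate limits of these parts. *)
Definition coord_mx (M : 'M[C]_N) (k : 'I_N * 'I_N * bool) : R :=
  if k.2 then complex.Re (M k.1.1 k.1.2) else complex.Im (M k.1.1 k.1.2).
Definition basis_mx (k : 'I_N * 'I_N * bool) : 'M[C]_N :=
  (if k.2 then 1 else 'i%C) *: delta_mx k.1.1 k.1.2.

Lemma coord_mx_sum (M : 'M[C]_N) : M = \sum_k (coord_mx M k)%:C *: basis_mx k.
Proof.
rewrite -(pair_big xpredT xpredT (fun p b => (coord_mx M (p, b))%:C *: basis_mx (p, b))) /=.
rewrite -(pair_big xpredT xpredT (fun i j =>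
  \sum_(b : bool) (coord_mx M (i, j, b))%:C *: basis_mx (i, j, b))) /=.
rewrite [LHS]matrix_sum_delta; apply: eq_bigr => i _; apply: eq_bigr => j _.
rewrite big_bool /coord_mx /basis_mx /= !scalerA -scalerDl mulr1; congr (_ *: _).
rewrite [RHS]addrC; case: (M i j) => a b; apply/eqP; rewrite eq_complex /=.
by apply/andP; split; apply/eqP; ring.
Qed.

Lemma coord_mx_sumB (M1 M2 : 'M[C]_N) :
  \sum_k (coord_mx M1 k - coord_mx M2 k)%:C *: basis_mx k = M1 - M2.
Proof.
apply: etrans (esym (f_equal2 (fun A B => A - B) (coord_mx_sum M1) (coord_mx_sum M2))).
by rewrite -sumrB; apply: eq_bigr => k _; rewrite rmorphB scalerBl.
Qed.

Lemma coord_mx_lipschitz G k : mx_lipschitz G -> bounded_lipschitz (fun x => coord_mx (G x) k).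
Proof. by move=> Gl; rewrite /coord_mx; have [g1 g2] := Gl k.1.1 k.1.2; case: (k.2). Qed.

Lemma LphiE G x : mx_lipschitz G -> Lphi G x = \sum_k
  (\int[@lebesgue_measure R]_(t in @quarter R) (lcos t `^ (- 2^-1) *
     (coord_mx (G (x - t)) k - coord_mx (G (x + t)) k)))%:C *: basis_mx k.
Proof.
move=> Gl; rewrite [LHS]coord_mx_sum; apply: eq_bigr => k _; congr (_%:C *: _).
case: k => [[i j] b]; have [g1 g2] := Gl i j.
pose S (e : R) : set R := [set t : R | e < `|t| <= pi].
case: b; rewrite /coord_mx /Lphi mxE /=; apply: cvg_lim => //.
  have -> : (fun e => complex.Re (mx_integral (@lebesgue_measure R) (S e)
      (fun t => (phi t)%:C *: G (x - t)) i j)) =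
      (fun e => \int[@lebesgue_measure R]_(t in S e) (phi t * complex.Re (G (x - t) i j))).
    apply/funext => e; rewrite mxE /=; apply: eq_Rintegral => t _.
    by rewrite mxE ReM_real.
  exact: (principal_value (x := x) g1).
have -> : (fun e => complex.Im (mx_integral (@lebesgue_measure R) (S e)
    (fun t => (phi t)%:C *: G (x - t)) i j)) =
    (fun e => \int[@lebesgue_measure R]_(t in S e) (phi t * complex.Im (G (x - t) i j))).
  apply/funext => e; rewrite mxE /=; apply: eq_Rintegral => t _.
  by rewrite mxE ImM_real.
exact: (principal_value (x := x) g2).
Qed.

End LipschitzMatrices.

(** * Transference along the rotations *)

Section Transference.
Variables (R : realType) (N n : nat).
Local Notation C := R[i].
Local Notation mu := (@lebesgue_measure R).
Local Notation quarter := (@quarter R).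
Variables (Q P : 'I_n -> 'M[C]_N) (Gam : 'M[C]_N).
Hypothesis cliff : clifford Q P Gam.
Variables (nrm : ('I_N -> R) -> R) (rnE : symmetric_norm nrm).
Implicit Types (t : {set 'I_n} -> C) (A : {set 'I_n}).

Local Opaque schatten.

Definition multiplier (c : nat -> R) t : 'M[C]_N :=
  \sum_(A : {set 'I_n}) ((c #|A|)%:C : C) *: (t A *: Qword Q A).

(* Integrating a Hahn-Banach functional avoids vector-valued integrals. *)
Lemma multiplier_le (m : R -> R) (c : nat -> R) t :
  (forall s, 0 <= m s) ->
  (forall k, mu.-integrable quarter (EFin \o (fun s => m s * dcos k s))) ->
  (forall k, \int[mu]_(s in quarter) (m s * dcos k s) = c k) ->
  mu.-integrable quarter (EFin \o (fun s => m s * schatten nrm (deriv Q P t))) ->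
  schatten nrm (multiplier c t) <=
  \int[mu]_(s in quarter) (m s * schatten nrm (deriv Q P t)).
Proof.
move=> m0 mi mc mX.
pose p (x : {set 'I_n} -> R) := schatten nrm
  (\sum_(A : {set 'I_n}) ((x A)%:C : C) *: (t A *: Qword Q A)).
have pD x y : p (fun A => x A + y A) <= p x + p y.
  apply: le_trans (schattenD rnE _ _); rewrite -big_split /p /=.
  rewrite le_eqVlt; apply/orP; left; apply/eqP; congr (schatten nrm _).
  by apply: eq_bigr => A _; rewrite rmorphD scalerDl.
have pZ s x : 0 <= s -> p (fun A => s * x A) <= s * p x.
  move=> s0; rewrite -{2}(ger0_norm s0) -normc_real /p -(schattenZ rnE) scaler_sumr.
  rewrite le_eqVlt; apply/orP; left; apply/eqP; congr (schatten nrm _).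
  by apply: eq_bigr => A _; rewrite rmorphM -scalerA.
(* [p] is the norm as a function of real multipliers of the fixed coefficients. A functional
   supporting it at [c] turns the claim into the comparison of two scalar integrals. *)
have [a [ap ax]] := hahn_banach_fin (fun A => c #|A|) pD pZ.
have -> : schatten nrm (multiplier c t) = p (fun A => c #|A|) by [].
rewrite -ax.
have [li lE] := Rintegral_lincomb a (@measurable_quarter R) (fun A => mi #|A|).
rewrite (eq_bigr (fun A : {set 'I_n} =>
  a A * \int[mu]_(s in quarter) (m s * dcos #|A| s))); last first.
  by move=> A _; rewrite mc.
rewrite -lE; apply: le_Rintegral; [exact: measurable_quarter|exact: li|exact: mX|].
move=> s _; have -> : \sum_(A : {set 'I_n}) a A * (m s * dcos #|A| s) =
    m s * \sum_(A : {set 'I_n}) a A * dcos #|A| s.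
  by rewrite mulr_sumr; apply: eq_bigr => A _; ring.
apply: ler_wpM2l; first exact: m0.
by apply: le_trans (ap _) _; exact: (schatten_cexp_rot_deriv cliff rnE t s).
Qed.

Let dcos0 s : dcos 0 s = 0 :> R.
Proof. by rewrite /dcos mul0r. Qed.

Lemma multiplier_mean t :
  schatten nrm (multiplier (fun k => if k == 0%N then 0 else 1) t) <=
  pi / 2 * schatten nrm (deriv Q P t).
Proof.
have -> : pi / 2 * schatten nrm (deriv Q P t) =
    \int[mu]_(s in quarter) (1 * schatten nrm (deriv Q P t)).
  rewrite mul1r Rintegral_cst; last exact: measurable_quarter.
  have -> : fine (mu quarter) = pi / 2.
    by rewrite /quarter lebesgue_measure_itv /= lte_fin pihalf_gt0 /= subr0.
  by rewrite mulrC.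
apply: multiplier_le => [s|k|k|]; first exact: ler01.
- under eq_fun do rewrite mul1r.
  apply: (integrable_bounded_quarter (M := k%:R * 2)); first exact: measurable_dcos.
  move=> s s0; have /andP[d0 d1] := dcos_bound k s0; rewrite ger0_norm//.
  apply: le_trans d1 _; apply: ler_wpM2l => //; have [_ s1] := andP s0.
  by apply/ltW/(lt_trans s1); exact: pihalf_lt2.
- under eq_Rintegral do rewrite mul1r.
  case: k => [|k] /=; last exact: integral_dcos.
  by under eq_Rintegral do rewrite dcos0; rewrite Rintegral_cst ?mul0r//; exact: measurable_quarter.
- under eq_fun do rewrite mul1r.
  apply: (integrable_bounded_quarter (M := schatten nrm (deriv Q P t))).
    exact: measurable_cst.
  by move=> s _; rewrite ger0_norm//; exact: (schatten_ge0 rnE).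
Qed.

(** Integrability is assumed here so that the exponent 1/2 is covered when the derivation vanishes;
    [multiplier_HE] uses it in that degenerate case. *)
Lemma multiplier_lcos a t : 0 <= a -> a <= 2^-1 ->
  mu.-integrable quarter (EFin \o (fun s => lcos s `^ (- a) * schatten nrm (deriv Q P t))) ->
  schatten nrm (multiplier (fun k => if k == 0%N then 0 else k%:R `^ a) t) * Gamma (1 - a) <=
  \int[mu]_(s in quarter) (lcos s `^ (- a) * schatten nrm (deriv Q P t)).
Proof.
move=> a0 a1 iX; have G0 : 0 <= Gamma (1 - a) :> R by exact/ltW/Gamma_gt0.
have -> : schatten nrm (multiplier (fun k => if k == 0%N then 0 else k%:R `^ a) t) * Gamma (1 - a) =
    schatten nrm (multiplier (fun k => if k == 0%N then 0 else k%:R `^ a * Gamma (1 - a)) t).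
  rewrite mulrC -{1}(ger0_norm G0) -normc_real -(schattenZ rnE); congr (schatten nrm _).
  rewrite scaler_sumr; apply: eq_bigr => A _; rewrite scalerA -rmorphM; congr (_%:C *: _).
  by case: ifP => _; rewrite ?mulr0// mulrC.
apply: multiplier_le => [s|k|k|//]; first exact: powR_ge0.
- exact: integrable_powR_dcos.
- case: k => [|k] /=; last exact: integral_powR_dcos.
  under eq_Rintegral do rewrite dcos0 mulr0.
  by rewrite Rintegral_cst ?mul0r//; exact: measurable_quarter.
Qed.

Definition orbit t (x : R) : 'M[C]_N := Ad (rot Q P (- x)) (deriv Q P t).

Lemma orbit_lipschitz t : mx_lipschitz (orbit t).
Proof.
have rl : mx_lipschitz (fun x => rot Q P (- x)).
  rewrite /rot; elim: (index_enum _) => [|j s IH].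
    by under eq_fun do rewrite word_nil; exact: mx_lipschitz_cst.
  under eq_fun do rewrite word_cons; apply: mx_lipschitzM => //.
  have h (f : R -> R) : bounded_lipschitz f -> bounded_lipschitz (fun x => f (- x / 2)).
    move=> /(bounded_lipschitz_scale (- 2^-1)).
    by under eq_fun do rewrite mulNr mulrC -mulNr.
  apply: mx_lipschitzD; last first.
    apply: mx_lipschitz_real; last exact: mx_lipschitz_cst.
    exact: h (bounded_lipschitz_sin R).
  under eq_fun do rewrite -scalemx1.
  apply: mx_lipschitz_real; last exact: mx_lipschitz_cst.
  exact: h (bounded_lipschitz_cos R).
apply: mx_lipschitzM; last exact: mx_lipschitz_adj.
by apply: mx_lipschitzM => //; exact: mx_lipschitz_cst.
Qed.

Lemma Ad_deriv V t : Ad V (deriv Q P t) =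
  \sum_(A : {set 'I_n}) t A *: \sum_(j in A) Ad V (dword Q P A j).
Proof.
by rewrite /deriv Ad_sum; apply: eq_bigr => A _; rewrite AdZ Ad_sum.
Qed.

Lemma deriv_scale (c : C) t : deriv Q P (fun A => c * t A) = c *: deriv Q P t.
Proof. by rewrite /deriv scaler_sumr; apply: eq_bigr => A _; rewrite scalerA. Qed.

Let AdB (V S T : 'M[C]_N) : Ad V (S - T) = Ad V S - Ad V T.
Proof. by rewrite AdD AdN. Qed.

Local Opaque Ad rot deriv cexp dword.

Lemma Ad_rot_deriv_add t (a b : R) :
  Ad (rot Q P a) (Ad (rot Q P b) (deriv Q P t)) = Ad (rot Q P (a + b)) (deriv Q P t).
Proof.
rewrite -Ad_comp (Ad_deriv (_ *m _)) (Ad_deriv (rot Q P (a + b))); apply: eq_bigr => A _.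
by congr (_ *: _); apply: eq_bigr => j _; rewrite Ad_comp; exact: (Ad_rotD cliff).
Qed.

(** With half angles, a full turn changes each factor of [rot] by a sign; conjugation removes it, so
    the period is read on the rotated words. *)
Lemma orbit_periodic t x : orbit t (x + 2 * pi) = orbit t x.
Proof.
have e : - x = - (x + 2 * pi) + 2 * pi by ring.
rewrite /orbit e; move: (- (x + 2 * pi)) => a.
rewrite (Ad_deriv (rot Q P a)) (Ad_deriv (rot Q P (a + _))); apply: eq_bigr => A _.
apply: (f_equal (fun M => t A *: M)); apply: eq_bigr => j _.
exact: esym (Ad_rot_2pi cliff a A (fun k => (k != j)%:R) (fun k => (k == j)%:R)).
Qed.

Lemma schatten_orbit t x : schatten nrm (orbit t x) = schatten nrm (deriv Q P t).
Proof. exact: (schatten_Ad rnE _ (unitary_rot cliff _)). Qed.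

Let diff t x k (s : R) : R :=
  coord_mx (orbit t (x - s)) k - coord_mx (orbit t (x + s)) k.

Let diff_integrable t x k : mu.-integrable quarter
  (EFin \o (fun s => lcos s `^ (- 2^-1) * diff t x k s)).
Proof. exact: (integrable_powR_lcos_diff x (coord_mx_lipschitz k (orbit_lipschitz t))). Qed.

Let diff_sum t x s : \sum_k ((diff t x k s)%:C : C) *: basis_mx R k =
  orbit t (x - s) - orbit t (x + s).
Proof.
exact: coord_mx_sumB.
Qed.

(** Conjugation by [rot x] sends [orbit t y] to [orbit t (y - x)], and [Lphi] commutes with
    translations. Hence the norm of [Lphi (orbit t)] is constant on the circle, and its L^2 norm is
    a matrix norm up to a factor. *)
Lemma Ad_rot_Lphi t x : Ad (rot Q P x) (Lphi (orbit t) x) = Lphi (orbit t) 0.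
Proof.
rewrite (LphiE x (orbit_lipschitz t)) (LphiE 0 (orbit_lipschitz t)) Ad_sum.
under eq_bigr => k _ do rewrite AdZ.
apply: (lincomb_mx_transfer (f := diff t x) (h := diff t 0)).
- exact: measurable_quarter.
- exact: diff_integrable.
- exact: diff_integrable.
move=> s _; transitivity (orbit t (0 - s) - orbit t (0 + s)); last exact/esym/diff_sum.
transitivity (Ad (rot Q P x) (\sum_k (diff t x k s)%:C *: basis_mx R k)).
  by rewrite Ad_sum; apply: eq_bigr => k _; exact/esym/AdZ.
have e := diff_sum t x s; rewrite [X in Ad _ X]e AdB.
apply: (f_equal2 (fun S T : 'M[C]_N => S - T)).
  apply: etrans (Ad_rot_deriv_add t x (- (x - s))) _.
  by have -> : x + - (x - s) = - (0 - s) by ring.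
apply: etrans (Ad_rot_deriv_add t x (- (x + s))) _.
by have -> : x + - (x + s) = - (0 + s) by ring.
Qed.

Lemma schatten_Lphi t x : schatten nrm (Lphi (orbit t) x) = schatten nrm (Lphi (orbit t) 0).
Proof. by rewrite -(Ad_rot_Lphi t x); exact/esym/(schatten_Ad rnE _ (unitary_rot cliff _)). Qed.

Let cexpB S T : cexp P Gam (S - T) = cexp P Gam S - cexp P Gam T.
Proof. by rewrite cexpD -(scaleN1r T) cexpZ scaleN1r. Qed.

(** At 0 the symmetric difference of the orbit compares the rotations by [s] and [- s]. As [dcos] is
    odd in [s], the expectation doubles it, and the Gamma integral at exponent 1/2 converts it into
    the square root of the degree. *)
Lemma cexp_Lphi t : cexp P Gam (Lphi (orbit t) 0) =
  ((- (2 * Gamma 2^-1))%:C : C) *: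
    multiplier (fun k => if k == 0%N then 0 else k%:R `^ 2^-1) t.
Proof.
have h0 : (0 : R) <= 2^-1 by rewrite invr_ge0.
have dN k s : dcos k (- s) = - dcos k s :> R by rewrite /dcos sinN cosN; ring.
have wd k : mu.-integrable quarter (EFin \o (fun s => lcos s `^ (- 2^-1) * (- 2 * dcos k s))).
  have := integrableZl (@measurable_quarter R) (- 2) (integrable_powR_dcos k h0 (lexx _)).
  by apply: eq_integrable => [|s _]; [exact: measurable_quarter|rewrite /= -EFinM mulrCA].
rewrite (LphiE 0 (orbit_lipschitz t)) cexp_sum.
under eq_bigr => k _ do rewrite cexpZ.
transitivity (\sum_(A : {set 'I_n}) ((\int[mu]_(s in quarter)
    (lcos s `^ (- 2^-1) * (- 2 * dcos #|A| s)))%:C : C) *: (t A *: Qword Q A)).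
  apply: (lincomb_mx_transfer (f := diff t 0) (h := fun A s => - 2 * dcos #|A| s)).
  - exact: measurable_quarter.
  - exact: diff_integrable.
  - by move=> A; exact: wd.
  move=> s _; transitivity (cexp P Gam (\sum_k (diff t 0 k s)%:C *: basis_mx R k)).
    by rewrite cexp_sum; apply: eq_bigr => k _; exact/esym/cexpZ.
  have e := diff_sum t 0 s; rewrite [X in cexp _ _ X]e cexpB /orbit sub0r add0r opprK.
  apply: etrans (f_equal2 (fun S T : 'M[C]_N => S - T) (cexp_rot_deriv cliff t s)
    (cexp_rot_deriv cliff t (- s))) _.
  apply: etrans (esym (sumrB _ _ _ _)) _; apply: eq_bigr => A _.
  rewrite -scalerBl -rmorphB; congr (_%:C *: _).
  by have := dN #|A| s; rewrite /dcos => ->; ring.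
rewrite scaler_sumr; apply: eq_bigr => A _; rewrite [RHS]scalerA -rmorphM; congr (_%:C *: _).
transitivity (\int[mu]_(s in quarter) (- 2 * (lcos s `^ (- 2^-1) * dcos #|A| s))).
  by apply: eq_Rintegral => s _; rewrite mulrCA.
rewrite RintegralZl; [|exact: measurable_quarter|exact: integrable_powR_dcos].
case: ifP => [/eqP ->|/negbT c0].
  under eq_Rintegral do rewrite dcos0 mulr0.
  by rewrite Rintegral_cst ?mul0r ?mulr0//; exact: measurable_quarter.
rewrite integral_powR_dcos ?lt0n//.
by have -> : 1 - 2^-1 = 2^-1 :> R by [lra]; ring.
Qed.

Lemma circle_L2norm_cst (g : R -> 'M[C]_N) (r : R) : 0 <= r ->
  (forall x, schatten nrm (g x) = r) ->
  circle_L2norm (schatten nrm) g = (r * Num.sqrt (2 * pi))%:E.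
Proof.
move=> r0 gr; rewrite /circle_L2norm /Lp_norm.
have p0 : 0 <= 2 * pi :> R by rewrite mulr_ge0 ?pi_ge0.
under eq_integral do rewrite gr.
rewrite integral_cst /=; last exact: measurable_itv.
rewrite lebesgue_measure_itv /= lte_fin mulr_gt0 ?pi_gt0// -EFinB subr0 -EFinM poweR_EFin.
suff -> : (r `^ 2 * (2 * pi)) `^ 2^-1 = r * Num.sqrt (2 * pi) by [].
rewrite powR12_sqrt; last by rewrite !mulr_ge0 ?powR_ge0 ?pi_ge0.
by rewrite (powR_mulrn 2 r0) sqrtrM ?exprn_ge0// sqrtr_sqr ger0_norm.
Qed.

(** The assumed bound puts the orbit in the unit ball of L^2, so it is an admissible test function;
    [cexp] is a contraction and extracts the multiplier from its image. *)
Lemma Lphi_opnorm_ge t : schatten nrm (deriv Q P t) <= (Num.sqrt (2 * pi))^-1 ->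
  ((2 * Gamma 2^-1 * Num.sqrt (2 * pi) *
    schatten nrm (multiplier (fun k => if k == 0%N then 0 else k%:R `^ 2^-1) t))%:E
   <= Lphi_opnorm (schatten nrm))%E.
Proof.
have s0 : 0 < Num.sqrt (2 * pi) :> R by rewrite sqrtr_gt0 mulr_gt0 ?pi_gt0.
move=> X1; have ball : circle_L2_ball (schatten nrm) (orbit t).
  split; [exact: mx_lipschitz_measurable (orbit_lipschitz t)|exact: orbit_periodic|].
  rewrite (circle_L2norm_cst (schatten_ge0 rnE (deriv Q P t)) (schatten_orbit t)).
  by rewrite lee_fin -ler_pdivlMr// div1r.
apply: (@le_trans _ _ (circle_L2norm (schatten nrm) (Lphi (orbit t)))); last first.
  by apply: ereal_sup_ubound; exists (orbit t).
rewrite (circle_L2norm_cst (schatten_ge0 rnE (Lphi (orbit t) 0)) (schatten_Lphi t)).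
rewrite lee_fin mulrAC ler_pM2r//.
apply: le_trans (schatten_cexp cliff rnE _); rewrite cexp_Lphi (schattenZ rnE) normc_real normrN.
rewrite ger0_norm// mulr_ge0//; have -> : 2^-1 = 1 - 2^-1 :> R by lra.
by apply/ltW/Gamma_gt0; rewrite // invr_ge0.
Qed.

Lemma multiplier_scale (c : C) (b : nat -> R) t :
  multiplier b (fun A => c * t A) = c *: multiplier b t.
Proof.
rewrite /multiplier scaler_sumr; apply: eq_bigr => A _; rewrite !scalerA.
by congr (_ *: _); rewrite mulrCA mulrA.
Qed.

(** The test function is the orbit rescaled by [c], which gives a lower bound for [HE], valid also
    when [HE] is infinite. Multiplied by [g], it is at least [2 * Gamma 2^-1 / s * nu], and that
    factor is at least 1. *)
Lemma multiplier_HE t (g : R) : schatten nrm (deriv Q P t) <= g ->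
  ((schatten nrm (multiplier (fun k => if k == 0%N then 0 else k%:R `^ 2^-1) t))%:E
   <= HE (schatten nrm) * g%:E)%E.
Proof.
set b := (fun k => _); set h := schatten nrm (deriv Q P t); move=> hg.
set nu := schatten nrm (multiplier b t).
have nu0 : 0 <= nu by exact: (schatten_ge0 rnE).
have h0 : 0 <= h by exact: (schatten_ge0 rnE).
have g0 := le_trans h0 hg.
have half0 : (0 : R) <= 2^-1 by rewrite invr_ge0.
have G0 : 0 < Gamma 2^-1 :> R.
  by have := Gamma_gt0 half0 (lexx _); have -> : 1 - 2^-1 = 2^-1 :> R by lra.
set s := Num.sqrt (2 * pi) : R.
have s0 : 0 < s by rewrite sqrtr_gt0 mulr_gt0 ?pi_gt0.
have q1 : 1 <= 2 * Gamma 2^-1 / s by rewrite ler_pdivlMr// mul1r; exact: Gamma_half_ge.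
pose c := (s * h)^-1; have c0 : 0 <= c by rewrite invr_ge0 mulr_ge0// ltW.
have := @Lphi_opnorm_ge (fun A => c%:C * t A).
rewrite deriv_scale multiplier_scale !(schattenZ rnE) normc_real ger0_norm// -/h -/nu -/s.
have ch : c * h <= s^-1.
  rewrite /c invfM -mulrA; have [->|hn0] := eqVneq h 0; first by rewrite !mulr0 invr_ge0 ltW.
  by rewrite mulVf// mulr1.
move=> /(_ ch) Op.
have Y0 : 0 <= s^-1 * (2 * Gamma 2^-1 * s * (c * nu)).
  have sv : 0 <= s^-1 by rewrite invr_ge0 ltW.
  have G2 := mulr_ge0 (ler0n R 2) (ltW G0).
  exact: mulr_ge0 sv (mulr_ge0 (mulr_ge0 G2 (ltW s0)) (mulr_ge0 c0 nu0)).
have sV0 : (0 <= s^-1%:E :> \bar R)%E by rewrite lee_fin invr_ge0 ltW.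
apply: (@le_trans _ _ (s^-1%:E * (2 * Gamma 2^-1 * s * (c * nu))%:E * g%:E)%E); last first.
  by apply: lee_wpmul2r; [rewrite lee_fin|exact: lee_wpmul2l].
rewrite -!EFinM lee_fin.
(* For [h = 0] the scaling [c] is the inverse of 0, that is 0, and the lower bound on [HE] carries
   no information; [multiplier_lcos] shows instead that the multiplier itself vanishes. *)
have [h00|hn0] := eqVneq h 0.
  have : nu * Gamma (1 - 2^-1) <= 0.
    have := @multiplier_lcos 2^-1 t half0 (lexx _).
    rewrite -/h h00; under eq_fun do rewrite mulr0; move=> /(_ (integrable0 _ _)).
    rewrite Rintegral_cst ?mul0r//.
    exact: measurable_quarter.
  have -> : 1 - 2^-1 = 2^-1 :> R by lra.
  rewrite pmulr_lle0// => nu00; apply: le_trans nu00 _.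
  exact: mulr_ge0 Y0 g0.
have hp : 0 < h by rewrite lt0r hn0.
apply: (@le_trans _ _ (s^-1 * (2 * Gamma 2^-1 * s * (c * nu)) * h)); last first.
  exact: ler_wpM2l Y0 _ _ hg.
have -> : s^-1 * (2 * Gamma 2^-1 * s * (c * nu)) * h = 2 * Gamma 2^-1 / s * nu.
  by rewrite /c; field; rewrite hn0 gt_eqF.
by rewrite -[leLHS]mul1r; exact: ler_wpM2r nu0 _ _ q1.
Qed.

End Transference.

Lemma Kalpha_step (R : realFieldType) (m G I h K g : R) : 0 < G -> 0 <= I ->
  m * G <= I * h -> h <= K * g -> m <= G^-1 * I * K * g.
Proof.
move=> G0 I0 mh hg; rewrite -!mulrA ler_pdivlMl// mulrC.
by apply: le_trans mh _; exact: ler_wpM2l.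
Qed.

(** * Admissible constants and conclusion *)

Section DerivConstant.
Variables (R : realType) (n : nat).

(** Both 2-convex cases give [4 * Num.sqrt q]. It is the admissible value for [L^q]; in the general
    case it is weakened to [4 * q], using [1 <= Num.sqrt q]. *)
Lemma deriv_admissible (E : symSpace R n) (K : R) t : admissible_KE 4 E K ->
  schatten (rnorm E) (deriv (@fermion R n) (@fermion_dual R n) t) <=
  K * schatten (rnorm E) (sqrtmx (grad2 (@fermion R n) t)).
Proof.
have rnE := rnorm_symmetric E.
have cl := @fermion_clifford R n.
case=> [cE|q q2 cvE cE|q q2 lq].
- rewrite mul1r; apply: (deriv_concave cl rnE).
  exact: (qconcave_superadditive _ cE).
- have q0 : 0 < q by apply: lt_le_trans q2.
  have wE := convex_concave_weights rnE q2 (pconvex_subadditive (ltr0n _ 2) cvE)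
    (qconcave_superadditive q0 cE).
  apply: le_trans (deriv_khintchine cl rnE t q2 wE) _.
  apply: ler_wpM2r; first exact: (schatten_ge0 rnE).
  apply: ler_wpM2l => //; have s1 : 1 <= Num.sqrt q.
    by rewrite -sqrtr1 ler_sqrt ?(ltW q0)// (le_trans _ q2)// ler1n.
  by rewrite -[leRHS](sqr_sqrtr (ltW q0)) expr2 ler_peMl// sqrtr_ge0.
- exact: (deriv_khintchine cl rnE t (ltW q2) (Lq_weights q2 lq)).
Qed.

End DerivConstant.

Local Close Scope sesquilinear_scope.

Theorem theorem6p1 (R : realType) :
  exists C : R, 0 < C /\
  forall (n : nat), (1 <= n)%N ->
  forall (E : symSpace R n) (K : R), admissible_KE C E K ->
  forall T : cubemx R n, fermion_alg T ->
  [/\ CEnorm E (T - ntrace T *: 1%:M) <= pi / 2 * K * CEnorm E (grad_s T),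
      (forall alpha : R, 0 < alpha -> alpha < 2^-1 ->
        CEnorm E (number_pow alpha T)
          <= Kalpha alpha * K * CEnorm E (grad_s T)) &
      (UMD (CEnorm E) ->
        ((CEnorm E (number_pow 2^-1 T))%:E
          <= HE (CEnorm E) * (K * CEnorm E (grad_s T))%:E)%E)].
Proof.
exists 4; split=> // n _ E K KE T /fermion_alg_span[t TE].
have rnE := rnorm_symmetric E; have cl := @fermion_clifford R n.
have nE : CEnorm E = schatten (rnorm E) by [].
have hX := deriv_admissible t KE.
rewrite nE (grad_sE TE); set g := schatten _ (sqrtmx _) in hX *.
pose mult (a : R) := multiplier (@fermion R n) (fun k => if k == 0%N then 0 else k%:R `^ a) t.
have powE a : number_pow a T = mult a.
  by rewrite (number_powE a TE); apply: eq_bigr => A _; rewrite cards_eq0.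
split.
- have -> : T - ntrace T *: 1%:M = multiplier (@fermion R n) (fun k => if k == 0%N then 0 else 1) t.
    by rewrite (sub_ntraceE TE); apply: eq_bigr => A _; rewrite cards_eq0.
  rewrite -mulrA; apply: le_trans (multiplier_mean cl rnE t) _.
  by apply: ler_wpM2l => //; rewrite divr_ge0 ?pi_ge0.
- move=> a a0 a1; rewrite powE.
  have ai := integrable_powR_lcos (ltW a0) a1.
  have G0 := Gamma_gt0 (ltW a0) (ltW a1).
  have := @multiplier_lcos R _ n _ _ _ cl _ rnE a t (ltW a0) (ltW a1).
  rewrite RintegralZr//; last exact: measurable_quarter.
  move=> h; have {}h := h (integrableZr (@measurable_quarter R) _ ai).
  by apply: (Kalpha_step G0 _ h hX); apply: Rintegral_ge0 => s _; exact: powR_ge0.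
- move=> _; rewrite powE; exact: (multiplier_HE cl rnE).
Qed.
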